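(* Let $(Y_t)_{t\ge 0}$ be the locally-balanced Markov jump process (LBMJP) with balancing function $g$, base kernel $\gamma$ and target distribution $\pi$, with jump rate $\lambda$ and embedded chain $X=(X_n)_{n\ge 0}$ with transition kernel $\Gamma_g$. Assume: (1) $\lambda(x)>0$ for all $x\in\mathrm{supp}(\pi)$; (2) $g$ is non-decreasing and continuous on $[0,\infty)$; (3) there is a non-trivial measure $\phi$ on $(E,\mathcal{E})$ such that for all $x\in\mathrm{supp}(\pi)$ and all $B\in\mathcal{E}$ with $\phi(B)>0$ there exists $n\in\mathbb{N}$ with $\mathbb{P}_x(X_n\in B)>0$. Then: (a) $Y$ is almost surely non-explosive for $\pi$-almost every starting state $x\in E$. (b) $Y$ is $\pi$-reversible, hence $\pi$-invariant. (c) $Y$ is ergodic for $\pi$-almost every starting state $x\in E$, meaning that for every $f:E\to\mathbb{R}$ with $f\in L^1(\pi)$, almost surely $$\lim_{t\to\infty}\frac1t\int_0^t f(Y_s)\,ds=\int_E f(x)\,\pi(dx).$$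
   Context: Let $E$ be a Polish space with Borel $\sigma$-algebra $\mathcal{E}$, $\pi$ a probability measure on $(E,\mathcal{E})$ with topological support $\mathrm{supp}(\pi)$, and $\gamma:E\times\mathcal{E}\to[0,1]$ a Markov kernel. Write $[\pi\otimes\gamma](dx,dy)=\pi(dx)\gamma(x,dy)$. The function $t:E\times E\to[0,\infty)$ is a version of the Radon--Nikodym derivative $t(x,y)=\frac{\pi(dy)\gamma(y,dx)}{\pi(dx)\gamma(x,dy)}$ such that, for some measurable $R\subset E\times E$ with $[\pi\otimes\gamma](R)=1$, one has $0<t(x,y)<\infty$ and $t(y,x)=1/t(x,y)$ for $(x,y)\in R$, and $t(x,y)=0$ for $(x,y)\notin R$. A balancing function is a (Borel) function $g:[0,\infty)\to[0,\infty)$ with $g(1)=1$, $g(0)=0$, $g(s)>0$ for $s>0$, and $g(s)=s\,g(1/s)$ for all $s>0$. Jump rate: $\lambda(x)=\int_E g(t(x,y))\,\gamma(x,dy)\in[0,\infty]$. Embedded kernel: $\Gamma_g(x,A)=\int_A \frac{g(t(x,y))}{\lambda(x)}\,\gamma(x,dy)$ (at degenerate points, where $\lambda(x)\in\{0,\infty\}$, set $\Gamma_g(x,\cdot)=\delta_x$). LBMJP started from $x\in\mathrm{supp}(\pi)$: let $X=(X_n)_{n\ge0}$ be the discrete-time Markov chain with $X_0=x$ and transition kernel $\Gamma_g$; given $X$, let $\tau_n\sim\mathrm{Exp}(\lambda(X_{n-1}))$, $n\ge1$, be conditionally independent ($\mathrm{Exp}(0)$ means $+\infty$, $\mathrm{Exp}(\infty)$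 means $0$); set $T_0=0$, $T_n=\sum_{k=1}^n\tau_k$. Then $Y_t=X_{\sup\{n:T_n\le t\}}$ if $t<\sup_n T_n$, and $Y_t=\partial$ (a graveyard state) otherwise. $\mathbb{P}_x$ denotes the law when started from $x$. The process is non-explosive if $\sum_{k\ge1}\tau_k=\infty$ almost surely. *)

(* Defs.v *)
From HB Require Import structures.
From mathcomp Require Import all_boot all_order all_algebra.
From mathcomp Require Import all_classical all_reals all_analysis.
From mathcomp Require Import measurable_realfun.
Import Order.TTheory GRing.Theory Num.Theory.
Import numFieldNormedType.Exports.

Set Implicit Arguments.
Unset Strict Implicit.
Unset Printing Implicit Defensive.

Local Open Scope classical_set_scope.
Local Open Scope ring_scope.

(* Separable and completely metrizable; the metric is existentially quantified,
   as only the topology of E is part of the data. *)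
Definition polish (R : realType) (E : topologicalType) : Prop :=
  (exists2 D : set E, countable D & dense D) /\
  exists d : E -> E -> R,
    [/\ forall x y, d x y = 0 <-> x = y,
        forall x y, d x y = d y x,
        forall x y z, d x z <= d x y + d y z,
        forall (x : E) (A : set E), nbhs x A <->
          exists2 e : R, 0 < e & [set y | d x y < e] `<=` A &
        forall u : nat -> E,
          (forall e : R, 0 < e ->
             exists N, forall m n, (N <= m)%N -> (N <= n)%N ->
               d (u m) (u n) < e) ->
          exists l : E, u @ \oo --> l].

(* A copy of E (convertible to E) with its Borel sigma-algebra. *)
Notation borel E := (g_sigma_algebraType (@open E)).

Section target_and_kernel.
Context {R : realType} {E : ptopologicalType}.
Variables (pi : probability (borel E) R) (gamma : R.-pker (borel E) ~> (borel E)).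
Local Open Scope ereal_scope.

Definition topsupp : set (borel E) := [set x | forall U : set E, open U -> U x -> 0 < pi U].

(* The measure pi (x) gamma on E * E. *)
Definition joint (A : set (borel E * borel E)) : \bar R :=
  \int[pi]_x \int[gamma x]_y (\1_A (x, y))%:E.

HB.instance Definition _ := Measure.copy joint
  (mkproduct (kprobability (@measurable_cst _ _ unit (pprobability (borel E) R)
                              setT pi))
             (kernel.kernel_snd gamma) tt).

(* The third clause says that t is a density, with respect to
   pi(dx) gamma(x, dy), of its image pi(dy) gamma(y, dx) by (x, y) |-> (y, x). *)
Definition is_ratio (t : borel E * borel E -> R) : Prop :=
  [/\ measurable_fun setT t,
      forall z, (0 <= t z)%R,
      forall A, measurable A ->
        joint [set z | A (z.2, z.1)] = \int[joint]_(z in A) (t z)%:E &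
      exists S : set (borel E * borel E),
        [/\ measurable S,
            joint S = 1,
            forall x y, S (x, y) -> (0 < t (x, y))%R /\ t (y, x) = (t (x, y))^-1%R &
            forall x y, ~ S (x, y) -> t (x, y) = 0%R]].

End target_and_kernel.

(* A function [0, +oo[ -> [0, +oo[ is represented by a function R -> R, of which
   only the values on [0, +oo[ are constrained (and used). *)
Definition balancing (R : realType) (g : R -> R) : Prop :=
  [/\ measurable_fun [set s : R | 0 <= s] g,
      g 1 = 1,
      g 0 = 0,
      forall s, 0 < s -> 0 < g s &
      forall s, 0 < s -> g s = s * g s^-1].

Section jump_process.
Context {R : realType} {E : ptopologicalType}.
Variables (gamma : R.-pker (borel E) ~> (borel E)).
Variables (t : borel E * borel E -> R) (g : R -> R).
Local Open Scope ereal_scope.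

Definition jump_rate (x : borel E) : \bar R := \int[gamma x]_y (g (t (x, y)))%:E.

Definition embedded_kernel (x : borel E) (A : set (borel E)) : \bar R :=
  if (jump_rate x == 0) || (jump_rate x == +oo) then \d_x A
  else \int[gamma x]_(y in A) (g (t (x, y)) / fine (jump_rate x))%:E.

(* Exponential law on [0, +oo]; jump rates are nonnegative, so the values for
   negative r are irrelevant. *)
Definition exp_law (r : \bar R) (B : set (\bar R)) : \bar R :=
  match r with
  | r0%:E => if r0 == 0%R then \d_(+oo : \bar R) B
             else exponential_prob r0 (EFin @^-1` B)
  | _ => \d_(0 : \bar R) B
  end.

Context {d : measure_display} {Omega : measurableType d}.
(* X n is the state after n jumps; tau n is the holding time in X n, i.e. the
   holding times are numbered from 0 instead of 1. *)
Variables (X : nat -> {mfun Omega >-> borel E}).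
Variables (tau : nat -> {mfun Omega >-> \bar R}).

Definition sigmaX (I : set nat) : set (set Omega) :=
  <<s \bigcup_(i in I) preimage_set_system setT (X i) measurable >>.

(* Under P, X is a Markov chain with kernel embedded_kernel and X 0 = x, and,
   conditionally on X, the tau k are independent with laws
   exp_law (jump_rate (X k)). *)
Definition lbmjp_from (x : borel E) (P : probability Omega R) : Prop :=
  [/\ {ae P, forall w, X 0%N w = x},
      forall n (F : set Omega) (A : set (borel E)),
        sigmaX [set i | (i <= n)%N] F -> measurable A ->
        P (F `&` X n.+1 @^-1` A) = \int[P]_(w in F) embedded_kernel (X n w) A &
      forall n (F : set Omega) (B : nat -> set (\bar R)),
        sigmaX setT F -> (forall k, measurable (B k)) ->
        P (F `&` \bigcap_(k < n) (tau k @^-1` B k)) =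
        \int[P]_(w in F) \prod_(k < n) exp_law (jump_rate (X k w)) (B k)].

Definition jump_time (n : nat) (w : Omega) : \bar R := \sum_(k < n) tau k w.

(* None is the graveyard state. *)
Definition lbmjp (u : R) (w : Omega) : option (borel E) :=
  if u%:E < ereal_sup (range (jump_time ^~ w)) then
    Some (X (supremum 0%N [set n | jump_time n w <= u%:E]) w)
  else None.

Definition lbmjp_in (u : R) (B : set (borel E)) : set Omega :=
  [set w | exists2 y, lbmjp u w = Some y & B y].

Definition nonexplosive (P : probability Omega R) : Prop :=
  {ae P, forall w, \sum_(0 <= k <oo) tau k w = +oo}.

Variables (pi : probability (borel E) R) (P : borel E -> probability Omega R).

Definition lbmjp_reversible : Prop :=
  forall u : R, (0 <= u)%R ->
  forall A B : set (borel E), measurable A -> measurable B ->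
    \int[pi]_(x in A) P x (lbmjp_in u B) = \int[pi]_(x in B) P x (lbmjp_in u A).

Definition lbmjp_invariant : Prop :=
  forall u : R, (0 <= u)%R ->
  forall B : set (borel E), measurable B ->
    \int[pi]_x P x (lbmjp_in u B) = pi B.

(* f is extended by 0 at the graveyard state. *)
Definition lbmjp_ergodic_from (x : borel E) : Prop :=
  forall f : borel E -> R, pi.-integrable setT (EFin \o f) ->
  {ae P x, forall w,
    (u^-1)%:E * \int[lebesgue_measure]_(s in `[0%R, u]) (oapp f 0%R (lbmjp s w))%:E
      @[u --> +oo%R] --> \int[pi]_y (f y)%:E}.

End jump_process.

(* Main.v *)
Require Import Defs.
From HB Require Import structures.
From mathcomp Require Import all_boot all_order all_algebra finmap.
From mathcomp Require Import all_classical all_reals all_analysis.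
From mathcomp Require Import measurable_realfun ring lra.
Import Order.TTheory GRing.Theory Num.Theory.
Import numFieldNormedType.Exports.

(** Let [X k] be the states and [tau k] the holding times. The proof studies the
    law [Q x] of the trajectory [(X k, tau k)_k] on the space of sequences, for a
    starting point [x] in the support of [pi]; the three hypotheses of
    [lbmjp_from] determine it ([trajectory_chain_law]).

    Reversibility of the embedded chain. The measure with density [g (t (x, y))]
    with respect to [pi(dx) gamma(x, dy)] is symmetric, because exchanging [x] and
    [y] inverts [t] and [g s = s * g s^-1]. Hence the embedded chain satisfies
    detailed balance for [lambda(x) pi(dx)], where [lambda] is the jump rate
    ([flow_sym]). Since [g] is nondecreasing, [g s <= 1 + s], so [lambda] has a
    finite mean [Lam], and [m(dx) = lambda(x) pi(dx) / Lam] is an invariant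
    probability of the embedded chain, with the same null sets as [pi]
    ([embedded_invariant_law]).

    Ergodicity. When [X 0] has law [m], the sequence [(X k, tau k)_k] is stationary
    under the shift. The irreducibility hypothesis makes the shift ergodic:
    the probability of an invariant event takes only the values 0 and 1, the
    starting points of either value form a set that the chain cannot leave,
    and two such disjoint sets of positive measure would contradict irreducibility
    ([shift_zero_one]). The ergodic theorem of Birkhoff then gives the limit of
    the averages of [tau k] and of [f (X k) * tau k]. Given [X k] the mean of
    [tau k] is [1 / lambda (X k)], which cancels the density of [m], so these
    limits are [1 / Lam] and [pi(f) / Lam] ([time_average]). The first one shows
    that jump times do not accumulate; the quotient of the two is the limit of
    the time averages of [f] along the process ([signed_path_average_cvg]).

    A single null set of starting points. The conclusion asks for one exceptional
    set that serves uncountably many functions [f], while Birkhoff's theorem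
    yields one for each [f]. The exceptional set is uniform because irreducibility
    forces the chain, from every point of the support, to have a later state
    whose law is not singular to [m]; the chain returns infinitely often
    to a set of points where this holds with a uniform bound, and an invariant
    event of full stationary probability has, from such points, a
    probability bounded below ([uniform_invariant_event]).

    Reversibility of the process. The probability that [n] jumps occur up to time
    [u] and that the state is then in [B] is obtained by alternating the
    convolution in time with the survival function and the averaging over a
    jump ([at_time_renew]). Both operations are symmetric for the convolution in
    time of the scalar product of L2(pi), so integrals of these probabilities over
    [A] are symmetric in [A] and [B] ([renew_sym]); summation over [n] gives
    reversibility. *)

Set Implicit Arguments.
Unset Strict Implicit.
Unset Printing Implicit Defensive.

Local Open Scope classical_set_scope.
Local Open Scope ring_scope.

(** * Monotone classes of functions and image measures *)

Lemma measurable_lt_set {d} {T : measurableType d} {R : realType} (f g : T -> R) :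
  measurable_fun setT f -> measurable_fun setT g -> measurable [set w | f w < g w].
Proof.
move=> mf mg; have := measurable_fun_ltr mf mg measurableT (Y := [set true]) Logic.I.
by rewrite setTI.
Qed.

Section monotone_class_functions.
Context {d} {T : measurableType d} {R : realType}.
Local Open Scope ereal_scope.

Import HBNNSimple.

(** Nonnegative measurable functions are increasing limits of nonnegative
    combinations of indicators, so a property compatible with these operations
    has to be checked on indicators only. *)
Lemma ge0_measurable_ind (Pr : (T -> \bar R) -> Prop) :
  (forall A, measurable A -> Pr (fun x => (\1_A x)%:E)) ->
  (forall f (k : R), (0 <= k)%R -> measurable_fun setT f -> (forall x, 0 <= f x) ->
     Pr f -> Pr (fun x => k%:E * f x)) ->
  (forall f g, measurable_fun setT f -> (forall x, 0 <= f x) -> Pr f ->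
     measurable_fun setT g -> (forall x, 0 <= g x) -> Pr g ->
     Pr (fun x => f x + g x)) ->
  (forall f_ : nat -> T -> \bar R,
     (forall n, measurable_fun setT (f_ n)) -> (forall n x, 0 <= f_ n x) ->
     (forall x, nondecreasing_seq (f_ ^~ x)) -> (forall n, Pr (f_ n)) ->
     Pr (fun x => limn (f_ ^~ x))) ->
  forall f, measurable_fun setT f -> (forall x, 0 <= f x) -> Pr f.
Proof.
move=> H1 H2 H3 H4 f mf f0.
pose f_ := nnsfun_approx measurableT mf.
rewrite (_ : f = fun x => limn (fun n => (f_ n x)%:E)); last first.
  by apply/funext => x; apply/esym/cvg_lim => //; exact: cvg_nnsfun_approx.
apply: (H4 (fun n x => (f_ n x)%:E)).
- by move=> n; exact/measurable_EFinP.
- by move=> n x; rewrite lee_fin.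
- by move=> x a b ab; rewrite lee_fin; exact/lefP/nd_nnsfun_approx.
move=> n.
pose s := fset_set (f_ n @` setT).
have s0 i : (i < #|` s|)%N -> (0 <= s`_i)%R.
  move=> /(mem_nth 0%R); rewrite in_fset_set ?inE; last exact: fimfunP.
  by move=> [x _ <-].
rewrite (_ : (fun x => _) = fun x => \sum_(i < #|` s|)
    (s`_i)%:E * (\1_(f_ n @^-1` [set s`_i]) x)%:E); last first.
  by apply/funext => x; rewrite fimfunEord -sumEFin; apply: eq_bigr => i _;
     rewrite EFinM.
have ms i : measurable (f_ n @^-1` [set s`_i]) by exact: measurable_sfunP.
have m1 A : measurable A -> measurable_fun setT (fun x : T => (\1_A x)%:E : \bar R).
  by move=> mA; exact/measurable_EFinP/measurable_indic.
suff: forall k, (k <= #|` s|)%N ->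
    [/\ Pr (fun x => \sum_(i < k) (s`_i)%:E * (\1_(f_ n @^-1` [set s`_i]) x)%:E),
    measurable_fun setT (fun x => \sum_(i < k) (s`_i)%:E * (\1_(f_ n @^-1` [set s`_i]) x)%:E)
    & forall x, 0 <= \sum_(i < k) (s`_i)%:E * (\1_(f_ n @^-1` [set s`_i]) x)%:E].
  by move=> /(_ _ (leqnn _))[].
elim=> [_|k ih ks].
  rewrite (_ : (fun x => _) = fun x => (\1_(@set0 T) x)%:E); last first.
    by apply/funext => x; rewrite big_ord0 indic0.
  split; [exact: H1|exact: m1|by move=> x; rewrite big_ord0].
have [ih1 ih2 ih3] := ih (ltnW ks).
rewrite (_ : (fun x => _) = fun x =>
   (fun x => \sum_(i < k) (s`_i)%:E * (\1_(f_ n @^-1` [set s`_i]) x)%:E) x +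
   (fun x => (s`_k)%:E * (\1_(f_ n @^-1` [set s`_k]) x)%:E) x); last first.
  by apply/funext => x; rewrite big_ord_recr.
have mk : measurable_fun setT (fun x => (s`_k)%:E * (\1_(f_ n @^-1` [set s`_k]) x)%:E).
  by apply: emeasurable_funM => //; exact: m1.
have k0 x : 0 <= (s`_k)%:E * (\1_(f_ n @^-1` [set s`_k]) x)%:E.
  by rewrite mule_ge0// lee_fin// s0.
split.
- by apply: H3 => //; apply: H2; rewrite ?s0//; [exact: m1|exact: H1].
- exact: emeasurable_funD.
- by move=> x; rewrite big_ord_recr/= adde_ge0.
Qed.

End monotone_class_functions.

(** For [u = +oo] this uses that a nonnegative nondecreasing sequence is either
    zero or eventually positive. *)
Lemma lime_mulr_nd {R : realType} (f : (\bar R)^nat) (u : \bar R) :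
  (forall n, 0 <= f n)%E -> nondecreasing_seq f -> (0 <= u)%E ->
  limn (fun n => f n * u)%E = (limn f * u)%E.
Proof.
move=> f0 ndf; case: u => [r r0||//].
  have cf : cvgn f by exact: ereal_nondecreasing_is_cvgn.
  by apply/cvg_lim => //; apply: cvgeZr.
move=> _; have [h|/existsNP[n /eqP fn0]] := pselect (forall n, f n = 0%E).
  have -> : f = cst 0%E by exact/funext.
  have -> : (fun n : nat => cst 0%E n * +oo)%E = cst 0%E :> (\bar R)^nat.
    by apply/funext => n /=; rewrite mul0e.
  by rewrite lim_cst// mul0e.
have fn : (0 < f n)%E by rewrite lt_neqAle eq_sym fn0 f0.
have lf : (0 < limn f)%E.
  apply: (lt_le_trans fn); apply: lime_ge; first exact: ereal_nondecreasing_is_cvgn.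
  by exists n => // m /= nm; exact: ndf.
rewrite gt0_muley//; apply/cvg_lim => //; apply: cvg_near_cst.
exists n => // m /= nm; rewrite gt0_muley//; exact: lt_le_trans (ndf _ _ nm).
Qed.

Section density.
Context {d} {T : measurableType d} {R : realType}.
Variables (mu : {measure set T -> \bar R}) (u : T -> \bar R).
Hypotheses (mu_ : measurable_fun setT u) (u0 : forall x, (0 <= u x)%E).
Local Open Scope ereal_scope.

(** The two hypotheses are arguments so that the measure structure can be
    attached to the name. *)
Definition dens of (measurable_fun setT u) & (forall x, 0 <= u x) :=
  fun A : set T => \int[mu]_(x in A) u x.

Let dn := dens mu_ u0.

Let dens0 : dn set0 = 0. Proof. exact: integral_set0. Qed.
Let dens_ge0 A : 0 <= dn A. Proof. exact: integral_ge0. Qed.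
Let dens_sigma_additive : semi_sigma_additive dn.
Proof.
move=> F mF tF mUF; rewrite /dn /dens; apply: cvg_toP.
  apply: ereal_nondecreasing_is_cvgn => m n mn.
  by apply: lee_sum_nneg_natr => // k _ _; exact: integral_ge0.
by rewrite ge0_integral_bigcup//; exact: measurable_funTS.
Qed.

HB.instance Definition _ := isMeasure.Build _ _ _ (dens mu_ u0) dens0 dens_ge0
  dens_sigma_additive.

Lemma dens_integral f : measurable_fun setT f -> (forall x, 0 <= f x) ->
  \int[dens mu_ u0]_x f x = \int[mu]_x (f x * u x).
Proof.
move: f; apply: ge0_measurable_ind.
- move=> A mA; rewrite integral_indic// setIT.
  transitivity (\int[mu]_(x in A) u x) => //; rewrite integral_mkcond.
  apply: eq_integral => x _; rewrite patchE indicE.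
  by case: ifPn => xA; rewrite ?mul1e ?mul0e.
- move=> f k k0 mf f0 ih; rewrite ge0_integralZl//= ih -ge0_integralZl//.
  + by apply: eq_integral => x _; rewrite muleA.
  + exact: emeasurable_funM.
  + by move=> x _; rewrite mule_ge0.
- move=> f g mf f0 ihf mg g0 ihg; rewrite ge0_integralD//= ihf ihg -ge0_integralD//.
  + by apply: eq_integral => x _; rewrite ge0_muleDl.
  + by move=> x _; rewrite mule_ge0.
  + exact: emeasurable_funM.
  + by move=> x _; rewrite mule_ge0.
  + exact: emeasurable_funM.
- move=> f_ mf f0 ndf ih.
  rewrite monotone_convergence//.
  rewrite (eq_integral (fun x => limn (fun n => f_ n x * u x))); last first.
    by move=> x _; rewrite lime_mulr_nd.
  rewrite monotone_convergence//.
  + by congr (limn _); apply/funext => n; rewrite ih.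
  + by move=> n; exact: emeasurable_funM.
  + by move=> n x _; rewrite mule_ge0.
  + by move=> x _ m n mn; rewrite lee_wpmul2r//; exact: ndf.
Qed.

End density.

(** The image measure, packaged with the measurability of the map. *)
Definition pushm {d1 d2} {T1 : measurableType d1} {T2 : measurableType d2}
    {R : realType} (m : {measure set T1 -> \bar R}) (f : T1 -> T2)
    (mf : measurable_fun setT f) : {measure set T2 -> \bar R} :=
  measure_function_pushforward__canonical__measure_function_Measure m mf.

(** * Approximation, almost everywhere equality and conditioning *)

Section approximation_by_algebra.
Context {d} {T : measurableType d} {R : realType}.
Variables (mu : {measure set T -> \bar R}) (G : set_system T).
Hypothesis mu_fin : (mu setT < +oo)%E.
Hypotheses (G0 : G set0) (GC : setC_closed G) (GU : setU_closed G).
Hypothesis mG : G `<=` measurable.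
Local Open Scope ereal_scope.

Let D (B : set T) := measurable B /\
  forall e : R, (0 < e)%R -> exists2 C, G C & mu (B `+` C) < e%:E.

Let mu_fin_num A : measurable A -> mu A \is a fin_num.
Proof.
move=> mA; rewrite ge0_fin_numE// (le_lt_trans _ mu_fin)//.
by apply: le_measure; rewrite ?inE.
Qed.

Let mY (A B : set T) : measurable A -> measurable B -> measurable (A `+` B).
Proof. by move=> mA mB; apply: measurableU; apply: measurableD. Qed.

Let DU A B : D A -> D B -> D (A `|` B).
Proof.
move=> [mA hA] [mB hB]; split; first exact: measurableU.
move=> e e0; have e20 : (0 < e / 2)%R by rewrite divr_gt0.
have [C GC_ hC] := hA _ e20; have [C' GC' hC'] := hB _ e20.
exists (C `|` C'); first exact: GU.
have mC := mG GC_; have mC' := mG GC'.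
apply: (@le_lt_trans _ _ (mu ((A `+` C) `|` (B `+` C')))).
  apply: le_measure; rewrite ?inE; [by apply: mY; apply: measurableU| |].
    by apply: measurableU; apply: mY.
  by move=> x; rewrite /setY/= /setD/=; tauto.
apply: (@le_lt_trans _ _ (mu (A `+` C) + mu (B `+` C'))).
  by apply: measureU2; apply: mY.
by rewrite (splitr e) EFinD lteD.
Qed.

(** The sets that elements of [G] approximate form a sigma-algebra. Countable
    unions are reached because their finite partial unions exhaust them up to
    small measure; this is where [mu] has to be finite. *)
Lemma approx_algebra B : <<s G >> B -> forall e : R, (0 < e)%R ->
  exists2 C, G C & mu (B `+` C) < e%:E.
Proof.
suff h : <<s G >> `<=` D by move=> /h[].
apply: smallest_sub; last first.
  move=> A GA; split; first exact: mG.
  by move=> e e0; exists A => //; rewrite /setY setDv setU0 measure0.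
have D0 : D set0.
  by split => // e e0; exists set0 => //; rewrite /setY setDv setU0 measure0.
split => //.
- move=> A [mA hA]; rewrite setTD; split; first exact: measurableC.
  move=> e /hA[C GC_ hC]; exists (~` C); first exact: GC.
  rewrite (_ : ~` A `+` ~` C = A `+` C)//.
  by apply/seteqP; split => x; rewrite /setY/= /setD/=; case: (pselect (A x));
     case: (pselect (C x)); tauto.
- move=> F DF; have mF n : measurable (F n) by have [] := DF n.
  pose H n := \big[setU/set0]_(i < n) F i.
  have DH n : D (H n).
    by elim: n => [|n ih]; rewrite /H ?big_ord0// big_ord_recr/=; apply: DU.
  have mB : measurable (\bigcup_n F n) by exact: bigcupT_measurable.
  split=> // e e0; have e20 : (0 < e / 2)%R by rewrite divr_gt0.
  have cH : mu (\bigcup_n F n `\` H n) @[n --> \oo] --> mu set0.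
    rewrite (_ : set0 = \bigcap_n (\bigcup_n F n `\` H n)); last first.
      apply/seteqP; split => // x h; have [[n _ Fn] _] := h 0%N Logic.I.
      have [_] := h n.+1 Logic.I; apply.
      by rewrite /H big_ord_recr/=; right.
    apply: nonincreasing_cvg_mu.
    + by rewrite -ge0_fin_numE// mu_fin_num//; apply: measurableD => //; case: (DH 0%N).
    + by move=> n; apply: measurableD => //; case: (DH n).
    + by apply: bigcapT_measurable => n; apply: measurableD => //; case: (DH n).
    + move=> m n mn; apply/subsetPset => x [Bx Hx]; split => // Hm; apply: Hx.
      by move: Hm; apply: subset_bigsetU.
  move: cH; rewrite measure0 => /fine_cvgP[_ /cvgrPdist_lt /(_ _ e20)[N _ hN]].
  have := hN _ (leqnn N); rewrite /= sub0r normrN ger0_norm ?fine_ge0//.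
  have mBH : measurable (\bigcup_n F n `\` H N).
    by apply: measurableD => //; case: (DH N).
  rewrite -lte_fin fineK ?mu_fin_num// => hB.
  have [C GC_ hC] := (DH N).2 _ e20; exists C => //.
  have mC := mG GC_; have [mH _] := DH N.
  apply: (@le_lt_trans _ _ (mu ((\bigcup_n F n `\` H N) `|` (H N `+` C)))).
    apply: le_measure; rewrite ?inE; [exact: mY|by apply: measurableU => //; exact: mY|].
    move=> x [[Fx Cx]|[Cx Fx]].
      by have [Hx|Hx] := pselect (H N x); [right; left|left].
    right; right; split => // Hx; apply: Fx.
    by move: Hx; rewrite /H -bigcup_mkord => -[k _ Fk]; exists k.
  apply: (@le_lt_trans _ _ (mu (\bigcup_n F n `\` H N) + mu (H N `+` C))).
    by apply: measureU2 => //; exact: mY.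
  by rewrite (splitr e) EFinD lteD.
Qed.

End approximation_by_algebra.

Section ae_nonmeasurable.
Context {d} {T : measurableType d} {R : realType}.
Variable mu : {measure set T -> \bar R}.
Local Open Scope ereal_scope.
Import HBNNSimple.

(** The functions may be non-measurable. The integral of a nonnegative function
    is the supremum of the integrals of the simple functions below it, and
    multiplying a simple function by the indicator of [~` N] does not change its
    integral. This serves for functions such as [x |-> P x A], where [P x] is
    only controlled for almost every [x]. *)
Lemma ge0_ae_eq_integral_nm (D N : set T) (f g : T -> \bar R) :
  measurable D -> measurable N -> mu N = 0 ->
  (forall x, 0 <= f x) -> (forall x, 0 <= g x) ->
  (forall x, ~ N x -> f x = g x) ->
  \int[mu]_(x in D) f x = \int[mu]_(x in D) g x.
Proof.
move=> mD mN N0.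
suff h : forall f g : T -> \bar R, (forall x, 0 <= f x) -> (forall x, 0 <= g x) ->
    (forall x, ~ N x -> f x = g x) -> \int[mu]_(x in D) f x <= \int[mu]_(x in D) g x.
  by move=> f0 g0 fg; apply/eqP; rewrite eq_le !h// => x /fg.
move=> {}f {}g f0 g0 fg.
rewrite [leLHS]ge0_integralE// [leRHS]ge0_integralE//.
apply: ub_ereal_sup => _ [h hf <-].
have mNC : measurable (~` N) by exact: measurableC.
pose h' := proj_nnsfun h mNC.
apply: ereal_sup_ubound; exists h'.
  move=> x; rewrite /h' /= mindicE.
  have [xN|xN] := boolP (x \in ~` N).
    rewrite mulr1 (le_trans (hf x))// /patch; case: ifPn => // _.
    by rewrite fg//; move: xN; rewrite inE.
  by rewrite mulr0 /patch; case: ifPn.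
rewrite -!integralT_nnsfun; apply: ge0_ae_eq_integral => //.
- by apply/measurable_EFinP; exact: measurable_funP.
- by apply/measurable_EFinP; exact: measurable_funP.
- by move=> x _; rewrite lee_fin.
- by move=> x _; rewrite lee_fin.
exists N; split => // x /= hx; apply: contrapT => Nx; apply: hx => _.
by rewrite /h' /= mindicE mem_set ?mulr1.
Qed.

End ae_nonmeasurable.

Section conditioning_on_a_map.
Context {d d'} {T : measurableType d} {T' : measurableType d'} {R : realType}.
Variables (mu : {measure set T -> \bar R}) (p : T -> T') (u v : T -> \bar R).
Hypotheses (mp : measurable_fun setT p).
Hypotheses (mu_ : measurable_fun setT u) (u0 : forall x, (0 <= u x)%E).
Hypotheses (mv : measurable_fun setT v) (v0 : forall x, (0 <= v x)%E).
Local Open Scope ereal_scope.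

(** The last hypothesis says that [u] and [v] have the same conditional
    expectation given [p]; both sides are then integrals of [G] against the same
    image measure. *)
Lemma ci_integral G : measurable_fun setT G -> (forall y, 0 <= G y) ->
  (forall C, measurable C ->
    \int[mu]_(x in p @^-1` C) u x = \int[mu]_(x in p @^-1` C) v x) ->
  \int[mu]_x (G (p x) * u x) = \int[mu]_x (G (p x) * v x).
Proof.
move=> mG G0 uv.
have mGp : measurable_fun setT (G \o p) by exact: measurableT_comp.
have Gp0 x : 0 <= (G \o p) x by exact: G0.
rewrite -(dens_integral mu mu_ u0 mGp Gp0) -(dens_integral mu mv v0 mGp Gp0).
rewrite -(@ge0_integral_pushforward _ _ _ _ _ p mp (dens mu mu_ u0) setT G)//.
rewrite -(@ge0_integral_pushforward _ _ _ _ _ p mp (dens mu mv v0) setT G)//.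
by apply: eq_measure_integral => A mA _; exact: uv.
Qed.

End conditioning_on_a_map.

Section lebesgue_reflection.
Context {R : realType}.
Local Open Scope ereal_scope.
Local Notation mu := (@lebesgue_measure R).

Let measurable_reflect (c : R) :
  measurable_fun setT ((fun s => c - s)%R : measurableTypeR R -> measurableTypeR R).
Proof. by apply: measurable_funB. Qed.

Lemma lebesgue_measure_reflect (c : R) (A : set R) : measurable A ->
  pushforward mu ((fun s => c - s)%R : _ -> measurableTypeR R) A = mu A.
Proof.
move=> mA; apply/esym.
refine (@lebesgue_measure_unique R (pushm mu (measurable_reflect c)) _ A mA).
move=> X [[a b]] _ <-; rewrite /= /pushforward.
have E : (fun s : R => c - s)%R @^-1` `]a, b]%classic = `[c - b, c - a[%classic%R.
  by apply/seteqP; split => x /=; rewrite !in_itv/= => /andP[h1 h2]; apply/andP;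
     split; lra.
transitivity (mu `[c - b, c - a[%classic%R); last by rewrite -E.
rewrite !lebesgue_measure_itv/= !lte_fin ltrD2l ltrN2; case: ifPn => // _.
by rewrite -!EFinB; congr EFin; lra.
Qed.

Lemma integral_reflect (c : R) (F : R -> \bar R) : measurable_fun setT F ->
  (forall s, 0 <= F s) -> \int[mu]_s F (c - s)%R = \int[mu]_s F s.
Proof.
move=> mF F0.
have := @ge0_integral_pushforward _ _ (measurableTypeR R) (measurableTypeR R) R _
  (measurable_reflect c) mu setT F measurableT mF (fun x _ => F0 x).
rewrite preimage_setT => <-.
by apply: eq_measure_integral => A mA _; exact: lebesgue_measure_reflect.
Qed.

End lebesgue_reflection.

(** * The ergodic theorem of Birkhoff *)

Lemma birkhoff_arith {R : realFieldType} (s i n dl e K K1 K2 : R) :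
  s <= (i + dl) * n + K1 -> - s <= (- i + dl) * n + K2 ->
  dl * n <= e / 2 * n -> K <= e / 2 * n -> K1 <= K -> K2 <= K ->
  - (e * n) <= i * n - s <= e * n.
Proof. by move=> h1 h2 h3 h4 h5 h6; apply/andP; split; lra. Qed.

Section birkhoff.
Context {d} {T : measurableType d} {R : realType}.
Variables (mu : probability T R) (theta : T -> T).
Hypothesis mtheta : measurable_fun setT theta.
Hypothesis theta_mu : forall A, measurable A -> mu (theta @^-1` A) = mu A.
Local Open Scope ereal_scope.

Definition birkhoff_sum (F : T -> R) n w := (\sum_(k < n) F (iter k theta w))%R.

Let S := birkhoff_sum.

Lemma birkhoff_sumS F n w : S F n.+1 w = (F w + S F n (theta w))%R.
Proof.
rewrite /S /birkhoff_sum big_ord_recl/=; congr (_ + _)%R; apply: eq_bigr => i _.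
by rewrite -iterSr.
Qed.

Lemma measurable_birkhoff_sum F n : measurable_fun setT F ->
  measurable_fun setT (S F n).
Proof.
move=> mF; elim: n => [|n ih].
  by rewrite (_ : S F 0 = cst 0%R)//; apply/funext => w; rewrite /S/birkhoff_sum big_ord0.
rewrite (_ : S F n.+1 = (F \+ (S F n \o theta))%R); last first.
  by apply/funext => w; rewrite birkhoff_sumS.
by apply: measurable_funD => //; exact: measurableT_comp.
Qed.

Lemma integral_theta (F : T -> \bar R) : measurable_fun setT F ->
  (forall w, 0 <= F w) -> \int[mu]_w F (theta w) = \int[mu]_w F w.
Proof.
move=> mF F0; have := @ge0_integral_pushforward _ _ _ _ _ _ mtheta mu setT F
  measurableT mF (fun x _ => F0 x).
rewrite preimage_setT => <-.
by apply: eq_measure_integral => A mA _; exact: theta_mu.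
Qed.

Section maximal.
Variable F : T -> R.
Hypothesis iF : mu.-integrable setT (EFin \o F).

Let mF : measurable_fun setT F.
Proof. by apply/measurable_EFinP; exact: measurable_int iF. Qed.

(** The maximum of the sums [birkhoff_sum F k w] for [k <= n], where the sum for
    [k = 0] is zero. *)
Fixpoint birkhoff_max n w : R :=
  if n is n'.+1 then Num.max 0%R (F w + birkhoff_max n' (theta w))%R else 0%R.

Let M := birkhoff_max.

Let MS n w : M n.+1 w = Num.max 0%R (F w + M n (theta w))%R.
Proof. by []. Qed.

Arguments birkhoff_max : simpl never.

Let M_ge0 n w : (0 <= M n w)%R.
Proof. by case: n => // n; rewrite MS le_max lexx. Qed.

Let M_nd w : nondecreasing_seq (M ^~ w).
Proof.
apply/nondecreasing_seqP => n; elim: n w => [|n ih] w; first exact: M_ge0.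
by rewrite (MS n.+1) [M _ _](MS n) ge_max !le_max lexx/= lerD2l ih orbT.
Qed.

Let mM n : measurable_fun setT (M n).
Proof.
elim: n => [|n ih]; first exact: measurable_cst.
apply: measurable_maxr => //; apply: measurable_funD => //.
exact: measurableT_comp.
Qed.

Let iM n : mu.-integrable setT (EFin \o M n).
Proof.
elim: n => [|n ih]; first by rewrite (_ : EFin \o M 0 = cst 0)//; exact: integrable0.
have iMt : mu.-integrable setT (EFin \o (M n \o theta)).
  apply/integrableP; split; first by apply/measurable_EFinP; exact: measurableT_comp.
  move/integrableP : ih => [mMn].
  rewrite -(integral_theta (F := fun w => `|(M n w)%:E|))//.
  by apply: measurableT_comp => //.
apply: (le_integrable measurableT _ _ (integrableD measurableT (integrable_abse iF) iMt)).
  by apply/measurable_EFinP; exact: mM.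
move=> w _; rewrite [leLHS]/= [leRHS]/= lee_fin.
have M0 := M_ge0 n (theta w).
have Mn : (0 <= M n.+1 w)%R by exact: M_ge0.
rewrite (ger0_norm Mn) ger0_norm ?addr_ge0//.
by rewrite MS ge_max lerD2r ler_norm addr_ge0.
Qed.

Let SM n w : (S F n w <= M n w)%R.
Proof.
elim: n w => [|n ih] w; first by rewrite /S /birkhoff_sum big_ord0.
by rewrite birkhoff_sumS MS le_max lerD2l ih orbT.
Qed.

(** Let [M n] be the maximum above and [D := M n - M n \o theta], whose integral
    is zero. Where [M n] is positive, [M n = F + M n.-1 \o theta], hence
    [D <= F]; elsewhere [D <= 0]. *)
Lemma maximal_ergodic n : 0 <= \int[mu]_(w in [set w | (0 < M n w)%R]) (F w)%:E.
Proof.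
case: n => [|n].
  by rewrite (_ : mkset _ = set0) ?integral_set0//; apply/seteqP; split => w //=; rewrite ltxx.
have mB : measurable [set w | (0 < M n.+1 w)%R].
  exact: measurable_lt_set.
have iMt : mu.-integrable setT (EFin \o (M n.+1 \o theta)).
  apply/integrableP; split; first by apply/measurable_EFinP; exact: measurableT_comp.
  move/integrableP : (iM n.+1) => [mMn].
  rewrite -(integral_theta (F := fun w => `|(M n.+1 w)%:E|))//.
  by apply: measurableT_comp => //.
have -> : 0 = \int[mu]_w ((EFin \o M n.+1) \- (EFin \o (M n.+1 \o theta))) w.
  rewrite integralB// (integral_theta (F := EFin \o M n.+1))//.
  - by rewrite subee//; exact: integrable_fin_num.
  - by apply/measurable_EFinP; exact: mM.
  - by move=> w; rewrite lee_fin; exact: M_ge0.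
rewrite [leRHS]integral_mkcond; apply: le_integral => //.
- exact: integrableB.
- by apply/(integrable_mkcond _ mB); exact: (integrableS measurableT).
move=> w _ /=; rewrite patchE; case: ifPn => [|/negP].
  rewrite inE/= => h; rewrite -EFinB lee_fin lerBlDr.
  have -> : M n.+1 w = (F w + M n (theta w))%R.
    by move: h; rewrite MS lt_max ltxx/= => h; apply/max_idPr/ltW.
  by rewrite lerD2l; exact: M_nd.
rewrite inE/= => /negP; rewrite -leNgt => h.
have -> : M n.+1 w = 0%R by apply/eqP; rewrite eq_le h M_ge0.
by rewrite -EFinB lee_fin sub0r oppr_le0 M_ge0.
Qed.

Lemma maximal_ergodic_lim A : measurable A -> mu A = 1 ->
  (forall w, A w -> exists n, (0 < S F n w)%R) -> 0 <= \int[mu]_w (F w)%:E.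
Proof.
move=> mA A1 hA.
pose B n := [set w | (0 < M n w)%R].
have mB n : measurable (B n) by exact: measurable_lt_set.
have [|||||_ _ hc] := @dominated_convergence _ _ _ mu setT measurableT
  (fun n => (EFin \o F) \_ (B n)) (EFin \o F) (abse \o (EFin \o F)).
- move=> n; apply/(measurable_restrictT _ (mB n)); apply: measurable_funTS.
  by apply/measurable_EFinP.
- by apply/measurable_EFinP.
- exists (~` A); split; first exact: measurableC.
    by have := probability_setC mu mA; rewrite A1 subee.
  move=> w /= hw Aw; apply: hw => _; have [n hn] := hA _ Aw.
  apply: cvg_near_cst; exists n => // m /= nm; rewrite patchE mem_set//=.
  by rewrite /B/=; apply: (lt_le_trans hn); apply: (le_trans (SM _ _)); exact: M_nd.
- exact: integrable_abse.
- apply: aeW => w n _; rewrite patchE; case: ifPn => //= _.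
  by rewrite normr0 lee_fin.
rewrite -(cvg_lim _ hc)//; apply: lime_ge; first by apply/cvg_ex; exists (\int[mu]_x (EFin \o F) x).
  by apply: nearW => n /=; rewrite -integral_mkcond; exact: maximal_ergodic.
Qed.
End maximal.

Hypothesis ergodic : forall A, measurable A -> theta @^-1` A = A ->
  mu A = 0 \/ mu A = 1.

(** The event that the sums are unbounded above is invariant. If it had
    probability one, the maximal inequality would make the mean of [F]
    nonnegative. *)
Lemma birkhoff_bounded F : mu.-integrable setT (EFin \o F) ->
  \int[mu]_w (F w)%:E < 0 ->
  {ae mu, forall w, exists K : R, forall n, (S F n w <= K)%R}.
Proof.
move=> iF F0.
have mF : measurable_fun setT F by apply/measurable_EFinP; exact: measurable_int iF.
pose A := \bigcap_(K : nat) \bigcup_n [set w | (K%:R < S F n w)%R].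
have mA : measurable A.
  apply: bigcapT_measurable => K; apply: bigcupT_measurable => n.
  by apply: measurable_lt_set => //; exact: measurable_birkhoff_sum.
have invA : theta @^-1` A = A.
  apply/seteqP; split => w /= hw K _.
    have [n _ /= hn] := hw (Num.truncn (K%:R - F w)%R).+1 Logic.I.
    exists n.+1 => //=; rewrite birkhoff_sumS -ltrBlDl.
    exact: lt_trans (truncnS_gt _) hn.
  pose k := (Num.truncn (Num.max 0 (K%:R + F w))%R).+1.
  have [n _ /= hn] := hw k Logic.I.
  have k0 : (K%:R + F w < k%:R)%R.
    by apply: le_lt_trans (truncnS_gt _); rewrite le_max lexx orbT.
  case: n hn => [|n hn].
    by rewrite /S /birkhoff_sum big_ord0 ltrn0.
  exists n => //=; rewrite -(ltrD2l (F w)) -birkhoff_sumS addrC.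
  exact: lt_trans hn.
have [A0|A1] := ergodic mA invA; last first.
  have := maximal_ergodic_lim iF mA A1; rewrite leNgt F0 => /(_ _)/negP; case => // w Aw.
  by have [n _ /= hn] := Aw 0%N Logic.I; exists n; rewrite (le_lt_trans _ hn).
exists A; split => // w /= hw K _.
apply: contrapT => hK; apply: hw; exists K%:R => n; rewrite leNgt; apply/negP => hn.
by apply: hK; exists n.
Qed.

Lemma birkhoff_upper F (c : R) : mu.-integrable setT (EFin \o F) ->
  \int[mu]_w (F w)%:E < c%:E ->
  {ae mu, forall w, exists K : R, forall n, (S F n w <= c * n%:R + K)%R}.
Proof.
move=> iF Fc; pose F' w := (F w - c)%R.
have ic : mu.-integrable setT (fun=> c%:E) by exact: finite_measure_integrable_cst.
have iF' : mu.-integrable setT (EFin \o F').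
  by apply: eq_integrable (integrableB measurableT iF ic) => // w _ /=; rewrite EFinB.
have : \int[mu]_w (F' w)%:E < 0.
  rewrite (eq_integral (fun w => (F w)%:E - c%:E)); last by move=> w _; rewrite EFinB.
  rewrite integralB_EFin//= integral_cst// [X in _ * X]probability_setT mule1.
  by rewrite lteBlDr// add0e.
move=> /(birkhoff_bounded iF'); apply: filterS => w [K hK]; exists K => n.
have := hK n; rewrite /S /birkhoff_sum sumrB big_const_ord iter_addr_0 lerBlDl.
by rewrite mulr_natr.
Qed.

(** Two applications of the linear bound, to [F] and to [- F], with a slope that
    exceeds the mean by [m.+1%:R^-1]. *)
Theorem birkhoff F : mu.-integrable setT (EFin \o F) ->
  {ae mu, forall w, (S F n w / n%:R)%R @[n --> \oo] --> fine (\int[mu]_w (F w)%:E)}.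
Proof.
move=> iF; set I := fine _.
have EI : \int[mu]_w (F w)%:E = I%:E by rewrite fineK//; exact: integrable_fin_num iF.
have iN : mu.-integrable setT (EFin \o (fun w => - F w)%R).
  by apply: eq_integrable (integrableN iF).
have EN : \int[mu]_w (- F w)%:E = (- I)%:E.
  by rewrite EFinN -EI -integralN//; exact: integrable_add_def.
have e0 (m : nat) : (0 < m.+1%:R^-1 :> R)%R by rewrite invr_gt0.
have h1 : {ae mu, forall w, forall m : nat,
    exists K : R, forall n, (S F n w <= (I + m.+1%:R^-1) * n%:R + K)%R}.
  by apply/ae_foralln => m; apply: birkhoff_upper => //; rewrite EI lte_fin ltrDl.
have h2 : {ae mu, forall w, forall m : nat,
    exists K : R, forall n, (S (fun w => - F w)%R n w <= (- I + m.+1%:R^-1) * n%:R + K)%R}.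
  by apply/ae_foralln => m; apply: birkhoff_upper => //; rewrite EN lte_fin ltrDl.
apply: filterS2 h1 h2 => w h1 h2.
apply/cvgrPdist_le => e he.
have e20 : (0 < e / 2)%R by rewrite divr_gt0.
have [m hm] : exists m : nat, (m.+1%:R^-1 < e / 2)%R.
  exists (Num.truncn (e / 2)^-1); rewrite invf_plt ?posrE//; exact: truncnS_gt.
have [K1 hK1] := h1 m; have [K2 hK2] := h2 m.
pose K := (Num.max `|K1| `|K2|)%R.
near=> n.
have n0 : (0 < n%:R :> R)%R by rewrite ltr0n; near: n; exact: nbhs_infty_gt.
have nK : (K <= e / 2 * n%:R)%R.
  by rewrite mulrC -ler_pdivrMr//; near: n; exact: nbhs_infty_ger.
have k1 : (K1 <= K)%R by rewrite le_max ler_norm.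
have k2 : (K2 <= K)%R by rewrite le_max [X in _ || X](ler_norm) orbT.
have := hK1 n; have := hK2 n.
rewrite {1}/S /birkhoff_sum sumrN -/(birkhoff_sum F n w) -/(S F n w) => g2 g1.
have hn : (m.+1%:R^-1 * n%:R <= e / 2 * n%:R)%R by rewrite ler_wpM2r// ltW.
have -> : (I - S F n w / n%:R = (I * n%:R - S F n w) / n%:R)%R.
  by rewrite mulrBl mulfK// gt_eqF.
rewrite normrM (@ger0_norm _ n%:R^-1) ?invr_ge0// ler_pdivrMr// ler_norml.
exact: birkhoff_arith g1 g2 hn nK k1 k2.
Unshelve. all: by end_near. Qed.

End birkhoff.

(** * Path space *)

Section path_space.
Context {dU dV} {U : measurableType dU} {V : measurableType dV}.

Definition rect (n : nat) (A : nat -> set U) (B : nat -> set V)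
    : set (nat -> U * V) :=
  [set w | forall k, (k < n)%N -> A k (w k).1 /\ B k (w k).2].

Definition rects (n : nat) : set_system (nat -> U * V) :=
  [set C | exists A B, [/\ forall k, measurable (A k),
    forall k, measurable (B k) & C = rect n A B]].

(** Sequences of states with marks, with the product sigma-algebra. The mark of
    a state will be the time that the process spends there. *)
Definition path := g_sigma_algebraType (\bigcup_n rects n).

HB.instance Definition _ := Measurable.on path.

Lemma rects_le n m : (n <= m)%N -> rects n `<=` rects m.
Proof.
move=> nm C [A [B [mA mB ->]]].
exists (fun k => if (k < n)%N then A k else setT).
exists (fun k => if (k < n)%N then B k else setT).
split; [by move=> k; case: ifP|by move=> k; case: ifP|].
apply/seteqP; split => w /= h k hk.
  by case: ifPn => // kn; exact: h.
by have := h k (leq_trans hk nm); rewrite hk.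
Qed.

Lemma rectsT n : rects n setT.
Proof.
exists (fun=> setT), (fun=> setT); split => //.
by apply/seteqP; split => w //= _ k _.
Qed.

Lemma rectsI n : setI_closed (rects n).
Proof.
move=> _ _ [A [B [mA mB ->]]] [A' [B' [mA' mB' ->]]].
exists (fun k => A k `&` A' k), (fun k => B k `&` B' k); split.
- by move=> k; exact: measurableI.
- by move=> k; exact: measurableI.
apply/seteqP; split => w /=.
  by move=> [h1 h2] k hk; have [? ?] := h1 k hk; have [? ?] := h2 k hk.
by move=> h; split => k hk; have [[? ?] [? ?]] := h k hk.
Qed.

Lemma all_rectsI : setI_closed (\bigcup_n rects n).
Proof.
move=> C C' [n _ hC] [m _ hC']; exists (maxn n m) => //.
by apply: rectsI; [apply: rects_le hC; rewrite leq_maxl|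
                   apply: rects_le hC'; rewrite leq_maxr].
Qed.

Lemma measurable_rects n C : rects n C -> measurable (C : set path).
Proof. by move=> hC; apply: sub_sigma_algebra; exists n. Qed.

Lemma measurable_pathE : @measurable _ path = <<s \bigcup_n rects n >>.
Proof. by []. Qed.

Definition coordX (n : nat) (w : path) : U := (w n).1.
Definition coordT (n : nat) (w : path) : V := (w n).2.
Definition shift (w : path) : path := fun n => w n.+1.

Lemma measurable_coordX n : measurable_fun setT (coordX n).
Proof.
move=> _ A mA; rewrite setTI; apply: (@measurable_rects n.+1).
exists (fun k => if k == n then A else setT), (fun=> setT); split => //.
  by move=> k; case: ifP.
apply/seteqP; split => w /=.
  by move=> h k _; split => //; case: eqP => // ->.
by move=> /(_ n (ltnSn n))[]; rewrite eqxx.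
Qed.

Lemma measurable_coordT n : measurable_fun setT (coordT n).
Proof.
move=> _ A mA; rewrite setTI; apply: (@measurable_rects n.+1).
exists (fun=> setT), (fun k => if k == n then A else setT); split => //.
  by move=> k; case: ifP.
apply/seteqP; split => w /=.
  by move=> h k _; split => //; case: eqP => // ->.
by move=> /(_ n (ltnSn n))[]; rewrite eqxx.
Qed.

Lemma measurable_to_path {d} {T : measurableType d} (f : T -> path) :
  (forall n, measurable_fun setT (fun x => coordX n (f x))) ->
  (forall n, measurable_fun setT (fun x => coordT n (f x))) ->
  measurable_fun setT f.
Proof.
move=> mX mT; apply: measurability; first exact: measurable_pathE.
move=> _ [_ [n _ [A [B [mA mB ->]]]] <-].
rewrite setTI (_ : _ @^-1` _ = \bigcap_(k in `I_n)
  (((fun x => coordX k (f x)) @^-1` A k) `&` ((fun x => coordT k (f x)) @^-1` B k))).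
  apply: fin_bigcap_measurable => // k _; apply: measurableI.
    by rewrite -[X in measurable X]setTI; exact: mX.
  by rewrite -[X in measurable X]setTI; exact: mT.
by apply/seteqP; split => x /= h k hk; apply: h.
Qed.

Lemma measurable_shift : measurable_fun setT shift.
Proof.
apply: measurable_to_path => n.
- exact: measurable_coordX n.+1.
- exact: measurable_coordT n.+1.
Qed.

Lemma iter_shiftE n (w : path) k : iter n shift w k = w (n + k)%N.
Proof. by elim: n w k => [|n ih] w k //; rewrite iterSr ih addSn. Qed.

Lemma measurable_iter_shift n : measurable_fun setT (iter n shift).
Proof.
elim: n => [|n ih]; first exact: measurable_id.
by rewrite (_ : iter n.+1 shift = shift \o iter n shift)//; apply: measurableT_comp => //; exact: measurable_shift.
Qed.

Definition past (n : nat) : set_system path := <<s rects n >>.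

Lemma past_le n m : (n <= m)%N -> past n `<=` past m.
Proof. by move=> nm; apply: sub_sigma_algebra2; exact: rects_le. Qed.

Lemma past_measurable n : past n `<=` measurable.
Proof. by apply: sub_sigma_algebra2 => C hC; exists n. Qed.

Lemma pastT n : past n setT.
Proof. by apply: sub_sigma_algebra; exact: rectsT. Qed.

Lemma pastI n : setI_closed (past n).
Proof. exact: (@measurableI _ (g_sigma_algebraType (rects n))). Qed.

Lemma pastC n : setC_closed (past n).
Proof. exact: (@measurableC _ (g_sigma_algebraType (rects n))). Qed.

Lemma past_coordX n A : measurable A -> past n.+1 (coordX n @^-1` A).
Proof.
move=> mA; apply: sub_sigma_algebra.
exists (fun k => if k == n then A else setT), (fun=> setT); split => //.
  by move=> k; case: ifP.
apply/seteqP; split => w /=.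
  by move=> h k _; split => //; case: eqP => // ->.
by move=> /(_ n (ltnSn n))[]; rewrite eqxx.
Qed.

Lemma past_algebra_gen : @measurable _ path = <<s \bigcup_n past n >>.
Proof.
apply/seteqP; split.
  by apply: sub_sigma_algebra2 => C [n _ hC]; exists n => //; exact: sub_sigma_algebra.
apply: smallest_sub; first exact: sigma_algebra_measurable.
by move=> C [n _]; exact: past_measurable.
Qed.

Section uniqueness.
Context {R : realType}.
Local Open Scope ereal_scope.

(** The rectangles are stable under intersection and generate. *)
Lemma path_measure_unique (m1 m2 : {measure set path -> \bar R}) :
  m1 setT < +oo ->
  (forall n A B, (forall k, measurable (A k)) -> (forall k, measurable (B k)) ->
    m1 (rect n A B) = m2 (rect n A B)) ->
  forall C, measurable C -> m1 C = m2 C.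
Proof.
move=> m1T h C mC.
apply: (@measure_unique _ _ path (\bigcup_n rects n) (fun=> setT)) => //.
- exact: all_rectsI.
- by move=> _; exists 0%N => //; exact: rectsT.
- by rewrite bigcup_const.
- by move=> _ [n _ [A [B [mA mB ->]]]]; exact: h.
Qed.

Lemma past_measure_unique n (m1 m2 : {measure set path -> \bar R}) :
  m1 setT < +oo ->
  (forall A B, (forall k, measurable (A k)) -> (forall k, measurable (B k)) ->
    m1 (rect n A B) = m2 (rect n A B)) ->
  forall C, past n C -> m1 C = m2 C.
Proof.
move=> m1T h C mC.
apply: (@g_sigma_algebra_measure_unique _ _ path (rects n) _ (fun=> setT)) => //.
- by move=> D; exact: measurable_rects.
- by move=> _; exact: rectsT.
- by rewrite bigcup_const.
- exact: rectsI.
- by move=> _ [A [B [mA mB ->]]]; exact: h.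
Qed.

Lemma approx_past (mu : {measure set path -> \bar R}) C : mu setT < +oo ->
  measurable C ->
  forall e : R, (0 < e)%R -> exists n D, past n D /\ mu (C `+` D) < e%:E.
Proof.
move=> mufin mC e e0.
have [||||||D [n _ hD] hCD] := @approx_algebra _ _ R mu (\bigcup_n past n) _ _ _ _ _ C _ e e0.
- exact: mufin.
- by exists 0%N => //; exact: sigma_algebra0.
- by move=> D [n _ hD]; exists n => //; rewrite -setTD; exact: sigma_algebraCD.
- move=> D D' [n _ hD] [m _ hD']; exists (maxn n m) => //.
  rewrite -bigcup2E; apply: sigma_algebra_bigcup => -[|[|k]] /=.
  + by apply: past_le hD; rewrite leq_maxl.
  + by apply: past_le hD'; rewrite leq_maxr.
  + exact: sigma_algebra0.
- by move=> D [n _]; exact: past_measurable.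
- by rewrite -past_algebra_gen.
by exists n, D.
Qed.

End uniqueness.

End path_space.
Arguments path {dU dV} U V.

(** * Mixtures and laws of marked Markov chains *)

Section mixture.
Context {d1 d2} {T1 : measurableType d1} {T2 : measurableType d2} {R : realType}.
Variables (m : {measure set T1 -> \bar R}) (k : R.-ker T1 ~> T2).
Local Open Scope ereal_scope.

Definition mixture (A : set T2) : \bar R := \int[m]_x k x A.

Let mixture0 : mixture set0 = 0.
Proof. by apply: integral0_eq => x _; rewrite measure0. Qed.

Let mixture_ge0 A : 0 <= mixture A.
Proof. exact: integral_ge0. Qed.

Let mixture_sigma_additive : semi_sigma_additive mixture.
Proof.
move=> F mF tF mUF; rewrite [X in _ --> X](_ : _ =
    \int[m]_x (\sum_(n <oo) k x (F n))); last first.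
  by apply: eq_integral => x _; apply/esym/cvg_lim => //; exact: measure_semi_sigma_additive.
apply/cvg_closeP; split.
  by apply: is_cvg_nneseries => n _ _; exact: integral_ge0.
by rewrite closeE// integral_nneseries// => n; exact: measurable_kernel.
Qed.

HB.instance Definition _ := isMeasure.Build _ _ _ mixture mixture0 mixture_ge0
  mixture_sigma_additive.

Lemma mixture_integral f : measurable_fun setT f -> (forall y, 0 <= f y) ->
  \int[mixture]_y f y = \int[m]_x \int[k x]_y f y.
Proof.
have mk g : measurable_fun setT g -> (forall y, 0 <= g y) ->
    measurable_fun setT (fun x => \int[k x]_y g y).
  by move=> mg g0; apply: measurable_fun_integral_kernel => //; exact: measurable_kernel.
have k0 g x : (forall y, 0 <= g y) -> 0 <= \int[k x]_y g y by move=> ?; exact: integral_ge0.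
move: f; apply: ge0_measurable_ind.
- move=> A mA; rewrite integral_indic// setIT.
  by apply: eq_integral => x _; rewrite integral_indic// setIT.
- move=> f r r0 mf f0 ih; have r0' : 0 <= r%:E by rewrite lee_fin.
  rewrite (ge0_integralZl _ measurableT mf (fun y _ => f0 y) r0') ih.
  rewrite -(ge0_integralZl m measurableT (mk f mf f0) (fun x _ => k0 f x f0) r0').
  apply: eq_integral => x _.
  by rewrite (ge0_integralZl (k x) measurableT mf (fun y _ => f0 y) r0').
- move=> f g mf f0 ihf mg g0 ihg.
  rewrite (ge0_integralD _ measurableT (fun y _ => f0 y) mf (fun y _ => g0 y) mg) ihf ihg.
  rewrite -(ge0_integralD m measurableT (fun x _ => k0 f x f0) (mk f mf f0)
    (fun x _ => k0 g x g0) (mk g mg g0)).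
  apply: eq_integral => x _.
  by rewrite (ge0_integralD (k x) measurableT (fun y _ => f0 y) mf (fun y _ => g0 y) mg).
- move=> f_ mf f0 ndf ih.
  rewrite monotone_convergence//.
  rewrite (eq_integral (fun x => limn (fun n => \int[k x]_y f_ n y))); last first.
    by move=> x _; rewrite monotone_convergence.
  rewrite monotone_convergence//.
  + by congr (limn _); apply/funext => n; rewrite ih.
  + by move=> n; exact: mk.
  + by move=> n x _; exact: k0.
  + move=> x _ i j ij; apply: ge0_le_integral => //.
    by move=> y _; exact: ndf.
Qed.

End mixture.

Section mixture_probability.
Context {d1 d2} {T1 : measurableType d1} {T2 : measurableType d2} {R : realType}.
Variables (m : probability T1 R) (k : R.-pker T1 ~> T2).
Local Open Scope ereal_scope.

Let mixture1 : mixture m k setT = 1.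
Proof.
rewrite /mixture (eq_integral (cst 1)).
  by rewrite integral_cst// mul1e; exact: probability_setT.
by move=> x _; rewrite prob_kernel.
Qed.

HB.instance Definition _ := Measure_isProbability.Build _ _ _ (mixture m k) mixture1.

End mixture_probability.

Section pker_probability.
Context {d1 d2} {T1 : measurableType d1} {T2 : measurableType d2} {R : realType}.
Variables (k : R.-pker T1 ~> T2) (x : T1).
Local Open Scope ereal_scope.

(** The kernel structure exposes [k x] as a measure only; this copy carries the
    structure of a probability. *)
Definition pker_at : set T2 -> \bar R := k x.

HB.instance Definition _ := Measure.copy pker_at (k x).

Let pker_at1 : pker_at setT = 1. Proof. exact: prob_kernel. Qed.

HB.instance Definition _ := Measure_isProbability.Build _ _ _ pker_at pker_at1.

Lemma pker_le1 A : measurable A -> k x A <= 1.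
Proof. by move=> mA; exact: (@probability_le1 _ _ _ pker_at). Qed.

Lemma pker_lty A : measurable A -> k x A < +oo.
Proof. by move=> mA; rewrite (le_lt_trans (pker_le1 mA))// ltry. Qed.

End pker_probability.

Section chain_law.
Context {dU dV} {U : measurableType dU} {V : measurableType dV} {R : realType}.
Variables (Gam : R.-pker U ~> U) (rho : R.-pker U ~> V).
Local Open Scope ereal_scope.

(** The finite-dimensional laws of the marked chain, by recursion on the first
    step: for a chain started at [x] with transition kernel [Gam], and marks
    drawn from [rho] given the states, this is the expectation of [phi] at the
    state of index [n] on the event that the earlier states are in the [A k]
    and their marks in the [B k]. *)
Fixpoint fd n (A : nat -> set U) (B : nat -> set V) (phi : U -> \bar R) (x : U)
    : \bar R :=
  if n is n'.+1 then
    (\1_(A 0%N) x)%:E * rho x (B 0%N) *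
    \int[Gam x]_y fd n' (A \o succn) (B \o succn) phi y
  else phi x.

Lemma fd_ge0 n A B phi x : (forall y, 0 <= phi y) -> 0 <= fd n A B phi x.
Proof.
move=> phi0; elim: n A B x => [|n ih] A B x //=.
by rewrite mule_ge0// ?mule_ge0 ?lee_fin//; apply: integral_ge0.
Qed.

Lemma measurable_fd n A B phi : (forall k, measurable (A k)) ->
  (forall k, measurable (B k)) -> measurable_fun setT phi ->
  (forall y, 0 <= phi y) -> measurable_fun setT (fd n A B phi).
Proof.
move=> + + mphi phi0; elim: n A B => [|n ih] A B mA mB //=.
apply: emeasurable_funM.
  apply: emeasurable_funM; last exact: measurable_kernel.
  exact/measurable_EFinP/measurable_indic.
apply: measurable_fun_integral_kernel.
- by move=> W mW; exact: measurable_kernel.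
- by move=> y; exact: fd_ge0.
- by apply: ih => k /=.
Qed.

Definition catf {T} n (A A' : nat -> T) k := if (k < n)%N then A k else A' (k - n)%N.

Lemma fd_cat n m A A' B B' phi x :
  fd (n + m) (catf n A A') (catf n B B') phi x = fd n A B (fd m A' B' phi) x.
Proof.
elim: n A B x => [|n ih] A B x.
  rewrite add0n/= (_ : catf 0 A A' = A'); last by apply/funext => k; rewrite /catf subn0.
  by rewrite (_ : catf 0 B B' = B')//; apply/funext => k; rewrite /catf subn0.
rewrite addSn/=; congr (_ * _); apply: eq_integral => y _.
by rewrite -ih; congr (fd _ _ _ _ _); apply/funext => k; rewrite /catf/= ltnS subSS.
Qed.

Lemma rect_cat n m (A A' : nat -> set U) (B B' : nat -> set V) :
  rect (n + m) (catf n A A') (catf n B B') =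
  rect n A B `&` iter n shift @^-1` rect m A' B'.
Proof.
apply/seteqP; split => w /=.
  move=> h; split => k hk.
    by have := h k (leq_trans hk (leq_addr _ _)); rewrite /catf hk.
  have := h (n + k)%N; rewrite ltn_add2l => /(_ hk).
  by rewrite /catf ltnNge leq_addr/= addKn iter_shiftE.
move=> [h1 h2] k hk; rewrite /catf; case: ltnP => kn; first exact: h1.
have := h2 (k - n)%N; rewrite iter_shiftE subnKC// ltn_subLR//.
exact.
Qed.

Definition chain_law (x : U) (q : {measure set (path U V) -> \bar R}) :=
  forall n A B phi, (forall k, measurable (A k)) -> (forall k, measurable (B k)) ->
    measurable_fun setT phi -> (forall y, 0 <= phi y) ->
    \int[q]_(w in rect n A B) phi (coordX n w) = fd n A B phi x.

Lemma chain_law_rect x q n A B : chain_law x q ->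
  (forall k, measurable (A k)) -> (forall k, measurable (B k)) ->
  q (rect n A B) = fd n A B (cst 1) x.
Proof.
move=> h mA mB; rewrite -h// integral_cst ?mul1e//.
by apply: (@measurable_rects _ _ _ _ n); exists A, B.
Qed.

Section family.
Variables (Q : R.-pker U ~> path U V) (K : set U).
Hypotheses (mK : measurable K) (law : forall x, K x -> chain_law x (Q x)).

Lemma measurable_Q C : measurable C -> measurable_fun setT (fun x => Q x C).
Proof. exact: measurable_kernel. Qed.

Lemma start x : K x -> forall phi, measurable_fun setT phi -> (forall y, 0 <= phi y) ->
  \int[Q x]_w phi (coordX 0 w) = phi x.
Proof.
move=> Kx phi mphi phi0.
rewrite -[RHS](@law x Kx 0%N (fun=> setT) (fun=> setT))//.
by congr integral; apply/seteqP; split => w // _ k.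
Qed.

(** Starting points from which the chain almost surely stays in [K]. Only in
    [K] is the kernel [Q] known to give the law of the chain, so the Markov
    property needs the chain to stay there. *)
Definition good : set U :=
  [set x | K x /\ forall n, Q x (coordX n @^-1` (~` K)) = 0].

Let mcK n : measurable (coordX n @^-1` (~` K) : set (path U V)).
Proof.
rewrite -[X in measurable X]setTI; apply: measurable_coordX => //.
exact: measurableC.
Qed.

Lemma measurable_good : measurable good.
Proof.
rewrite (_ : good = K `&` \bigcap_n [set x | Q x (coordX n @^-1` (~` K)) = 0]); last first.
  by apply/seteqP; split => x [h1 h2]; split => // n; [move=> _; exact: h2|exact: h2].
apply: measurableI => //; apply: bigcapT_measurable => n.
rewrite -[X in measurable X]setTI.
exact: (measurable_Q (mcK n) measurableT (emeasurable_set1 0)).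
Qed.

(** Both sides are measures in [C] and measures in [D], and they agree on
    rectangles by [fd_cat]. Uniqueness extends the equality first in [C], then
    in [D]. *)
Lemma markov x n C D : good x -> past n C -> measurable D ->
  Q x (C `&` iter n shift @^-1` D) = \int[Q x]_(w in C) Q (coordX n w) D.
Proof.
move=> [Kx Kn] pC mD.
have mQX D' : measurable D' ->
    measurable_fun setT (fun w : path U V => Q (coordX n w) D').
  by move=> mD'; exact: (measurableT_comp (measurable_Q mD') (measurable_coordX n)).
have mth D' : measurable D' -> measurable (iter n shift @^-1` D' : set (path U V)).
  by move=> mD'; rewrite -[X in measurable X]setTI; exact: measurable_iter_shift.
have Q0 (D' : set (path U V)) (w : path U V) : 0 <= Q (coordX n w) D' by [].
have mC : measurable C by exact: past_measurable pC.
have h1 m A B A' B' : (forall k, measurable (A k)) -> (forall k, measurable (B k)) ->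
    (forall k, measurable (A' k)) -> (forall k, measurable (B' k)) ->
    Q x (rect n A B `&` iter n shift @^-1` rect m A' B') =
    \int[Q x]_(w in rect n A B) Q (coordX n w) (rect m A' B').
  move=> mA mB mA' mB'.
  have mR : measurable (rect n A B : set (path U V)).
    by apply: (@measurable_rects _ _ _ _ n); exists A, B.
  rewrite (@ge0_ae_eq_integral_nm _ _ _ (Q x) _ (coordX n @^-1` (~` K)) _
    (fun w => fd m A' B' (cst 1) (coordX n w)))//.
  + rewrite law//; last 2 first.
    * exact: measurable_fd.
    * by move=> y; exact: fd_ge0.
    rewrite -rect_cat (chain_law_rect _ (law Kx)) ?fd_cat//;
      by move=> k; rewrite /catf; case: ifP.
  + by move=> w; exact: fd_ge0.
  + by move=> w /= /contrapT Kw; rewrite (chain_law_rect _ (law Kw)).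
have mR m A' B' : (forall k, measurable (A' k)) -> (forall k, measurable (B' k)) ->
    measurable (rect m A' B' : set (path U V)).
  by move=> mA' mB'; apply: (@measurable_rects _ _ _ _ m); exists A', B'.
have h2 m A' B' : (forall k, measurable (A' k)) -> (forall k, measurable (B' k)) ->
    Q x (C `&` iter n shift @^-1` rect m A' B') =
    \int[Q x]_(w in C) Q (coordX n w) (rect m A' B').
  move=> mA' mB'.
  have mD' := mR m _ _ mA' mB'.
  pose m1 : {measure set (path U V) -> \bar R} := mrestr (Q x) (mth _ mD').
  pose m2 : {measure set (path U V) -> \bar R} := dens (Q x) (mQX _ mD') (Q0 _).
  rewrite -[LHS]/(m1 C) -[RHS]/(m2 C).
  apply: (@past_measure_unique _ _ U V R n m1 m2) => //.
  - by rewrite /m1 /= /mrestr setTI; apply: pker_lty; exact: (mth _ mD').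
  - by move=> A B mA mB; rewrite /m1 /m2 /= /mrestr h1.
have m1C : measurable_fun setT (fun w : path U V => (\1_C w)%:E : \bar R).
  exact/measurable_EFinP/measurable_indic.
have p1C w : 0 <= (\1_C w)%:E :> \bar R by rewrite lee_fin.
pose m1 := pushm (mrestr (Q x) mC) (measurable_iter_shift n).
pose m2 := mixture (pushm (dens (Q x) m1C p1C) (measurable_coordX n)) Q.
have m2E D' : measurable D' -> m2 D' = \int[Q x]_(w in C) Q (coordX n w) D'.
  move=> mD'; rewrite /m2 /mixture/=.
  rewrite ge0_integral_pushforward//;
    [|exact: measurable_coordX|exact: measurable_Q].
  rewrite preimage_setT dens_integral//; last exact: mQX.
  rewrite [RHS]integral_mkcond; apply: eq_integral => w _ /=.
  by rewrite patchE indicE; case: ifPn => _; rewrite ?mule1 ?mule0.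
rewrite -m2E// setIC.
rewrite -[LHS]/(m1 D).
apply: (@path_measure_unique _ _ U V R m1 m2) => //.
- rewrite /m1 /= /pushforward/mrestr preimage_setT setTI.
  exact: pker_lty.
- move=> m A B mA mB; rewrite [RHS](m2E _ (mR m A B mA mB)).
  by rewrite /m1 /= /pushforward /mrestr setIC h2.
Qed.

End family.
End chain_law.

(** * Stationary marked chains and the zero-one law *)

Section vanishing_integral.
Context {d} {T : measurableType d} {R : realType}.
Local Open Scope ereal_scope.

Lemma ge0_integral_eq0_ae (m : {measure set T -> \bar R}) (f : T -> \bar R) :
  measurable_fun setT f -> (forall x, 0 <= f x) -> \int[m]_x f x = 0 ->
  {ae m, forall x, f x = 0}.
Proof.
move=> mf f0 int0; have : ae_eq m setT f (cst 0).
  apply/ae_eq_integral_abs => //; rewrite -[RHS]int0.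
  by apply: eq_integral => x _; rewrite gee0_abs.
by apply: filterS => x; exact.
Qed.

Lemma ge0_ae_integral0 (m : {measure set T -> \bar R}) (f : T -> \bar R) :
  measurable_fun setT f -> (forall x, 0 <= f x) ->
  {ae m, forall x, f x = 0} -> \int[m]_x f x = 0.
Proof.
move=> mf f0 h; rewrite (ge0_ae_eq_integral (g := cst 0)) ?integral0//.
by apply: filterS h.
Qed.

End vanishing_integral.

Section stationary_chain.
Local Open Scope ereal_scope.
Context {dU dV} {U : measurableType dU} {V : measurableType dV} {R : realType}.
Variables (Gam : R.-pker U ~> U) (rho : R.-pker U ~> V).
Variables (Q : R.-pker U ~> path U V) (K : set U).
Hypotheses (mK : measurable K).
Hypothesis law : forall x, K x -> chain_law Gam rho x (Q x).
Variable m : probability U R.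
Hypothesis m_inv : forall A, measurable A -> \int[m]_x Gam x A = m A.
Hypothesis mKC : m (~` K) = 0.

(** The law of the marked chain whose initial state has law [m]. *)
Definition stationary_law : probability (path U V) R := mixture m Q.
Let mu := stationary_law.

Let mKCn : measurable (~` K). Proof. exact: measurableC. Qed.

Lemma integral_inv f : measurable_fun setT f -> (forall x, 0 <= f x) ->
  \int[m]_x \int[Gam x]_y f y = \int[m]_x f x.
Proof.
move=> mf f0; rewrite -mixture_integral//.
by apply: eq_measure_integral => A mA _; exact: m_inv.
Qed.

Lemma integral_stationary f : measurable_fun setT f -> (forall x, 0 <= f x) ->
  \int[mu]_w f w = \int[m]_x \int[Q x]_w f w.
Proof. exact: mixture_integral. Qed.

Lemma stationary_rect n A B : (forall k, measurable (A k)) ->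
  (forall k, measurable (B k)) ->
  mu (rect n A B) = \int[m]_x fd Gam rho n A B (cst 1) x.
Proof.
move=> mA mB; rewrite -[LHS]/(\int[m]_x Q x (rect n A B)).
apply: (ge0_ae_eq_integral_nm measurableT mKCn mKC) => //.
- by move=> x; exact: fd_ge0.
- by move=> x /= /contrapT Kx; exact: (chain_law_rect _ (law Kx)).
Qed.

Lemma stationary_shift C : measurable C -> mu (@shift _ _ U V @^-1` C) = mu C.
Proof.
move=> mC; pose m1 := pushm mu (@measurable_shift _ _ U V).
rewrite -[LHS]/(m1 C).
apply: (@path_measure_unique _ _ U V R m1 mu) => //.
  by rewrite /m1/= /pushforward preimage_setT -[X in X < _]/(mu setT) probability_setT ltry.
move=> n A B mA mB; rewrite /m1/= /pushforward.
pose A' k := if k is k'.+1 then A k' else setT.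
pose B' k := if k is k'.+1 then B k' else setT.
rewrite (_ : _ @^-1` _ = rect n.+1 A' B'); last first.
  apply/seteqP; split => w h.
    by case => [|k]// kn; exact: h.
  by move=> k kn; exact: (h k.+1).
rewrite stationary_rect;
  [|by case=> [|k]; [exact: measurableT|exact: mA]
   |by case=> [|k]; [exact: measurableT|exact: mB]].
have mf : measurable_fun setT (fd Gam rho n A B (cst 1)) by exact: measurable_fd.
have f0 x : 0 <= fd Gam rho n A B (cst 1) x by exact: fd_ge0.
rewrite stationary_rect// -(integral_inv mf f0).
apply: eq_integral => x _ /=.
by rewrite indicT prob_kernel !mul1e.
Qed.

Lemma stationary_iter_shift n C : measurable C ->
  mu (iter n (@shift _ _ U V) @^-1` C) = mu C.
Proof.
move=> mC; elim: n => // n ih; rewrite -{}ih.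
rewrite (_ : iter n.+1 _ @^-1` C = shift @^-1` (iter n shift @^-1` C)); last first.
  by apply/seteqP; split => w; rewrite /preimage/= -iterSr.
apply: stationary_shift.
by rewrite -[X in measurable X]setTI; exact: measurable_iter_shift.
Qed.

Lemma start_event x B : K x -> measurable B -> Q x (coordX 0 @^-1` B) = (\1_B x)%:E.
Proof.
move=> Kx mB; rewrite -(start law Kx (phi := fun x => (\1_B x)%:E))//.
- rewrite (eq_integral (fun w => (\1_(coordX 0 @^-1` B) w)%:E))//.
  rewrite integral_indic// ?setIT//.
  by rewrite -[X in measurable X]setTI; exact: measurable_coordX.
- exact/measurable_EFinP/measurable_indic.
Qed.

Lemma mcoordX n B : measurable B -> measurable (coordX n @^-1` B : set (path U V)).
Proof. by move=> mB; rewrite -[X in measurable X]setTI; exact: measurable_coordX. Qed.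

Lemma stationary_coordX n B : measurable B -> mu (coordX n @^-1` B) = m B.
Proof.
move=> mB; rewrite (_ : coordX n @^-1` B = iter n shift @^-1` (coordX 0 @^-1` B)); last first.
  by apply/seteqP; split => w; rewrite /preimage/= /coordX iter_shiftE addn0.
rewrite stationary_iter_shift; last exact: mcoordX.
rewrite -[LHS]/(\int[m]_x Q x (coordX 0 @^-1` B)).
rewrite (ge0_ae_eq_integral_nm measurableT mKCn mKC (g := fun x => (\1_B x)%:E))//.
- by rewrite integral_indic// setIT.
- by move=> x /= /contrapT Kx; exact: start_event.
Qed.

Lemma ae_K : {ae m, forall x, K x}.
Proof. by exists (~` K); split. Qed.

Lemma ae_good : {ae m, forall x, good Q K x}.
Proof.
have h : {ae m, forall x, forall n, Q x (coordX n @^-1` (~` K)) = 0}.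
  apply/ae_foralln => n; apply: ge0_integral_eq0_ae => //.
  - by apply: measurable_kernel; exact: mcoordX.
  - by have := stationary_coordX n mKCn; rewrite mKC.
by apply: filterS2 ae_K h.
Qed.

Lemma one_step x A : good Q K x -> measurable A ->
  Q x (shift @^-1` A) = \int[Gam x]_y Q y A.
Proof.
move=> gx mA; have [Kx _] := gx.
have := markov mK law gx (n := 1%N) (C := setT) _ mA.
rewrite setTI => -> //; last exact: pastT.
have mQ : measurable_fun setT (fun y => Q y A) by exact: measurable_kernel.
have := @law x Kx 1%N (fun=> setT) (fun=> setT) (fun y => Q y A) _ _ mQ _.
rewrite /= indicT prob_kernel !mul1e => <-//.
by congr integral; apply/seteqP; split => w // _ k.
Qed.

Section irreducible.
Variable phi : {measure set U -> \bar R}.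
Hypothesis phi_nontrivial : 0 < phi setT.
Hypothesis irreducible : forall x, K x -> forall B, measurable B -> 0 < phi B ->
  exists n, 0 < Q x (coordX n @^-1` B).

(** Almost every stationary trajectory that starts in [D] stays in [D], hence
    some starting point in [D] never leads to [~` D]; by irreducibility
    [phi (~` D)] vanishes. *)
Lemma absorbing_phi D : measurable D ->
  {ae m, forall x, D x -> Gam x (~` D) = 0} -> m D != 0 -> phi (~` D) = 0.
Proof.
move=> mD aD mD0.
have mDC : measurable (~` D) by exact: measurableC.
pose leave n := (coordX 0 @^-1` D `&` coordX n @^-1` (~` D)) : set (path U V).
have mleave n : measurable (leave n) by apply: measurableI; exact: mcoordX.
have leave1 : mu (coordX 0 @^-1` D `&` coordX 1 @^-1` (~` D)) = 0.
  rewrite -[LHS]/(\int[m]_x Q x (leave 1%N)).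
  apply: ge0_ae_integral0 => //; first exact: measurable_kernel.
  apply: filterS2 ae_K aD => x Kx aD.
  have mI : measurable_fun setT (fun x => (\1_(~` D) x)%:E : \bar R).
    exact/measurable_EFinP/measurable_indic.
  have I0 y : 0 <= (\1_(~` D) y)%:E :> \bar R by rewrite lee_fin.
  have := @law x Kx 1%N (fun=> D) (fun=> setT) _ (fun=> mD) (fun=> measurableT) mI I0.
  have E1 : \int[Gam x]_y (\1_(~` D) y)%:E = Gam x (~` D).
    by rewrite integral_indic// setIT.
  rewrite /= prob_kernel mule1 E1 => h.
  transitivity (\int[Q x]_(w in rect 1 (fun=> D) (fun=> setT))
      (\1_(~` D) (coordX 1 w))%:E); last first.
    rewrite h.
    have [xD|xD] := pselect (D x); first by rewrite aD// mule0.
    by rewrite indicE memNset// mul0e.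
  rewrite (eq_integral (fun w => (\1_(coordX 1 @^-1` (~` D)) w)%:E))//.
  rewrite integral_indic//; last exact: mcoordX.
    congr (Q x _); apply/seteqP; split => w /=.
      by move=> [h1 h2]; split => // -[|]//.
    by move=> [h2 /(_ 0%N (ltnSn _))[]].
  by apply: (@measurable_rects _ _ _ _ 1); exists (fun=> D), (fun=> setT).
have leaven n : mu (leave n) = 0.
  elim: n => [|n ih].
    by rewrite /leave (_ : _ `&` _ = set0) ?measure0//; apply/seteqP; split => w //= [].
  have m2 : measurable (iter n shift @^-1` leave 1%N : set (path U V)).
    by rewrite -[X in measurable X]setTI; exact: measurable_iter_shift.
  apply/eqP; rewrite -measure_le0.
  apply: (@le_trans _ _ (mu (leave n `|` iter n shift @^-1` leave 1%N))).
    apply: le_measure; rewrite ?inE; [exact: mleave|exact: measurableU|].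
    move=> w [/= h1 h2]; have [h3|h3] := pselect (D (coordX n w)); [right|by left].
    by split; rewrite /= /coordX iter_shiftE ?addn0 ?addn1.
  apply: (@le_trans _ _ (mu (leave n) + mu (iter n shift @^-1` leave 1%N))).
    exact: measureU2.
  by rewrite ih add0e stationary_iter_shift// leave1.
have h : {ae m, forall x, forall n, Q x (leave n) = 0}.
  apply/ae_foralln => n; apply: ge0_integral_eq0_ae => //; last exact: leaven.
  exact: measurable_kernel.
have [x [Dx Kx hx]] : exists x, [/\ D x, K x & forall n, Q x (leave n) = 0].
  apply: contrapT => hn; move/negP: mD0; apply; apply/eqP.
  apply: measure_negligible => //.
  have [N [mN N0 hN]] : {ae m, forall x, K x /\ forall n, Q x (leave n) = 0}.
    by apply: filterS2 ae_K h.
  exists N; split => // x Dx; apply: hN => -[Kx hx]; apply: hn.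
  by exists x.
apply/eqP; rewrite eq_le measure_ge0 andbT leNgt; apply/negP => phi0.
have [n] := irreducible Kx mDC phi0.
apply/negP; rewrite -leNgt.
apply: (@le_trans _ _ (Q x (leave n `|` coordX 0 @^-1` (~` D)))).
  apply: le_measure; rewrite ?inE; [exact: mcoordX| |].
    by apply: measurableU => //; exact: mcoordX.
  by move=> w /= hw; have [h3|h3] := pselect (D (coordX 0 w)); [left|right].
apply: (@le_trans _ _ (Q x (leave n) + Q x (coordX 0 @^-1` (~` D)))).
  by apply: measureU2 => //; exact: mcoordX.
by rewrite hx add0e start_event// indicE memNset.
Qed.

(** If [D] and [~` D] both had positive measure, [phi] would vanish on both. *)
Lemma absorbing_zero_one D : measurable D ->
  {ae m, forall x, D x -> Gam x (~` D) = 0} ->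
  {ae m, forall x, ~ D x -> Gam x D = 0} -> m D = 0 \/ m D = 1.
Proof.
move=> mD h1 h2; have [->|D0] := eqVneq (m D) 0; [by left|right].
have mDC : measurable (~` D) by exact: measurableC.
have p1 := absorbing_phi mD h1 D0.
have [DC0|DC0] := eqVneq (m (~` D)) 0.
  by rewrite -(setCK D) probability_setC// DC0 sube0.
have p2 : phi (~` ~` D) = 0 by apply: absorbing_phi => //; rewrite setCK.
have : phi setT <= phi D + phi (~` D).
  by rewrite -(setUv D); exact: measureU2.
by rewrite p1 -[X in phi X + _]setCK p2 adde0 leNgt phi_nontrivial.
Qed.

(** Put [h x := Q x A]. For an event [C] of the first [n] coordinates that is
    close to [A], the invariance of [A] and the Markov property give
    [mu (C `&` A) = \int[mu]_(w in C) h (coordX n w)], which is close to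
    [\int[mu]_(w in A) h (coordX n w)]; by stationarity the latter is the
    integral of [h * h]. So [h] and [h * h] have the same integral, and [h] takes
    the values 0 and 1 only. Since [h] is harmonic, the chain leaves neither
    [h = 1] nor its complement, and [absorbing_zero_one] concludes. *)
Lemma shift_zero_one A : measurable A -> shift @^-1` A = A ->
  mu A = 0 \/ mu A = 1.
Proof.
move=> mA sA.
have sAn n : iter n shift @^-1` A = A.
  elim: n => // n ih; rewrite -[RHS]sA -[in RHS]ih.
  by apply/seteqP; split => w; rewrite /preimage/= -iterSr.
pose h x := Q x A.
have mh : measurable_fun setT h by exact: measurable_kernel.
have h0 x : 0 <= h x by [].
have h1 x : h x <= 1 by exact: pker_le1.
have hf x : h x \is a fin_num by rewrite ge0_fin_numE// (le_lt_trans (h1 x)) ?ltry.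
have muA : mu A = \int[m]_x h x by [].
have h1m x : 0 <= 1 - h x by rewrite subre_ge0// h1.
have mhn n : measurable_fun setT (fun w : path U V => h (coordX n w)).
  exact: (measurableT_comp mh (measurable_coordX n)).
(* Stationarity and the invariance of A replace index n by index 0, and the
   state of index 0 is the starting point. *)
have EA n : \int[mu]_(w in A) h (coordX n w) = \int[m]_x (h x * h x).
  have -> : \int[mu]_(w in A) h (coordX n w) = \int[mu]_(w in A) h (coordX 0 w).
    pose f w := (\1_A w)%:E * h (coordX 0 w).
    have mf : measurable_fun setT f.
      apply: emeasurable_funM => //; exact/measurable_EFinP/measurable_indic.
    have f0 w : 0 <= f w by rewrite mule_ge0// lee_fin.
    have indE k : \int[mu]_(w in A) h (coordX k w) = \int[mu]_w ((\1_A w)%:E * h (coordX k w)).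
      rewrite integral_mkcond; apply: eq_integral => w _; rewrite patchE indicE.
      by case: ifPn => _; rewrite ?mul1e ?mul0e.
    rewrite !indE -(integral_theta (measurable_iter_shift n) (stationary_iter_shift n) mf f0).
    apply: eq_integral => w _; rewrite /f /coordX iter_shiftE addn0.
    by congr (_%:E * _); rewrite -[in LHS](sAn n) !indicE; congr (_%:R); apply/idP/idP; rewrite !inE.
  rewrite -[LHS]/(\int[mu]_(w in A) (h \o coordX 0) w) integral_mkcond.
  rewrite integral_stationary; last 2 first.
  - apply/(measurable_restrictT _ mA); apply: measurable_funTS; exact: mhn.
  - by move=> w; rewrite patchE; case: ifP.
  apply: (ge0_ae_eq_integral_nm measurableT mKCn mKC).
  - by move=> x; apply: integral_ge0 => w _; rewrite patchE; case: ifP.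
  - by move=> x; rewrite mule_ge0.
  move=> x /= /contrapT Kx; rewrite -integral_mkcond.
  have mE : measurable (h @^-1` [set h x]).
    rewrite -[X in measurable X]setTI; apply: mh => //; exact: emeasurable_set1.
  rewrite (ge0_ae_eq_integral_nm mA (N := coordX 0 @^-1` (~` (h @^-1` [set h x])))
    (g := cst (h x)))//.
  - by rewrite integral_cst.
  - by apply: mcoordX; exact: measurableC.
  - rewrite start_event//; last exact: measurableC.
    by rewrite indicE memNset// => /(_ erefl).
  - by move=> w /= /contrapT.
have muT : mu setT < +oo by rewrite -[X in X < _]/(mu setT) probability_setT ltry.
have le_b : mu A <= \int[m]_x (h x * h x).
  apply/lee_addgt0Pr => e e0; have e20 : (0 < e / 2)%R by rewrite divr_gt0.
  have [n [C [pC hC]]] := approx_past muT mA e20.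
  have mC := past_measurable pC.
  have mY : measurable (A `+` C) by apply: measurableU; apply: measurableD.
  have muCA : mu (C `&` A) = \int[mu]_(w in C) h (coordX n w).
    rewrite -[in LHS](sAn n) -[LHS]/(\int[m]_x Q x (C `&` iter n shift @^-1` A)).
    rewrite [RHS]integral_mkcond [RHS]integral_stationary; last 2 first.
    - apply/(measurable_restrictT _ mC); apply: measurable_funTS; exact: mhn.
    - by move=> w; rewrite patchE; case: ifP.
    have [N [mN N0 hN]] := ae_good.
    apply: (ge0_ae_eq_integral_nm measurableT mN N0) => //.
    - by move=> x; apply: integral_ge0 => w _; rewrite patchE; case: ifP.
    move=> x Nx; have gx : good Q K x by apply: contrapT => /hN.
    by rewrite -integral_mkcond (markov mK law gx pC mA).
  have s1 : A `<=` (C `&` A) `|` (A `+` C).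
    by move=> w Aw; have [Cw|Cw] := pselect (C w); [left|right; left].
  have s2 : C `<=` A `|` (A `+` C).
    by move=> w Aw; have [Cw|Cw] := pselect (A w); [left|right; right].
  apply: (@le_trans _ _ (mu (C `&` A) + (e / 2)%:E)).
    apply: (@le_trans _ _ (mu ((C `&` A) `|` (A `+` C)))).
      by apply: le_measure; rewrite ?inE//; apply: measurableU => //; exact: measurableI.
    apply: (le_trans (measureU2 _ _ _)) => //; first exact: measurableI.
    by rewrite leeD2l// ltW.
  rewrite [in leRHS](splitr e) EFinD addeA leeD2r// muCA -(EA n).
  apply: (@le_trans _ _ (\int[mu]_(w in A `|` (A `+` C)) h (coordX n w))).
    apply: ge0_subset_integral => //; first exact: measurableU.
    by apply: measurable_funTS; exact: mhn.
  have -> : A `|` (A `+` C) = A `|` (C `\` A).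
    by apply/seteqP; split => w; rewrite /setY/=/setD/=; tauto.
  rewrite ge0_integral_setU//; last 3 first.
  - exact: measurableD.
  - by apply: measurable_funTS; exact: mhn.
  - by apply/disj_set2P; rewrite setDE setICA setICr setI0.
  rewrite leeD2l//.
  apply: (@le_trans _ _ (\int[mu]_(w in C `\` A) 1)).
    apply: ge0_le_integral => //; first exact: measurableD.
    by apply: measurable_funTS; exact: mhn.
  rewrite integral_cst ?mul1e; last exact: measurableD.
  apply: (@le_trans _ _ (mu (A `+` C))); last exact: ltW.
  apply: le_measure; rewrite ?inE//; first exact: measurableD.
  by move=> w; right.
have ae01 : {ae m, forall x, h x = 0 \/ h x = 1}.
  have : {ae m, forall x, h x * (1 - h x) = 0}.
    apply: ge0_integral_eq0_ae.
    - by apply: emeasurable_funM => //; exact: emeasurable_funB.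
    - by move=> x; rewrite mule_ge0.
    have mhh : measurable_fun setT (fun x => h x * h x) by exact: emeasurable_funM.
    have mh1 : measurable_fun setT (fun x => h x * (1 - h x)).
      by apply: emeasurable_funM => //; exact: emeasurable_funB.
    have : mu A = \int[m]_x (h x * h x) + \int[m]_x (h x * (1 - h x)).
      rewrite muA -ge0_integralD//.
      - apply: eq_integral => x _; rewrite -ge0_muleDr//.
        by rewrite addeC subeK// mule1.
      - by move=> x _; rewrite mule_ge0.
      - by move=> x _; rewrite mule_ge0.
    move=> E; apply/eqP; rewrite eq_le integral_ge0 ?andbT; last first.
      by move=> x _; rewrite mule_ge0.
    have muAfin : mu A \is a fin_num by exact: fin_num_measure.
    have hhf : \int[m]_x (h x * h x) \is a fin_num.
      rewrite ge0_fin_numE; last by apply: integral_ge0 => x _; rewrite mule_ge0.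
      apply: (@le_lt_trans _ _ (mu A)); last by rewrite -ge0_fin_numE.
      by rewrite E leeDl// integral_ge0// => x _; rewrite mule_ge0.
    by rewrite -(leeD2lE _ _ hhf) -E adde0.
  apply: filterS => x /eqP; rewrite mule_eq0 => /orP[/eqP ->|]; [by left|].
  by rewrite sube_eq ?fin_num_adde_defr// add0e => /eqP <-; right.
pose D := [set x | h x = 1].
have mD : measurable D.
  by rewrite -[X in measurable X]setTI; exact: (mh measurableT _ (emeasurable_set1 1)).
(* Harmonicity, because A is also the event that the shifted trajectory is
   in A. *)
have harm : {ae m, forall x, h x = \int[Gam x]_y h y}.
  by apply: filterS ae_good => x gx; rewrite -one_step// sA.
have mh' : measurable_fun setT (fun x => 1 - h x) by exact: emeasurable_funB.
have sub0 x (f : U -> \bar R) (B : set U) : measurable_fun setT f -> measurable B ->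
    (forall y, 0 <= f y) -> \int[Gam x]_y f y = 0 -> (forall y, B y -> f y <> 0) ->
    Gam x B = 0.
  move=> mf mB f0 int0 hB; apply: measure_negligible => //.
  have [N [mN N0 hN]] := ge0_integral_eq0_ae mf f0 int0.
  by exists N; split => // y /hB hy; apply: hN.
have [|||D0|D1] := @absorbing_zero_one D.
- exact: mD.
- apply: filterS harm => x hx Dx.
  apply: (sub0 x (fun y => 1 - h y)) => //; first exact: measurableC.
  + have : 1 = \int[Gam x]_y h y + \int[Gam x]_y (1 - h y).
      rewrite -ge0_integralD//.
      rewrite (eq_integral (cst 1)) ?integral_cst ?mul1e ?prob_kernel// => y _ /=.
      by rewrite addeC subeK.
    rewrite -hx Dx => E; apply/eqP; rewrite eq_le integral_ge0 ?andbT; last first.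
      by move=> y _; exact: h1m.
    by rewrite -(@leeD2lE _ 1)// -E adde0.
  + move=> y /= hy /eqP; rewrite sube_eq ?fin_num_adde_defr// add0e => /eqP h1y.
    by apply: hy; exact/esym.
- apply: filterS2 harm ae01 => x hx [h0x|h1x] Dx; last by [].
  apply: (sub0 x h) => //; first by rewrite -hx.
  by move=> y /= -> /eqP; rewrite onee_eq0.
- left; rewrite muA; apply: ge0_ae_integral0 => //.
  have aeD : {ae m, forall x, ~ D x} by exists D; split => // x /= /contrapT.
  by apply: filterS2 aeD ae01 => x Dx [].
- right; rewrite muA (ge0_ae_eq_integral (g := cst 1)) ?integral_cst ?mul1e//.
    exact: probability_setT.
  have aeD : {ae m, forall x, D x}.
    exists (~` D); split => //; first exact: measurableC.
    by have := probability_setC m mD; rewrite D1 subee.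
  by apply: filterS aeD.
Qed.

End irreducible.
End stationary_chain.

(** * Invariant events from almost every starting point *)

Lemma contraction_arith {R : realFieldType} (e q p r s : R) :
  s < e * q / 3 -> p <= (1 - e) * r -> q <= p + s ->
  (1 - e) * r <= (1 - e) * (q + s) -> 0 <= e * s -> 0 < q -> 0 < e -> 0 <= s ->
  False.
Proof. by nra. Qed.

Section uniform_null_set.
Local Open Scope ereal_scope.
Context {dU dV} {U : measurableType dU} {V : measurableType dV} {R : realType}.
Variables (Gam : R.-pker U ~> U) (rho : R.-pker U ~> V).
Variables (Q : R.-pker U ~> path U V) (K : set U).
Hypotheses (mK : measurable K).
Hypothesis law : forall x, K x -> chain_law Gam rho x (Q x).
Variable m : probability U R.
Hypothesis m_inv : forall A, measurable A -> \int[m]_x Gam x A = m A.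
Hypothesis mKC : m (~` K) = 0.
Variable phi : {measure set U -> \bar R}.
Hypothesis phi_nontrivial : 0 < phi setT.
Hypothesis irreducible : forall x, K x -> forall B, measurable B -> 0 < phi B ->
  exists n, 0 < Q x (coordX n @^-1` B).
Variable a : nat -> set U.
Hypothesis ma : forall i, measurable (a i).
Hypothesis a_gen : @measurable _ U = <<s range a >>.
Hypothesis a0 : range a set0.
Hypothesis aC : setC_closed (range a).
Hypothesis aU : setU_closed (range a).

Let mu := stationary_law Q m.
(** A summable sequence of thresholds. *)
Let r j : R := ((2 ^ j.+1)%:R^-1)%R.

Let r_gt0 j : (0 < r j)%R.
Proof. by rewrite /r invr_gt0 ltr0n expn_gt0. Qed.

Let mX n B : measurable B -> measurable (coordX n @^-1` B : set (path U V)).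
Proof. exact: mcoordX. Qed.

Let c n j x i : \bar R := if m (a i) < (r j)%:E then Q x (coordX n @^-1` a i) else 0.

Let bj n j x := esups (c n j x) 0%N.

(** An upper bound for the mass that the law of the [n]-th state gives to sets
    that are null for [m]. Each null set is approximated, simultaneously for [m]
    and for this law, by members of the countable algebra that have small
    measure; the supremum over these countably many sets is measurable in [x]. *)
Definition sing_mass n x := einfs (fun j => bj n j x) 0%N.

Let b := sing_mass.

Let measurable_bj n j : measurable_fun setT (bj n j).
Proof.
apply: (measurable_fun_esups (f := fun i x => c n j x i)) => i.
rewrite /c; case: (m (a i) < _) => //.
exact: (measurable_kernel Q _ (mX n (ma i))).
Qed.

Lemma measurable_sing_mass n : measurable_fun setT (b n).
Proof. exact: (measurable_fun_einfs (f := fun j x => bj n j x)). Qed.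

Lemma sing_mass_null n x B : measurable B -> m B = 0 ->
  Q x (coordX n @^-1` B) <= b n x.
Proof.
move=> mB B0; apply: le_ereal_inf_tmp => _ [j _ <-].
apply/lee_addgt0Pr => e e0.
pose nu : {measure set U -> \bar R} := pushm (Q x) (@measurable_coordX _ _ U V n).
pose mnu : {measure set U -> \bar R} := measure_add m nu.
have mnuE C : mnu C = m C + Q x (coordX n @^-1` C) by exact: measure_addE.
have mnuT : mnu setT < +oo.
  by rewrite mnuE lte_add_pinfty// ?preimage_setT ?pker_lty// -[X in X < _]/(m setT) probability_setT ltry.
have [|||||||_ [i _ <-] hi] := @approx_algebra _ _ R mnu (range a) _ _ _ _ _ B _ (Num.min e (r j)).
- exact: mnuT.
- exact: a0.
- exact: aC.
- exact: aU.
- by move=> _ [i _ <-].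
- by rewrite -a_gen.
- by rewrite lt_min e0 r_gt0.
have mY : measurable (B `+` a i) by apply: measurableU; apply: measurableD.
move: hi; rewrite mnuE EFin_min lt_min => /andP[h1 h2].
have h3 : m (a i) < (r j)%:E.
  apply: (@le_lt_trans _ _ (m (B `|` (B `+` a i)))).
    apply: le_measure; rewrite ?inE//; first exact: measurableU.
    by move=> y ay; have [By|By] := pselect (B y); [left|right; right].
  apply: (@le_lt_trans _ _ (m B + m (B `+` a i))); first exact: measureU2.
  rewrite B0 add0e; apply: le_lt_trans h2.
  by rewrite leeDl.
apply: (@le_trans _ _ (Q x (coordX n @^-1` (a i)) + e%:E)).
  apply: (@le_trans _ _ (Q x (coordX n @^-1` a i `|` coordX n @^-1` (B `+` a i)))).
    apply: le_measure; rewrite ?inE; [exact: mX| |].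
      by apply: measurableU; exact: mX.
    by move=> w /= Bw; have [h|h] := pselect (a i (coordX n w)); [left|right; left].
  apply: (@le_trans _ _ (Q x (coordX n @^-1` a i) + Q x (coordX n @^-1` (B `+` a i)))).
    by apply: measureU2; exact: mX.
  rewrite leeD2l//; apply/ltW; apply: le_lt_trans h1.
  by rewrite leeDr.
rewrite leeD2r//; apply: ereal_sup_ubound; exists i => //.
by rewrite /c h3.
Qed.

Let phi_m B : measurable B -> m B = 0 -> phi B = 0.
Proof.
move=> mB B0; apply/eqP; rewrite eq_le measure_ge0 andbT leNgt; apply/negP => pB.
have h : {ae m, forall x, forall n, Q x (coordX n @^-1` B) = 0}.
  apply/ae_foralln => n; apply: ge0_integral_eq0_ae => //.
  - by apply: measurable_kernel; exact: mX.
  - by have := stationary_coordX mK law m_inv mKC n mB; rewrite B0.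
have aeK := @ae_K _ U R K mK m mKC.
have [N [mN N0 hN]] : {ae m, forall x, K x /\ forall n, Q x (coordX n @^-1` B) = 0}.
  by apply: filterS2 aeK h.
have [x Nx] : exists x, ~ N x.
  apply: contrapT => hx; have : m setT = 0.
    by rewrite (_ : setT = N)//; apply/seteqP; split => // x _; apply: contrapT => Nx; apply: hx; exists x.
  by move/eqP; rewrite probability_setT onee_eq0.
have [Kx hx] : K x /\ forall n, Q x (coordX n @^-1` B) = 0 by apply: contrapT => /hN.
by have [n] := irreducible Kx mB pB; rewrite hx ltxx.
Qed.

(** Otherwise the law of each [X n] would be carried by the limit superior of
    sets [a i] of summable measure, so by a null set (Borel-Cantelli), and the
    whole chain by the union [GG] of these null sets. But [phi] vanishes on null
    sets, so it charges the complement of [GG], which irreducibility makes the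
    chain visit. *)
Lemma sing_mass_lt1 x : K x -> exists n, b n x < 1.
Proof.
move=> Kx; apply: contrapT => hn.
have b1 n : 1 <= b n x by rewrite leNgt; apply/negP => h; apply: hn; exists n.
have ex n j : exists i, m (a i) < (r j)%:E /\ (1 - r j)%:E < Q x (coordX n @^-1` a i).
  have : (1 - r j)%:E < bj n j x.
    apply: (@lt_le_trans _ _ 1); first by rewrite lte_fin ltrBlDr ltrDl.
    by apply: le_trans (b1 n) _; apply: ereal_inf_lbound; exists j.
  move=> /ereal_sup_gt[_ [i _ <-]]; rewrite /c; case: ifPn => [h1 h2|_ h2].
    by exists i.
  exfalso; move: h2; rewrite lte_fin ltNge subr_ge0 invf_le1 ?ltr0n ?expn_gt0//.
  by rewrite ler1n expn_gt0.
have [i hi] := choice (fun nj : nat * nat => ex nj.1 nj.2).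
pose F n j := a (i (n, j)).
have mF n j : measurable (F n j) by exact: ma.
pose G n := lim_sup_set (F n).
have mG n : measurable (G n).
  by apply: bigcap_measurable => // k _; exact: bigcup_measurable.
have G0 n : m (G n) = 0.
  apply: lim_sup_set_cvg0 => //.
  apply: (@le_lt_trans _ _ 1); last by rewrite ltry.
  apply: le_trans (@epsilon_trick0 R 1%R xpredT ler01).
  apply: lee_nneseries => // j _.
  by have [h _] := hi (n, j); rewrite div1r; exact: ltW h.
have QG n : Q x (coordX n @^-1` (G n)) = 1.
  apply/eqP; rewrite eq_le pker_le1/=; last exact: mX.
  pose nu : {measure set U -> \bar R} := pushm (Q x) (@measurable_coordX _ _ U V n).
  rewrite -[leRHS]/(nu (G n)); apply/lee_addgt0Pr => e e0.
  rewrite -leeBlDr//.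
  have nuT A : measurable A -> nu A < +oo by move=> mA; apply: pker_lty; exact: mX.
  have mbig k : measurable (\bigcup_(j >= k) F n j) by exact: bigcup_measurable.
  have /cvg_lim <- // := lim_sup_set_cvg nu (F n) (mF n) (nuT _ (mbig 0%N)).
  apply: lime_ge.
    by apply/cvg_ex; eexists; exact: (lim_sup_set_cvg nu (F n) (mF n) (nuT _ (mbig 0%N))).
  apply: nearW => k.
  have [j hj] : exists j, (r (k + j)%N <= e)%R.
    exists (Num.truncn e^-1); rewrite /r invf_ple ?posrE ?ltr0n ?expn_gt0//.
    apply: ltW; apply: (lt_le_trans (truncnS_gt _)); rewrite ler_nat.
    apply: (leq_trans (ltn_expl _ (ltnSn 1))); rewrite leq_exp2l//.
    by apply: leqW; rewrite leq_addl.
  apply: (@le_trans _ _ (nu (F n (k + j)%N))).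
    apply: (@le_trans _ _ (1 - r (k + j)%N)%:E).
      by rewrite -EFinB lee_fin lerD2l lerN2.
    by have [_ h] := hi (n, (k + j)%N); exact: ltW h.
  apply: le_measure; rewrite ?inE//.
  by move=> y hy; exists (k + j)%N => //=; rewrite leq_addr.
pose GG := \bigcup_n G n.
have mGG : measurable GG by exact: bigcupT_measurable.
have GG0 : m GG = 0.
  apply: measure_negligible => //; apply: negligible_bigcup => n.
  by apply/(negligibleP _ (mG n)); exact: G0.
have mGGC : measurable (~` GG) by exact: measurableC.
have : 0 < phi (~` GG).
  rewrite lt_neqAle measure_ge0 andbT; apply/negP => /eqP h.
  have : phi setT <= phi GG + phi (~` GG).
    by rewrite -(setUv GG); exact: measureU2.
  by rewrite -h adde0 (phi_m mGG GG0) leNgt phi_nontrivial.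
move=> /(irreducible Kx mGGC)[n]; rewrite ltNge => /negP; apply.
have : Q x (~` (coordX n @^-1` G n)) <= 0.
  rewrite -[leLHS]/(pker_at Q x _) probability_setC; last exact: mX.
  by rewrite -[X in 1 - X]/(Q x _) QG subee.
apply: le_trans; apply: le_measure; rewrite ?inE; [exact: mX| |].
  by apply: measurableC; exact: mX.
by move=> w /= h1 h2; apply: h1; exists n.
Qed.

(** The points from which some later state charges null sets with mass at most
   [1 - k.+1%:R^-1]. *)
Let D k : set U :=
  [set x | good Q K x /\ exists n, b n x < (1 - k.+1%:R^-1)%:E].

Let mD k : measurable (D k).
Proof.
rewrite (_ : D k = good Q K `&` \bigcup_n [set x | b n x < (1 - k.+1%:R^-1)%:E]).
  apply: measurableI; first exact: measurable_good.
  apply: bigcupT_measurable => n; rewrite -[X in measurable X]setTI.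
  by apply: emeasurable_fun_infty_o => //; exact: measurable_sing_mass.
by apply/seteqP; split => x [gx]; [move=> [n h]; split => //; exists n
                                  |move=> [n _ h]; split => //; exists n].
Qed.

Lemma recurrent_set : exists k, m (D k) != 0.
Proof.
apply: contrapT => h.
have D0 : m (\bigcup_k D k) = 0.
  apply: measure_negligible; first exact: bigcupT_measurable.
  apply: negligible_bigcup => k; apply/(negligibleP _ (mD k)).
  by apply: contrapT => /eqP h'; apply: h; exists k.
have [N [mN N0 hN]] := @ae_good _ _ _ _ _ _ _ _ _ mK law _ m_inv mKC.
have : m setT <= m (\bigcup_k D k) + m N.
  apply: (@le_trans _ _ (m (\bigcup_k D k `|` N))); last first.
    by apply: measureU2 => //; exact: bigcupT_measurable.
  apply: le_measure; rewrite ?inE//.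
    by apply: measurableU => //; exact: bigcupT_measurable.
  move=> x _; have [gx|gx] := pselect (good Q K x); last by right; apply: hN.
  left; have [n hn] := sing_mass_lt1 gx.1.
  have bf : b n x \is a fin_num.
    rewrite ge0_fin_numE ?(lt_trans hn) ?ltry//.
    exact: le_trans (sing_mass_null n x measurable0 (measure0 _)).
  move: hn; rewrite -(fineK bf) lte_fin => hn.
  have d0 : (0 < 1 - fine (b n x))%R by rewrite subr_gt0.
  exists (Num.truncn (1 - fine (b n x))^-1) => //; split => //; exists n.
  rewrite -(fineK bf) lte_fin ltrBrDl -ltrBrDr invf_plt ?posrE//.
  exact: truncnS_gt.
by rewrite -[X in X <= _]/(m setT) probability_setT D0 N0 adde0 lee_fin ler10.
Qed.

(** One null set of starting points serves all invariant events. Let [e] be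
    [k.+1%:R^-1] for some [k] with [D k] not null. From points of [D k] the
    complement of [A] has probability at most [1 - e], since a later state is
    outside the null set where [~` A] has positive probability with probability
    at least [e]. Almost every trajectory visits [D k] infinitely often, so
    splitting at the first visit after time [n] gives
    [Q x (C `&` ~` A) <= (1 - e) * Q x C] for all events [C] of the first [n]
    coordinates. As [~` A] itself is approximated by such [C], it is null. *)
Theorem uniform_invariant_event :
  {ae m, forall x, forall A, measurable A -> shift @^-1` A = A -> mu A = 1 ->
    Q x A = 1}.
Proof.
have [k Dk0] := recurrent_set.
pose I := lim_sup_set (fun n => coordX n @^-1` D k) : set (path U V).
have mXD n : measurable (coordX n @^-1` D k : set (path U V)) by exact: mX.
have mbig n : measurable (\bigcup_(j >= n) coordX j @^-1` D k : set (path U V)).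
  by apply: bigcup_measurable.
have mI : measurable I by apply: bigcap_measurable.
have shI : shift @^-1` I = I.
  apply/seteqP; split => w hw N _.
    have [n /= Nn h] := hw N Logic.I; exists n.+1 => //=; exact: leqW.
  have [[//|n] /= Nn h] := hw N.+1 Logic.I; exists n => //.
have muI : mu I = 1.
  have [I0|//] := shift_zero_one mK law m_inv mKC phi_nontrivial irreducible mI shI.
  exfalso; move/negP: Dk0; apply; rewrite -measure_le0.
  have muT : mu (\bigcup_(j >= 0) coordX j @^-1` D k) < +oo.
    by rewrite (le_lt_trans (probability_le1 _ _)) ?ltry.
  have hc := lim_sup_set_cvg mu (fun n => coordX n @^-1` D k) mXD muT.
  rewrite -[leRHS]I0 -(cvg_lim _ hc)//; apply: lime_ge.
    by apply/cvg_ex; eexists; exact: hc.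
  apply: nearW => n; rewrite -[leLHS]/(m (D k)) -(stationary_coordX mK law m_inv mKC n (mD k)).
  by apply: le_measure; rewrite ?inE//= => w h; exists n => /=.
have aeI : {ae m, forall x, Q x (~` I) = 0}.
  have mIC : measurable (~` I) by exact: measurableC.
  apply: ge0_integral_eq0_ae => //; first exact: measurable_kernel.
  by have := probability_setC mu mI; rewrite muI subee.
have aeg := @ae_good _ _ _ _ _ _ _ _ _ mK law _ m_inv mKC.
apply: filterS2 aeI aeg => x QI gx A mA shA muA.
have mAC : measurable (~` A) by exact: measurableC.
have shAn n : iter n shift @^-1` (~` A) = ~` A.
  elim: n => // n ih.
  have shAC : shift @^-1` (~` A) = ~` A by rewrite -[in RHS]shA.
  rewrite -[RHS]ih; transitivity (iter n shift @^-1` (shift @^-1` (~` A))) => //.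
  by rewrite shAC.
have mth n C : measurable C -> measurable (iter n shift @^-1` C : set (path U V)).
  by move=> mC; rewrite -[X in measurable X]setTI; exact: measurable_iter_shift.
set e : R := (k.+1%:R^-1)%R.
have e0 : (0 < e)%R by rewrite invr_gt0.
have e1 : (0 <= 1 - e)%R by rewrite subr_ge0 invf_le1// ler1n.
pose h y := Q y (~` A).
have mh : measurable_fun setT h by exact: measurable_kernel.
have hae : {ae m, forall y, h y = 0}.
  apply: ge0_integral_eq0_ae => //.
  by have := probability_setC mu mA; rewrite muA subee.
pose B := [set y | h y != 0].
have mB : measurable B.
  by rewrite -[X in measurable X]setTI; apply: emeasurable_neq.
have B0 : m B = 0.
  apply: measure_negligible => //; have [N [mN N0 hN]] := hae.
  by exists N; split => // y hy; apply: hN; exact/eqP.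
(* Given the state [y], the invariant event fails with the probability that it
   fails from the [n]-th state on, which is zero unless that state is in the
   null set [B]. *)
have hD y : D k y -> h y <= (1 - e)%:E.
  move=> [gy [n hn]].
  have -> : h y = \int[Q y]_w h (coordX n w).
    have := markov mK law gy (@pastT _ _ U V n) mAC.
    by rewrite setTI shAn.
  apply: (@le_trans _ _ (\int[Q y]_w (\1_(coordX n @^-1` B) w)%:E)).
    apply: ge0_le_integral => //.
    - exact: (measurableT_comp mh (measurable_coordX n)).
    - by apply/measurable_EFinP; apply: measurable_indic; exact: mX.
    - move=> w _; rewrite indicE; have [hw|hw] := boolP (_ \in _).
        exact: pker_le1.
      by move: hw; rewrite notin_setE /= => /negP; rewrite negbK => /eqP ->.
  rewrite integral_indic//; last exact: mX.
  rewrite setIT; apply: le_trans (sing_mass_null n y mB B0) _.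
  exact: ltW.
pose q C := fine (Q x C).
have qE C : measurable C -> Q x C = (q C)%:E.
  by move=> mC; rewrite /q fineK// ge0_fin_numE// pker_lty.
have split_D j C : past j C ->
    (q (C `&` coordX j @^-1` D k `&` ~` A) <= (1 - e) * q (C `&` coordX j @^-1` D k))%R.
  move=> pC; have mC := past_measurable pC.
  have mX0 : measurable (coordX 0 @^-1` D k : set (path U V)) by exact: mX.
  have mX0A : measurable (coordX 0 @^-1` D k `&` ~` A) by exact: measurableI.
  have E1 : C `&` coordX j @^-1` D k `&` ~` A =
      C `&` iter j shift @^-1` (coordX 0 @^-1` D k `&` ~` A).
    rewrite -setIA -[in LHS](shAn j); congr (_ `&` _).
    by apply/seteqP; split => w; rewrite /preimage/= /coordX iter_shiftE addn0.
  have E2 : C `&` coordX j @^-1` D k =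
      C `&` iter j shift @^-1` (coordX 0 @^-1` D k).
    congr (_ `&` _).
    by apply/seteqP; split => w; rewrite /preimage/= /coordX iter_shiftE addn0.
  rewrite -lee_fin EFinM -!qE; last 2 first.
  - by apply: measurableI => //; exact: mX.
  - by apply: measurableI => //; apply: measurableI => //; exact: mX.
  rewrite E1 E2 (markov mK law gx pC mX0A) (markov mK law gx pC mX0).
  have mQ (F : set (path U V)) : measurable F ->
      measurable_fun setT (fun w : path U V => Q (coordX j w) F).
    move=> mF; exact: (measurableT_comp (measurable_kernel Q _ mF) (measurable_coordX j)).
  rewrite -ge0_integralZl//; last by apply: measurable_funTS; exact: mQ.
  have mKCj : measurable (coordX j @^-1` (~` K) : set (path U V)).
    by apply: mX; exact: measurableC.
  apply: ae_ge0_le_integral => //.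
  - by apply: measurable_funTS; exact: mQ.
  - by move=> w _; rewrite mule_ge0// lee_fin.
  - by apply: emeasurable_funM => //; apply: measurable_funTS; exact: mQ.
  exists (coordX j @^-1` (~` K)); split => //; first exact: gx.2.
  move=> w /= hw Kw; apply: hw => _.
  set y := coordX j w in Kw *.
  rewrite (start_event law Kw (mD k)) indicE.
  have [yD|yD] := boolP (y \in D k).
    rewrite mule1; apply: le_trans (hD y _); last by rewrite inE in yD.
    by apply: le_measure; rewrite ?inE//.
  rewrite mule0 -[leRHS](_ : Q y (coordX 0 @^-1` D k) = 0).
    by apply: le_measure; rewrite ?inE//; move=> ? [].
  by rewrite (start_event law Kw (mD k)) indicE (negbTE yD).
have key n C : past n C -> (q (C `&` ~` A) <= (1 - e) * q C)%R.
  move=> pC; have mC := past_measurable pC.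
  (* No visit to D k at the times from n to n + j - 1. *)
  pose Rj j := C `&` [set w : path U V | forall i, (i < j)%N -> ~ D k (coordX (n + i) w)].
  have RS j : Rj j.+1 = Rj j `&` ~` (coordX (n + j) @^-1` D k).
    apply/seteqP; split => w [Cw]; last first.
      move: Cw => [Cw h1] h2; split => // i; rewrite ltnS leq_eqVlt => /orP[/eqP ->//|].
      exact: h1.
    move=> h1; split; last exact: h1.
    by split => // i ij; apply: h1; exact: leqW.
  have pR j : past (n + j) (Rj j).
    elim: j => [|j ih].
      rewrite addn0 (_ : Rj 0%N = C)//.
      by apply/seteqP; split => w; [case|split].
    rewrite RS addnS; apply: pastI; first exact: past_le ih.
    by apply: pastC; exact: past_coordX.
  have mR j : measurable (Rj j) by exact: past_measurable (pR j).
  have qDI F G : measurable F -> measurable G -> q F = (q (F `&` G) + q (F `&` ~` G))%R.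
    move=> mF mG; apply: EFin_inj; rewrite EFinD -!qE//; last 2 first.
    - by apply: measurableI => //; exact: measurableC.
    - exact: measurableI.
    by rewrite addeC -setDE -measureDI.
  have tele j : (q (C `&` ~` A) + (1 - e) * q (Rj j) <=
                 (1 - e) * q C + q (Rj j `&` ~` A))%R.
    elim: j => [|j ih].
      rewrite (_ : Rj 0%N = C) 1?addrC//.
      by apply/seteqP; split => w; [case|split].
    have s1 := split_D _ _ (pR j).
    have s2 := qDI _ _ (mR j) (mXD (n + j)%N).
    have mRA : measurable (Rj j `&` ~` A) by exact: measurableI.
    have s3 := qDI _ _ mRA (mXD (n + j)%N).
    rewrite (setIAC _ (~` A)) (setIAC _ (~` A) (~` _)) -RS in s3.
    rewrite -RS in s2; move: ih s1 s2 s3.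
    move: (q (Rj j)) (q (Rj j.+1)) (q C) (q (C `&` ~` A)) (q (Rj j `&` ~` A))
      (q (Rj j.+1 `&` ~` A)) (q (Rj j `&` _)) (q (Rj j `&` _ `&` _)) => *.
    nra.
  have hc : Q x \o Rj @ \oo --> Q x (\bigcap_j Rj j).
    apply: nonincreasing_cvg_mu => //; first exact: pker_lty.
      by apply: bigcapT_measurable.
    move=> i j ij; apply/subsetPset => w [Cw hw]; split => // l li; apply: hw.
    exact: leq_trans ij.
  have R0 : Q x (\bigcap_j Rj j) = 0.
    apply/eqP; rewrite -measure_le0 -[leRHS]QI; apply: le_measure; rewrite ?inE.
    - by apply: bigcapT_measurable.
    - exact: measurableC.
    move=> w hw Iw; have [l /= nl Dl] := Iw n Logic.I.
    have [_ /(_ (l - n)%N)] := hw (l - n).+1 Logic.I.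
    by rewrite ltnS leqnn subnKC// => /(_ isT).
  rewrite R0 in hc; move/fine_cvgP : hc => [_ /cvgrPdist_lt hc].
  apply/ler_addgt0Pr => d d0; have [N _ hN] := hc _ d0.
  have := hN _ (leqnn N); rewrite /= sub0r normrN ger0_norm ?fine_ge0// -/(q (Rj N)) => qN.
  have t := tele N.
  have qle : (q (Rj N `&` ~` A) <= q (Rj N))%R.
    rewrite -lee_fin -!qE//; last exact: measurableI.
    by apply: le_measure; rewrite ?inE//; exact: measurableI.
  have q0 : (0 <= q (Rj N))%R by rewrite fine_ge0.
  move: qN t qle q0 e1; move: (q (Rj N)) (q C) (q (C `&` ~` A)) (q (Rj N `&` ~` A)) => *.
  nra.
have QAC : Q x (~` A) = 0.
  apply/eqP; rewrite -measure_le0 -[leLHS]/(Q x (~` A)) qE// lee_fin.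
  rewrite leNgt; apply/negP => qA0.
  have d0 : (0 < e * q (~` A) / 3)%R by rewrite divr_gt0// mulr_gt0.
  have QT : Q x setT < +oo by exact: pker_lty.
  have [n [C [pC hC]]] := approx_past QT mAC d0.
  have mC := past_measurable pC.
  have mY : measurable (~` A `+` C) by apply: measurableU; apply: measurableD.
  rewrite qE// lte_fin in hC.
  have k1 := key n C pC.
  have k2 : (q (~` A) <= q (C `&` ~` A) + q (~` A `+` C))%R.
    rewrite -lee_fin EFinD -!qE//; last exact: measurableI.
    apply: (@le_trans _ _ (Q x ((C `&` ~` A) `|` (~` A `+` C)))).
      apply: le_measure; rewrite ?inE//.
        by apply: measurableU => //; exact: measurableI.
      by move=> w Aw; have [Cw|Cw] := pselect (C w); [left|right; left].
    by apply: measureU2 => //; exact: measurableI.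
  have k3 : (q C <= q (~` A) + q (~` A `+` C))%R.
    rewrite -lee_fin EFinD -!qE//.
    apply: (@le_trans _ _ (Q x (~` A `|` (~` A `+` C)))).
      apply: le_measure; rewrite ?inE//; first exact: measurableU.
      by move=> w Cw; have [Aw|Aw] := pselect ((~` A) w); [left|right; right].
    exact: measureU2.
  have y0 : (0 <= q (~` A `+` C))%R by rewrite fine_ge0.
  have k4 := ler_wpM2l e1 k3.
  have k5 : (0 <= e * q (~` A `+` C))%R by rewrite mulr_ge0// ltW.
  by have := contraction_arith hC k1 k2 k4 k5 qA0 e0 y0.
have : Q x (~` ~` A) = 1 - Q x (~` A) by exact: (@probability_setC _ _ _ (pker_at Q x)).
by rewrite setCK QAC sube0.
Qed.

End uniform_null_set.

(** * Symmetry of the renewal operators *)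

Section renewal_operators.
Context {d} {U : measurableType d} {R : realType}.
Local Open Scope ereal_scope.
Variables (Gam : R.-pker U ~> U) (m : probability U R) (lam : U -> R).
Hypotheses (mlam : measurable_fun setT lam) (lam0 : forall x, (0 <= lam x)%R).
Local Notation leb := (@lebesgue_measure R).
Local Notation RR := (measurableTypeR R).

Definition mge0 (v : RR * U -> \bar R) :=
  measurable_fun setT v /\ forall z, 0 <= v z.

(** Functions of a time and a state, extended by zero to negative times. [surv]
    is the probability that no jump occurs up to a given time, [jumpop] averages
    over the next state with the intensity [lam], and [convop] is the
    convolution in time with [surv]. *)
Definition surv (z : RR * U) : \bar R :=
  if (0 <= z.1)%R then (expR (- lam z.2 * z.1))%:E else 0.

Definition jumpop (v : RR * U -> \bar R) (z : RR * U) : \bar R :=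
  (lam z.2)%:E * \int[Gam z.2]_y v (z.1, y).

Definition convop (v : RR * U -> \bar R) (z : RR * U) : \bar R :=
  \int[leb]_r (surv (r, z.2) * v ((z.1 - r)%R, z.2)).

(** Convolution in time of the pairing of functions of the state. Both [convop]
    and [jumpop] are symmetric for it ([form_conv], [form_jump]). *)
Definition form (v w : RR * U -> \bar R) (u : R) : \bar R :=
  \int[leb]_s \int[m]_x (v (s, x) * w ((u - s)%R, x)).

Lemma mge0_surv : mge0 surv.
Proof.
split; last by move=> z; rewrite /surv; case: ifP => // _; rewrite lee_fin expR_ge0.
apply: measurable_fun_ifT => //.
- by apply: measurable_fun_ler => //; exact: measurable_fst.
- apply/measurable_EFinP; apply: measurableT_comp; first exact: measurable_expR.
  apply: measurable_funM; last exact: measurable_fst.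
  by apply: measurableT_comp => //; apply: measurableT_comp => //; exact: measurable_snd.
Qed.

Lemma mge0_jumpop v : mge0 v -> mge0 (jumpop v).
Proof.
move=> [mv v0]; split; last first.
  by move=> z; rewrite mule_ge0// ?lee_fin//; exact: integral_ge0.
apply: emeasurable_funM.
  by apply/measurable_EFinP; apply: measurableT_comp => //; exact: measurable_snd.
have := @measurable_fun_integral_finite_kernel _ _ (RR * U)%type U R
  (fun zy => v (zy.1.1, zy.2)) (kernel.kernel_snd Gam).
apply => //.
apply: measurableT_comp => //; apply: measurable_fun_pair.
  by apply: measurableT_comp; [exact: measurable_fst|exact: measurable_fst].
exact: measurable_snd.
Qed.

Lemma mge0_convop v : mge0 v -> mge0 (convop v).
Proof.
move=> [mv v0]; have [ms s0] := mge0_surv.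
split; last first.
  by move=> z; apply: integral_ge0 => r _; rewrite mule_ge0.
apply: (@measurable_fun_fubini_tonelli_F _ _ (RR * U)%type RR R leb
  (fun zr => surv (zr.2, zr.1.2) * v ((zr.1.1 - zr.2)%R, zr.1.2))).
- apply: emeasurable_funM.
    apply: measurableT_comp => //; apply: measurable_fun_pair; first exact: measurable_snd.
    by apply: measurableT_comp; [exact: measurable_snd|exact: measurable_fst].
  apply: measurableT_comp => //; apply: measurable_fun_pair.
    apply: measurable_funB; last exact: measurable_snd.
    by apply: measurableT_comp; [exact: measurable_fst|exact: measurable_fst].
  by apply: measurableT_comp; [exact: measurable_snd|exact: measurable_fst].
- by move=> z; rewrite mule_ge0.
Qed.

Let mform (v w : RR * U -> \bar R) (u : R) : mge0 v -> mge0 w ->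
  measurable_fun setT (fun z : RR * U => v z * w ((u - z.1)%R, z.2)).
Proof.
move=> [mv v0] [mw w0]; apply: emeasurable_funM => //.
apply: measurableT_comp => //; apply: measurable_fun_pair; last exact: measurable_snd.
by apply: measurable_funB => //; exact: measurable_fst.
Qed.

Lemma form_sym v w u : mge0 v -> mge0 w -> form v w u = form w v u.
Proof.
move=> hv hw; have [mv v0] := hv; have [mw w0] := hw.
pose F (s : RR) : \bar R := \int[m]_x (v (s, x) * w ((u - s)%R, x)).
have mF : measurable_fun setT F.
  apply: (@measurable_fun_fubini_tonelli_F _ _ RR U R m
    (fun z => v z * w ((u - z.1)%R, z.2))) => //; first exact: mform.
  by move=> z; rewrite mule_ge0.
have F0 s : 0 <= F s by apply: integral_ge0 => x _; rewrite mule_ge0.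
rewrite /form -(integral_reflect u mF F0).
apply: eq_integral => s _; apply: eq_integral => x _.
by rewrite subKr muleC.
Qed.

Lemma form_conv v z u : mge0 v -> mge0 z -> form v (convop z) u = form z (convop v) u.
Proof.
move=> hv hz; have [mv v0] := hv; have [mz z0] := hz; have [ms s0] := mge0_surv.
suff key v' z' : mge0 v' -> mge0 z' -> form v' (convop z') u =
    \int[leb]_r \int[leb]_s \int[m]_x
      (surv (r, x) * (v' (s, x) * z' ((u - r - s)%R, x))).
  rewrite [LHS](key v z hv hz) [RHS](key z v hz hv); apply: eq_integral => r _.
  pose F (s : RR) : \bar R := \int[m]_x
    (surv (r, x) * (v (s, x) * z ((u - r - s)%R, x))).
  have mF : measurable_fun setT F.
    apply: (@measurable_fun_fubini_tonelli_F _ _ RR U R m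
      (fun p => surv (r, p.2) * (v p * z ((u - r - p.1)%R, p.2)))) => //.
      apply: emeasurable_funM; last exact: mform.
      by apply: measurableT_comp => //; apply: measurable_fun_pair => //; exact: measurable_snd.
    by move=> p; rewrite !mule_ge0.
  have F0 s : 0 <= F s by apply: integral_ge0 => x _; rewrite !mule_ge0.
  rewrite -[LHS](integral_reflect (u - r)%R mF F0).
  apply: eq_integral => s _; apply: eq_integral => x _.
  by rewrite subKr [z _ * _]muleC.
move=> hv1 hz1; move: v' z' hv1 hz1 => {hv hz mv v0 mz z0} {}v {}z hv hz.
have [mv v0] := hv; have [mz z0] := hz.
pose f (s : R) (x : U) (r : R) : \bar R :=
  surv (r, x) * (v (s, x) * z ((u - r - s)%R, x)).
have f0 s x r : 0 <= f s x r by rewrite /f !mule_ge0.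
have mf : measurable_fun setT (fun p : RR * U * RR => f p.1.1 p.1.2 p.2).
  have p1 : measurable_fun setT (fun p : RR * U * RR => p.1.1).
    by apply: measurableT_comp; exact: measurable_fst.
  have p2 : measurable_fun setT (fun p : RR * U * RR => p.1.2).
    by apply: (measurableT_comp (f := snd)); [exact: measurable_snd|exact: measurable_fst].
  apply: emeasurable_funM.
    by apply: measurableT_comp => //; apply: measurable_fun_pair => //; exact: measurable_snd.
  apply: emeasurable_funM.
    by apply: measurableT_comp => //; exact: measurable_fun_pair.
  apply: measurableT_comp => //; apply: measurable_fun_pair => //.
  apply: measurable_funB => //; apply: measurable_funB => //; exact: measurable_snd.
have -> : form v (convop z) u = \int[leb]_s \int[m]_x \int[leb]_r f s x r.
  apply: eq_integral => s _; apply: eq_integral => x _.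
  have mA : measurable_fun setT (fun r : RR => surv (r, x) * z ((u - s - r)%R, x)).
    apply: emeasurable_funM.
      by apply: measurableT_comp => //; exact: measurable_fun_pair.
    apply: measurableT_comp => //; apply: measurable_fun_pair => //.
    exact: measurable_funB.
  have A0 (r : RR) : 0 <= surv (r, x) * z ((u - s - r)%R, x) by rewrite mule_ge0.
  rewrite /convop -(ge0_integralZl leb measurableT mA (fun r _ => A0 r) (v0 _)).
  apply: eq_integral => r _; rewrite /f muleCA; congr (_ * (_ * z (_, _))).
  by rewrite /=; ring.
transitivity (\int[leb]_s \int[leb]_r \int[m]_x f s x r).
  apply: eq_integral => s _.
  apply: (@fubini_tonelli _ _ U RR R m leb (fun p => f s p.1 p.2)) => //.
  apply: (measurableT_comp mf (g := fun p : U * RR => ((s : RR, p.1), p.2))).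
  apply: measurable_fun_pair; last exact: measurable_snd.
  by apply: measurable_fun_pair => //; exact: measurable_fst.
apply: (@fubini_tonelli _ _ RR RR R leb leb (fun p => \int[m]_x f p.1 x p.2)).
  apply: (@measurable_fun_fubini_tonelli_F _ _ (RR * RR)%type U R m
    (fun q => f q.1.1 q.2 q.1.2)) => //.
  apply: (measurableT_comp mf (g := fun q : RR * RR * U => ((q.1.1, q.2), q.1.2))).
  apply: measurable_fun_pair.
    apply: measurable_fun_pair; last exact: measurable_snd.
    by apply: measurableT_comp; exact: measurable_fst.
  by apply: (measurableT_comp (f := snd)); [exact: measurable_snd|exact: measurable_fst].
by move=> p; apply: integral_ge0 => x _.
Qed.

Hypothesis lam_sym : forall A B, measurable A -> measurable B ->
  \int[m]_(x in A) ((lam x)%:E * Gam x B) = \int[m]_(x in B) ((lam x)%:E * Gam x A).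

Definition jump1 (k : U -> \bar R) (x : U) : \bar R := (lam x)%:E * \int[Gam x]_y k y.

Definition ge0mf (k : U -> \bar R) := measurable_fun setT k /\ forall x, 0 <= k x.

Lemma ge0mf_jump1 k : ge0mf k -> ge0mf (jump1 k).
Proof.
move=> [mk k0]; split.
  apply: emeasurable_funM; first exact/measurable_EFinP.
  by apply: measurable_fun_integral_kernel => //; exact: measurable_kernel.
move=> x; apply: mule_ge0; first by rewrite lee_fin.
exact: integral_ge0.
Qed.

(** Both sides are measures in the indicator that replaces [f], and then in the
   one that replaces [h]. *)
Lemma jump_sym f h : ge0mf f -> ge0mf h ->
  \int[m]_x (f x * jump1 h x) = \int[m]_x (h x * jump1 f x).
Proof.
have mlamE : measurable_fun setT (EFin \o lam) by exact/measurable_EFinP.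
have integral_jump k l : ge0mf k -> ge0mf l -> (forall B, measurable B ->
      \int[m]_x (k x * (lam x)%:E * Gam x B) = \int[m]_(x in B) jump1 k x) ->
    \int[m]_x (k x * jump1 l x) = \int[m]_x (l x * jump1 k x).
  move=> hk [ml l0] hkB; have [mj j0] := ge0mf_jump1 hk; have [mk k0] := hk.
  have mu_ : measurable_fun setT (fun x => k x * (lam x)%:E) by exact: emeasurable_funM.
  have u0 x : 0 <= k x * (lam x)%:E by rewrite mule_ge0// lee_fin.
  have mG l' : measurable_fun setT l' -> (forall y, 0 <= l' y) ->
      measurable_fun setT (fun x => \int[Gam x]_y l' y).
    by move=> ml' l0'; apply: measurable_fun_integral_kernel => // B mB; exact: measurable_kernel.
  rewrite -(dens_integral m mj j0)//.
  transitivity (\int[mixture (dens m mu_ u0) Gam]_y l y).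
    rewrite mixture_integral// dens_integral//; last by move=> x; exact: integral_ge0.
      by apply: eq_integral => x _; rewrite /jump1 muleA muleC.
    exact: mG.
  apply: eq_measure_integral => B mB _.
  transitivity (\int[dens m mu_ u0]_x Gam x B) => //.
  rewrite dens_integral//; last exact: measurable_kernel.
  transitivity (\int[m]_x (k x * (lam x)%:E * Gam x B)); last exact: hkB.
  by apply: eq_integral => x _; exact: muleC.
have ge0mf_indic A : measurable A -> ge0mf (fun x : U => (\1_A x)%:E).
  by move=> mA; split; [exact/measurable_EFinP/measurable_indic|move=> x; rewrite lee_fin].
have restrict A (k : U -> \bar R) : \int[m]_(x in A) k x = \int[m]_x ((\1_A x)%:E * k x).
  rewrite integral_mkcond; apply: eq_integral => x _; rewrite patchE indicE.
  by case: ifPn => _; rewrite ?mul1e ?mul0e.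
have jump1_indic A x : measurable A -> jump1 (fun y => (\1_A y)%:E) x = (lam x)%:E * Gam x A.
  by move=> mA; rewrite /jump1 integral_indic// setIT.
move=> hf hh; apply: (integral_jump) => // B mB; rewrite [RHS]restrict.
transitivity (\int[m]_x (f x * jump1 (fun y => (\1_B y)%:E) x)).
  by apply: eq_integral => x _; rewrite jump1_indic// muleA.
apply/esym; apply: (integral_jump) => //; first exact: ge0mf_indic.
move=> A mA; transitivity (\int[m]_(x in B) ((lam x)%:E * Gam x A)).
  by rewrite [RHS]restrict; apply: eq_integral => x _; rewrite muleA.
by rewrite lam_sym//; apply: eq_integral => x _; rewrite jump1_indic.
Qed.

Lemma form_jump v z u : mge0 v -> mge0 z -> form v (jumpop z) u = form (jumpop v) z u.
Proof.
move=> [mv v0] [mz z0]; apply: eq_integral => s _.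
have hv : ge0mf (fun x => v (s, x)).
  by split => //; apply: measurableT_comp => //; exact: measurable_fun_pair.
have hz : ge0mf (fun x => z ((u - s)%R, x)).
  by split => //; apply: measurableT_comp => //; exact: measurable_fun_pair.
rewrite -[LHS]/(\int[m]_x (v (s, x) * jump1 (fun y => z ((u - s)%R, y)) x)) (jump_sym hv hz).
by apply: eq_integral => x _; rewrite muleC.
Qed.

(** [renew n B (u, x)] is the probability, from [x], that exactly [n] jumps
    occur up to time [u] and that the state at time [u] is in [B]. *)
Definition surv_on (B : set U) (z : RR * U) : \bar R := (\1_B z.2)%:E * surv z.

Fixpoint renew n (B : set U) : RR * U -> \bar R :=
  if n is n'.+1 then convop (jumpop (renew n' B)) else surv_on B.

Lemma mge0_renew n B : measurable B -> mge0 (renew n B).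
Proof.
move=> mB; elim: n => [|n ih] /=; last by apply: mge0_convop; exact: mge0_jumpop.
have [ms s0] := mge0_surv; split; last by move=> z; rewrite mule_ge0// lee_fin.
apply: emeasurable_funM => //; apply/measurable_EFinP.
by apply: measurableT_comp; [exact: measurable_indic|exact: measurable_snd].
Qed.

Lemma form_renew i j A B u : measurable A -> measurable B ->
  form (renew i A) (jumpop (renew j.+1 B)) u = form (renew i.+1 A) (jumpop (renew j B)) u.
Proof.
move=> mA mB; have hA := mge0_renew i mA; have hB := mge0_renew j mB.
have hLA := mge0_jumpop hA; have hLB := mge0_jumpop hB.
rewrite (form_jump u hA (mge0_renew j.+1 mB)).
transitivity (form (jumpop (renew j B)) (convop (jumpop (renew i A))) u).
  exact: form_conv hLA hLB.
exact: form_sym hLB (mge0_renew i.+1 mA).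
Qed.

(** [renew n B] arises from [surv_on B] by [n] applications of [convop] after
    [jumpop], and its integral over [A] is a value of the form; by symmetry of
    both operators the applications move one by one to the entry of [A]. *)
Lemma renew_sym n A B u : measurable A -> measurable B ->
  \int[m]_(x in A) renew n B (u, x) = \int[m]_(x in B) renew n A (u, x).
Proof.
move=> mA mB; case: n => [|n].
  rewrite !(integral_mkcond A) !(integral_mkcond B); apply: eq_integral => x _.
  by rewrite !patchE /= /surv_on/= !indicE; do 2!case: ifPn => _; rewrite ?mul1e ?mul0e.
have shiftn k : (k <= n)%N -> forall A B, measurable A -> measurable B ->
    form (renew 0 A) (jumpop (renew n B)) u =
    form (renew k A) (jumpop (renew (n - k) B)) u.
  elim: k => [|k ih] kn A' B' mA' mB'; first by rewrite subn0.
  rewrite (ih (ltnW kn) A' B' mA' mB') -(form_renew k (n - k.+1) u mA' mB').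
  by rewrite subnSK.
have E A' B' : measurable A' -> measurable B' ->
    \int[m]_(x in A') renew n.+1 B' (u, x) = form (renew 0 A') (jumpop (renew n B')) u.
  move=> mA' mB'; have [mw w0] := mge0_jumpop (mge0_renew n mB').
  have [ms s0] := mge0_surv.
  rewrite integral_mkcond /form.
  transitivity (\int[m]_x \int[leb]_s (renew 0 A' (s, x) * jumpop (renew n B') ((u - s)%R, x))).
    apply: eq_integral => x _; rewrite patchE /= /surv_on/= indicE.
    case: ifPn => _.
      by apply: eq_integral => s _; rewrite mul1e.
    by rewrite integral0_eq// => s _; rewrite !mul0e.
  apply: (@fubini_tonelli _ _ U RR R m leb
    (fun p => renew 0 A' (p.2, p.1) * jumpop (renew n B') ((u - p.2)%R, p.1))).
    have [mr r0] := mge0_renew 0 mA'.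
    apply: emeasurable_funM; apply: measurableT_comp => //; apply: measurable_fun_pair => //.
    by apply: measurable_funB.
  by have [mr r0] := mge0_renew 0 mA'; move=> p; rewrite mule_ge0.
rewrite (E A B mA mB) (E B A mB mA) (shiftn n (leqnn n) A B mA mB) subnn.
have hA := mge0_renew n mA; have hB := mge0_renew 0 mB.
by rewrite (form_jump u hA hB) (form_sym u (mge0_jumpop hA) hB).
Qed.

End renewal_operators.

(** * Exponential holding times *)

Section holding_time.
Context {R : realType}.
Local Open Scope ereal_scope.
Local Notation leb := (@lebesgue_measure R).
Local Notation RR := (measurableTypeR R).

Let rate (r : \bar R) : R := Num.max 0%R (fine r).

Let rate_ge0 r : (0 <= rate r)%R.
Proof. by rewrite /rate le_max lexx. Qed.

Let pdf (r : \bar R) (s : RR) : \bar R := (exponential_pdf (rate r) s)%:E.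

Let mpdf r : measurable_fun setT (pdf r).
Proof. by apply/measurable_EFinP; exact: measurable_exponential_pdf. Qed.

Let pdf_ge0 r s : 0 <= pdf r s.
Proof. by rewrite lee_fin exponential_pdf_ge0. Qed.

Let mEFin : measurable_fun setT (EFin : RR -> \bar R).
Proof. exact: EFin_measurable. Qed.

(** It agrees with [exp_law] on nonnegative rates ([hold_exp_law]) and is a
    probability measure for every rate, so that it is a kernel. *)
Definition hold (r : \bar R) : {measure set \bar R -> \bar R} :=
  if (0 < r) && (r < +oo) then pushm (dens leb (mpdf r) (pdf_ge0 r)) mEFin
  else if r == 0 then (\d_(+oo : \bar R) : {measure set \bar R -> \bar R})
  else (\d_(0 : \bar R) : {measure set \bar R -> \bar R}).

Let mEFin_preimage (A : set \bar R) : measurable A -> measurable (EFin @^-1` A : set RR).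
Proof. by move=> mA; rewrite -[X in measurable X]setTI; exact: mEFin. Qed.

Lemma hold_exp_law r A : 0 <= r -> measurable A -> hold r A = exp_law r A.
Proof.
case: r => [r| |]//; rewrite ?lee_fin => r0 mA; rewrite /hold/=.
  rewrite lte_fin ltry andbT eqe; have [->|rn0] := eqVneq r 0%R.
    by rewrite ltxx.
  rewrite lt_neqAle eq_sym rn0 r0/= /pushforward/= /dens /exponential_prob.
  by rewrite /pdf /rate/= (max_idPr r0).
by rewrite ltxx andbF.
Qed.

Let mpdf2 : measurable_fun setT (fun z : \bar R * RR => pdf z.1 z.2).
Proof.
rewrite (_ : (fun z => _) = fun z : \bar R * RR => if (0 <= z.2)%R then
  (rate z.1 * expR (- rate z.1 * z.2))%:E else 0); last first.
  apply/funext => -[r s]; rewrite /pdf/=; case: ifPn => s0.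
    by rewrite exponential_pdfE.
  by rewrite lt0_exponential_pdf// ltNge.
have mr : measurable_fun setT (fun z : \bar R * RR => rate z.1).
  apply: measurable_maxr => //.
  by apply: measurableT_comp; [exact: fine_measurable|exact: measurable_fst].
apply: measurable_fun_ifT => //.
  by apply: measurable_fun_ler => //; exact: measurable_snd.
apply/measurable_EFinP; apply: measurable_funM => //.
apply: measurableT_comp; first exact: measurable_expR.
by apply: measurable_funM; [exact: measurableT_comp|exact: measurable_snd].
Qed.

Let measurable_hold A : measurable A -> measurable_fun setT (hold ^~ A).
Proof.
move=> mA.
rewrite (_ : hold ^~ A = fun r => if (0 < r) && (r < +oo) then
  \int[leb]_s (pdf r s * (\1_(EFin @^-1` A) s)%:E) else
  if r == 0 then \d_(+oo : \bar R) A else \d_(0 : \bar R) A); last first.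
  apply/funext => r; rewrite /hold; case: ifPn => h; last by case: ifP.
  rewrite /= /pushforward/= /dens integral_mkcond; apply: eq_integral => s _.
  by rewrite patchE indicE; case: ifPn => _; rewrite ?mule1 ?mule0.
have mb (B : set \bar R) (P : \bar R -> bool) : measurable B ->
    (forall r, P r = (r \in B)) -> measurable_fun setT P.
  move=> mB PB; apply: (measurable_fun_bool true).
  rewrite setTI (_ : _ @^-1` _ = B)//.
  apply/seteqP; split => r /=; first by rewrite PB => /set_mem.
  by move=> Br; rewrite PB; exact/mem_set.
apply: measurable_fun_ifT.
- apply: measurable_and.
  + apply: (mb [set r | 0 < r]) => [|r]; last by rewrite mem_setE.
    rewrite -[X in measurable X]setTI.
    by apply: (emeasurable_fun_o_infty (f := id)).
  + apply: (mb [set r | r < +oo]) => [|r]; last by rewrite mem_setE.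
    rewrite -[X in measurable X]setTI.
    by apply: (emeasurable_fun_infty_o (f := id)).
- apply: (@measurable_fun_fubini_tonelli_F _ _ (\bar R) RR R leb
    (fun z => pdf z.1 z.2 * (\1_(EFin @^-1` A) z.2)%:E)).
    apply: emeasurable_funM => //; apply/measurable_EFinP.
    apply: measurableT_comp; last exact: measurable_snd.
    by apply: measurable_indic; exact: mEFin_preimage.
  by move=> z; rewrite mule_ge0// lee_fin.
- apply: measurable_fun_ifT => //; apply: (mb [set 0]) => [|r].
    exact: emeasurable_set1.
  by apply/idP/idP; rewrite inE => /eqP.
Qed.

HB.instance Definition _ := isKernel.Build _ _ _ _ R hold measurable_hold.

Lemma hold_setT r : hold r setT = 1.
Proof.
rewrite /hold; case: ifPn => [|_]; last by case: ifP => _; rewrite /= diracT.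
case: r => [r| |]; [|by rewrite ltxx andbF|by rewrite ltNge leNye].
rewrite lte_fin ltry andbT => r0.
rewrite /= /pushforward preimage_setT /= /dens.
by rewrite /pdf/= /rate/= (max_idPr (ltW r0)) integral_exponential_pdf.
Qed.

HB.instance Definition _ := Kernel_isProbability.Build _ _ _ _ R hold hold_setT.

Section finite_rate.
Variable r : R.
Hypothesis r0 : (0 < r)%R.

Let holdE : hold r%:E = pushm (dens leb (mpdf r%:E) (pdf_ge0 r%:E)) mEFin.
Proof. by rewrite /hold lte_fin r0 ltry. Qed.

Let pdfE s : pdf r%:E s = (exponential_pdf r s)%:E.
Proof. by rewrite /pdf /rate/= (max_idPr (ltW r0)). Qed.

Lemma hold_integral (F : \bar R -> \bar R) : measurable_fun setT F ->
  (forall s, 0 <= F s) ->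
  \int[hold r%:E]_s F s = \int[leb]_s (F s%:E * (exponential_pdf r s)%:E).
Proof.
move=> mF F0; rewrite holdE ge0_integral_pushforward// preimage_setT.
have mF' : measurable_fun setT (F \o (EFin : RR -> \bar R)).
  exact: (measurableT_comp mF mEFin).
transitivity (\int[leb]_s ((F \o (EFin : RR -> \bar R)) s * pdf r%:E s)).
  exact: (dens_integral leb (mpdf r%:E) (pdf_ge0 r%:E) mF' (fun s => F0 s%:E)).
by apply: eq_integral => s _; rewrite pdfE.
Qed.

Lemma exponential_tail u : (0 <= u)%R ->
  \int[leb]_s ((\1_(`]u, +oo[%classic : set R) s)%:E * (exponential_pdf r s)%:E) = (expR (- r * u))%:E.
Proof.
move=> u0.
have h0 : exponential_prob r `[0%R, u] = (1 - expR (- r * u))%:E.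
  have [<-|u_gt0] := eqVneq 0%R u.
    rewrite mulr0 expR0 subrr /exponential_prob.
    by apply: (@integral_Sset1 _ _ _ 0%R); rewrite set_itv1.
  by rewrite exponential_prob_itv0c ?EFinB// lt_neqAle u_gt0.
pose nu : {measure set RR -> \bar R} := dens leb (mpdf r%:E) (pdf_ge0 r%:E).
have nuE A : nu A = exponential_prob r A.
  by rewrite /nu /= /dens /exponential_prob; apply: eq_integral => s _; rewrite pdfE.
have mI : measurable (`[0%R, u]%classic : set RR) by exact: measurable_itv.
have : nu setT = nu `[0%R, u]%classic + nu (~` `[0%R, u]%classic).
  by have := measureU nu mI (measurableC mI) (setICr _); rewrite setUv.
rewrite !nuE h0 /exponential_prob integral_exponential_pdf//.
rewrite [X in _ + X](_ : _ = \int[leb]_s ((\1_(`]u, +oo[%classic : set R) s)%:E * (exponential_pdf r s)%:E)).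
  by case: (integral _ _ _) => [y| |]//; rewrite -EFinD => -[e]; congr EFin; lra.
rewrite integral_mkcond; apply: eq_integral => s _; rewrite patchE indicE.
have [s0|s0] := ltP s 0%R.
  by rewrite lt0_exponential_pdf// mule0; case: ifP.
have -> : (s \in ~` `[0%R, u]%classic) = (s \in `]u, +oo[%classic).
  by apply/idP/idP; rewrite !inE/= !in_itv/= s0/= andbT ltNge => /negP.
by case: ifPn => _; rewrite ?mul1e ?mul0e.
Qed.

Lemma hold_gt u : (0 <= u)%R -> hold r%:E [set s | u%:E < s] = (expR (- r * u))%:E.
Proof.
move=> u0; have mA : measurable [set s : \bar R | u%:E < s].
  by rewrite -[X in measurable X]setTI; apply: (emeasurable_fun_o_infty (f := id)).
rewrite -(setIT [set s : \bar R | u%:E < s]) -integral_indic// hold_integral.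
- rewrite -exponential_tail//; apply: eq_integral => s _; congr (_ * _).
  rewrite !indicE; congr ((nat_of_bool _)%:R%:E); apply/idP/idP; rewrite !inE/= in_itv/= andbT lte_fin//.
- by apply/measurable_EFinP/measurable_indic.
- by move=> s; rewrite lee_fin.
Qed.

(** The mean is the integral of the tail, by Fubini on the region below the
    graph of the identity. *)
Lemma hold_mean : \int[hold r%:E]_s `|s| = (r^-1)%:E.
Proof.
rewrite hold_integral//.
pose f (z : RR * RR) : \bar R :=
  (\1_(`[0%R, +oo[%classic : set R) z.2)%:E * ((\1_(`]z.2, +oo[%classic : set R) z.1)%:E *
   (exponential_pdf r z.1)%:E).
have f0 z : 0 <= f z by rewrite !mule_ge0// lee_fin// exponential_pdf_ge0// ltW.
have mf : measurable_fun setT f.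
  apply: emeasurable_funM.
    apply/measurable_EFinP; apply: measurableT_comp; last exact: measurable_snd.
    by apply: measurable_indic; exact: measurable_itv.
  apply: emeasurable_funM; last first.
    apply/measurable_EFinP; apply: measurableT_comp; last exact: measurable_fst.
    exact: measurable_exponential_pdf.
  rewrite (_ : (fun z => _) = fun z : RR * RR => (\1_[set z : RR * RR | (z.2 < z.1)%R] z)%:E).
    apply/measurable_EFinP/measurable_indic; apply: measurable_lt_set.
      exact: measurable_snd.
    exact: measurable_fst.
  apply/funext => z; rewrite !indicE; congr ((nat_of_bool _)%:R%:E); apply/idP/idP; rewrite !inE/= in_itv/= ?andbT//.
transitivity (\int[leb]_s \int[leb]_v f (s, v)).
  apply: eq_integral => s _; rewrite /f/=.
  have [s0|s0] := ltP s 0%R.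
    by rewrite lt0_exponential_pdf// mule0 integral0_eq// => v _; rewrite !mule0.
  transitivity (\int[leb]_v ((exponential_pdf r s)%:E * (\1_(`[0%R, s[%classic : set R) v)%:E)).
    rewrite ge0_integralZl//; last 2 first.
    - by apply/measurable_EFinP; apply: measurable_indic; exact: measurable_itv.
    - by rewrite lee_fin exponential_pdf_ge0// ltW.
    have E : leb `[0%R, s[%classic = s%:E.
      rewrite lebesgue_measure_itv/= lte_fin.
      by case: ltgtP s0 => // [s0|<-] _; rewrite ?oppr0 ?adde0 ?sube0.
    rewrite integral_indic// setIT muleC; congr (_ * _).
    by rewrite [RHS]E /= ger0_norm.
  apply: eq_integral => v _; rewrite muleA muleC; congr (_ * _); rewrite -EFinM !indicE -natrM mulnb; congr ((nat_of_bool _)%:R%:E).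
  by rewrite !mem_setE !in_itv/= !andbT.
transitivity (\int[leb]_v \int[leb]_s f (s, v)).
  exact: (@fubini_tonelli _ _ RR RR R leb leb f).
transitivity (\int[leb]_v ((r^-1)%:E * (exponential_pdf r v)%:E)).
  apply: eq_integral => v _; rewrite /f/= indicE.
  have [v0|v0] := ltP v 0%R.
    rewrite lt0_exponential_pdf// mule0 integral0_eq// => s _.
    by rewrite memNset ?mul0e//= in_itv/= andbT; apply/negP; rewrite -ltNge.
  transitivity (\int[leb]_s ((\1_(`]v, +oo[%classic : set R) s)%:E * (exponential_pdf r s)%:E)).
    by apply: eq_integral => s _; rewrite mem_set ?mul1e//= in_itv/= v0.
  by rewrite exponential_tail// exponential_pdfE// -EFinM mulrA mulVf ?gt_eqF// mul1r.
rewrite ge0_integralZl//; last 3 first.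
- by apply/measurable_EFinP; exact: measurable_exponential_pdf.
- by move=> v _; rewrite lee_fin exponential_pdf_ge0// ltW.
- by rewrite lee_fin invr_ge0 ltW.
by rewrite integral_exponential_pdf// mule1.
Qed.

End finite_rate.

End holding_time.

(** * The state at a fixed time *)

Section first_jump.
Local Open Scope ereal_scope.
Context {dU} {U : measurableType dU} {R : realType}.
Local Notation V := (\bar R).
Local Notation leb := (@lebesgue_measure R).
Variables (Gam : R.-pker U ~> U) (rho : R.-pker U ~> V).
Variables (Q : R.-pker U ~> path U V) (K : set U).
Hypotheses (mK : measurable K).
Hypothesis law : forall x, K x -> chain_law Gam rho x (Q x).
Variable m : probability U R.
Hypothesis m_inv : forall A, measurable A -> \int[m]_x Gam x A = m A.
Hypothesis mKC : m (~` K) = 0.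
Variable lam : U -> R.
Hypotheses (mlam : measurable_fun setT lam) (lam0 : forall x, (0 <= lam x)%R).
Hypothesis rhoE : {ae m, forall x, (0 < lam x)%R /\
  forall A, measurable A -> rho x A = hold (lam x)%:E A}.

Definition jtime n (w : path U V) : \bar R := \sum_(k < n) coordT k w.

(** Exactly [n] jumps occur up to time [u], and the state is then in [B]. The
    signs of the holding times are part of the event because it is considered on
    all trajectories, where they may be negative. *)
Definition at_time n (u : R) (B : set U) : set (path U V) :=
  [set w | [/\ forall k, (k <= n)%N -> 0 <= coordT k w, jtime n w <= u%:E,
     u%:E < jtime n.+1 w & B (coordX n w)]].

Lemma jtimeS n w : jtime n.+1 w = coordT 0 w + jtime n (shift w).
Proof. by rewrite /jtime big_ord_recl. Qed.

Lemma measurable_jtime n : measurable_fun setT (jtime n).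
Proof.
elim: n => [|n ih].
  by rewrite (_ : jtime 0 = cst 0)//; apply/funext => w; rewrite /jtime big_ord0.
rewrite (_ : jtime n.+1 = fun w => coordT 0 w + jtime n (shift w)); last first.
  by apply/funext => w; rewrite jtimeS.
apply: emeasurable_funD; first exact: measurable_coordT.
by apply: measurableT_comp => //; exact: measurable_shift.
Qed.

Let delayed n u B : set (V * path U V) :=
  [set z | [/\ 0 <= z.1 /\ (forall k, (k <= n)%N -> 0 <= coordT k z.2),
     z.1 + jtime n z.2 <= u%:E, u%:E < z.1 + jtime n.+1 z.2 & B (coordX n z.2)]].

Let mle (d : measure_display) (T : measurableType d) (f : T -> \bar R) (a : \bar R) :
  measurable_fun setT f -> measurable [set x | f x <= a].
Proof. by move=> mf; rewrite -[X in measurable X]setTI; exact: emeasurable_fun_infty_c. Qed.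

Let mge (d : measure_display) (T : measurableType d) (f : T -> \bar R) (a : \bar R) :
  measurable_fun setT f -> measurable [set x | a <= f x].
Proof. by move=> mf; rewrite -[X in measurable X]setTI; exact: emeasurable_fun_c_infty. Qed.

Let mgt (d : measure_display) (T : measurableType d) (f : T -> \bar R) (a : \bar R) :
  measurable_fun setT f -> measurable [set x | a < f x].
Proof. by move=> mf; rewrite -[X in measurable X]setTI; exact: emeasurable_fun_o_infty. Qed.

Let measurable_delayed n u B : measurable B -> measurable (delayed n u B).
Proof.
move=> mB.
have m1 : measurable_fun setT (fun z : V * path U V => z.1) by exact: measurable_fst.
have m2 (f : path U V -> \bar R) : measurable_fun setT f ->
    measurable_fun setT (fun z : V * path U V => f z.2).
  by move=> mf; apply: measurableT_comp => //; exact: measurable_snd.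
have mD k : measurable_fun setT (fun z : V * path U V => z.1 + jtime k z.2).
  by apply: emeasurable_funD; [exact: m1|apply: m2; exact: measurable_jtime].
rewrite (_ : delayed n u B = [set z | 0 <= z.1] `&`
  \bigcap_(k in `I_n.+1) [set z | 0 <= coordT k z.2] `&`
  [set z | z.1 + jtime n z.2 <= u%:E] `&`
  [set z | u%:E < z.1 + jtime n.+1 z.2] `&` (fun z => coordX n z.2) @^-1` B).
  apply: measurableI; last first.
    rewrite -[X in measurable X]setTI.
    by apply: (measurableT_comp (@measurable_coordX _ _ U V n)) => //; exact: measurable_snd.
  apply: measurableI; last by apply: mgt; exact: mD.
  apply: measurableI; last by apply: mle; exact: mD.
  apply: measurableI; first exact: mge.
  apply: fin_bigcap_measurable => // k _; apply: mge; apply: m2.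
  exact: measurable_coordT.
apply/seteqP; split => z.
  by move=> [[h1 h2] h3 h4 h5]; split => //; split => //; split => //; split => // k; exact: h2.
by move=> [[[[h1 h2] h3] h4] h5]; split => //; split => // k kn; exact: (h2 k).
Qed.

Lemma at_timeS n u B : at_time n.+1 u B =
  (fun w => (coordT 0 w, shift w)) @^-1` delayed n u B.
Proof.
apply/seteqP; split => w; rewrite /at_time/delayed/= -!jtimeS.
  move=> [h1 h2 h3 h4]; split => //; split; first exact: h1.
  by move=> k kn; exact: (h1 k.+1).
by move=> [[h1 h2] h3 h4 h5]; split => // -[|k]// kn; exact: h2.
Qed.

Let mfirst : measurable_fun setT (fun w : path U V => (coordT 0 w, shift w)).
Proof. by apply: measurable_fun_pair; [exact: measurable_coordT|exact: measurable_shift]. Qed.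

Lemma measurable_at_time n u B : measurable B -> measurable (at_time n u B).
Proof.
move=> mB; case: n => [|n]; last first.
  by rewrite at_timeS -[X in measurable X]setTI; apply: mfirst => //; exact: measurable_delayed.
rewrite (_ : at_time 0 u B = coordT 0 @^-1` [set s | 0 <= s] `&`
  [set w | jtime 0 w <= u%:E] `&` [set w | u%:E < jtime 1 w] `&` coordX 0 @^-1` B).
  apply: measurableI; last exact: mcoordX.
  apply: measurableI; last by apply: mgt; exact: measurable_jtime.
  apply: measurableI; last by apply: mle; exact: measurable_jtime.
  by apply: mge; exact: measurable_coordT.
apply/seteqP; split => w; first by move=> [h1 h2 h3 h4]; split => //; split => //; split => //; exact: h1.
by move=> [[[h1 h2] h3] h4]; split => // k; rewrite leqn0 => /eqP ->.
Qed.

Let delayed_section n u B (s : R) : (0 <= s)%R ->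
  xsection (delayed n u B) s%:E = at_time n (u - s) B.
Proof.
move=> s0; apply/seteqP; split => w.
  rewrite /xsection/= inE => -[[h1 h2] h3 h4 h5]; split => //.
    by rewrite EFinB leeBrDl.
  by rewrite EFinB lteBlDl.
move=> [h1 h2 h3 h4]; rewrite /xsection/= inE; split => //=.
  by rewrite -leeBrDl.
by rewrite -lteBlDl.
Qed.

(** Given [x], the first holding time is independent of the rest of the
    trajectory, by the Markov property after the first step, so that
    both sides, as measures in [W], agree on product sets. *)
Lemma first_jump_law x W : good Q K x -> measurable W ->
  Q x ((fun w => (coordT 0 w, shift w)) @^-1` W) =
  \int[rho x]_s \int[Gam x]_y Q y (xsection W s).
Proof.
move=> gx mW; have [Kx _] := gx.
rewrite -[LHS]/(pushm (Q x) mfirst W).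
rewrite -(@product_measure_unique _ _ _ _ _ (pker_at rho x)
  (mixture (pker_at Gam x) Q) (pushm (Q x) mfirst) _ W mW)//.
move=> A D mA mD.
rewrite /= /pushforward (_ : _ @^-1` _ = rect 1 (fun=> setT) (fun=> A) `&` iter 1 shift @^-1` D); last first.
  apply/seteqP; split => w /=.
    by move=> [h1 h2]; split => // -[|]//.
  by move=> [h1 h2]; split => //; exact: (h1 0%N _).2.
rewrite (markov mK law gx _ mD); last first.
  by apply: sub_sigma_algebra; exists (fun=> setT), (fun=> A).
have mQ : measurable_fun setT (fun y => Q y D) by exact: measurable_kernel.
rewrite (@law x Kx 1%N (fun=> setT) (fun=> A) (fun y => Q y D))//.
by rewrite /= indicT mul1e.
Qed.

Let ae_Gam (P : U -> Prop) : {ae m, forall x, P x} ->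
  {ae m, forall x, {ae Gam x, forall y, P y}}.
Proof.
move=> [N [mN N0 hN]].
have : {ae m, forall x, Gam x N = 0}.
  apply: ge0_integral_eq0_ae => //; first exact: measurable_kernel.
  by rewrite m_inv.
by apply: filterS => x GN; exists N.
Qed.

(** Induction on [n]: conditioning on the first holding time and the first jump
    gives the convolution that defines [renew]. The exceptional set of [x] serves
    all times [u]. *)
Theorem at_time_renew n B : measurable B ->
  {ae m, forall x, forall u, Q x (at_time n u B) = renew Gam lam n B (u, x)}.
Proof.
move=> mB.
have aeg := @ae_good _ _ _ _ _ _ _ _ _ mK law _ m_inv mKC.
elim: n => [|n ih].
  apply: filterS2 aeg rhoE => x [Kx _] [l0 rhox] u.
  rewrite /= /surv_on /surv/=; case: ifPn => [u0|]; last first.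
    rewrite -ltNge => u0; rewrite mule0 (_ : at_time 0 u B = set0) ?measure0//.
    by apply/seteqP; split => // w [_]; rewrite /jtime big_ord0 lee_fin leNgt u0.
  have mS : measurable [set s : \bar R | u%:E < s] by exact: mgt.
  rewrite (_ : at_time 0 u B = rect 1 (fun=> B) (fun=> [set s | u%:E < s])); last first.
    apply/seteqP; split => w.
      move=> [h1 h2 h3 h4] [|]// _; split => //=.
      by move: h3; rewrite /jtime big_ord_recl big_ord0 adde0.
    move=> /(_ 0%N (ltnSn 0))[h1 h2]; split => //.
    - by move=> k; rewrite leqn0 => /eqP ->; apply/ltW; apply: le_lt_trans h2; rewrite lee_fin.
    - by rewrite /jtime big_ord0 lee_fin.
    - by rewrite /jtime big_ord_recl big_ord0 adde0.
  rewrite (chain_law_rect _ (law Kx))//= integral_cst// mul1e prob_kernel mule1.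
  by rewrite rhox// hold_gt.
apply: filterS3 aeg (ae_Gam ih) rhoE => x gx ihx [l0 rhox] u.
have mW := measurable_delayed n u mB.
rewrite at_timeS first_jump_law//.
have mWi : measurable_fun setT (fun s : V => \int[Gam x]_y Q y (xsection (delayed n u B) s)).
  have := measurable_fun_xsection (mixture (pker_at Gam x) Q) mW.
  exact.
rewrite -[LHS](@eq_measure_integral _ _ _ _ (rho x) (hold (lam x)%:E)); last first.
  by move=> A mA _; rewrite rhox.
rewrite hold_integral//; last by move=> s; exact: integral_ge0.
rewrite /= /convop; apply: eq_integral => s _; rewrite /surv/=.
case: ifPn => [s0|]; last by rewrite -ltNge => s0; rewrite lt0_exponential_pdf// mule0 mul0e.
rewrite delayed_section// exponential_pdfE// /jumpop/= EFinM.
rewrite muleA [RHS]muleC; congr (_ * _); rewrite muleC; congr (_ * _).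
apply: ge0_ae_eq_integral => //.
- by apply: measurable_kernel; exact: measurable_at_time.
- have [mr _] := mge0_renew Gam mlam lam0 n mB.
  by apply: measurableT_comp => //; exact: measurable_fun_pair.
- by move=> y _; have [_ r0] := mge0_renew Gam mlam lam0 n mB.
- by apply: filterS ihx => y hy _; exact: hy.
Qed.

End first_jump.

(** * Time averages along one trajectory *)

Section path_average.
Context {R : realType}.
Local Notation leb := (@lebesgue_measure R).
Variables (s y : nat -> R) (h : R -> R).
Hypothesis s0 : forall k, 0 <= s k.
Hypothesis y0 : forall k, 0 <= y k.
Let T n := \sum_(k < n) s k.
Let S n := \sum_(k < n) y k * s k.
Hypothesis hT : forall n u, T n <= u < T n.+1 -> h u = y n.
Variables (sigma c : R).
Hypothesis c0 : 0 < c.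
Hypothesis T_cvg : T n / n%:R @[n --> \oo] --> c.
Hypothesis S_cvg : S n / n%:R @[n --> \oo] --> sigma.

Let TS n : T n.+1 = T n + s n. Proof. by rewrite /T big_ord_recr. Qed.
Let SS n : S n.+1 = S n + y n * s n. Proof. by rewrite /S big_ord_recr. Qed.
Let T0 : T 0%N = 0. Proof. by rewrite /T big_ord0. Qed.
Let S0 : S 0%N = 0. Proof. by rewrite /S big_ord0. Qed.

Let T_nd : nondecreasing_seq T.
Proof. by apply/nondecreasing_seqP => n; rewrite TS lerDl. Qed.

Let T_ge0 n : 0 <= T n. Proof. by rewrite -T0; exact: T_nd. Qed.

Let S_ge0 n : 0 <= S n.
Proof. by apply: sumr_ge0 => k _; rewrite mulr_ge0. Qed.

Lemma times_unbounded (u : R) : exists n, u < T n.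
Proof.
apply: contrapT => hn.
have h1 n : T n <= u by rewrite leNgt; apply/negP => ?; apply: hn; exists n.
have u0 : 0 <= u by rewrite (le_trans (T_ge0 0%N)).
have c20 : 0 < c / 2 by rewrite divr_gt0.
have /cvgrPdist_lt/(_ _ c20)[N _ hN] := T_cvg.
pose n := maxn N (Num.truncn (u / (c / 2))).+1.
have n0 : 0 < n%:R :> R by rewrite ltr0n /n leq_max ltn0Sn orbT.
have := hN n (leq_maxl _ _); rewrite ltr_norml => /andP[_]; rewrite ltrBlDl -ltrBlDr => h2.
have h3 : c / 2 < T n / n%:R by lra.
have h4 : u / (c / 2) < n%:R.
  by apply: (lt_le_trans (truncnS_gt _)); rewrite ler_nat leq_maxr.
move: h3; rewrite ltr_pdivlMr// => h3; move: h4; rewrite ltr_pdivrMr// => h4.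
by have := h1 n; rewrite leNgt => /negP; apply; rewrite mulrC in h4; exact: lt_trans h3.
Qed.

Lemma bracket u : 0 <= u -> exists n, T n <= u < T n.+1.
Proof.
move=> u0; have [n hn] := ex_minnP (times_unbounded u).
case: n hn => [|n] hn hmin; first by move: hn; rewrite T0 ltNge u0.
exists n; rewrite hn andbT leNgt; apply/negP => /hmin.
by rewrite ltnn.
Qed.

Let I n := (`[0, T n[%classic : set R).

Let I0 : I 0%N = set0.
Proof.
by rewrite -subset0 => u; rewrite /I T0/= in_itv/= => /andP[h1]; rewrite ltNge h1.
Qed.

Let IS n : I n.+1 = I n `|` `[T n, T n.+1[%classic.
Proof.
apply/seteqP; split => u; rewrite /I/= !in_itv/=.
  move=> /andP[h1 h2]; have [h3|h3] := ltP u (T n); [left|right]; first by rewrite h1.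
  by rewrite h2.
have h0 := T_nd (leqnSn n); have h1 := T_ge0 n.
by move=> [|] /andP[h2 h3]; apply/andP; split; lra.
Qed.

Let measurable_I n : measurable (I n). Proof. exact: measurable_itv. Qed.

Let measurable_h n : measurable_fun (I n) h.
Proof.
elim: n => [|n ih].
  by rewrite I0; exact: measurable_fun_set0.
rewrite IS; apply/measurable_funU; [exact: measurable_I|exact: measurable_itv|split => //].
apply: (eq_measurable_fun (cst (y n))); last exact: measurable_cst.
by move=> u; rewrite inE/= in_itv/= => /hT ->.
Qed.

Let h_ge0 u : 0 <= u -> 0 <= h u.
Proof. by move=> /bracket[n /hT ->]. Qed.

Let integral_I n : (\int[leb]_(u in I n) (h u)%:E = (S n)%:E)%E.
Proof.
elim: n => [|n ih].
  by rewrite I0 S0 integral_set0.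
have mJ : measurable (`[T n, T n.+1[%classic : set R) by exact: measurable_itv.
have mh : measurable_fun (I n `|` `[T n, T n.+1[%classic) (EFin \o h).
  by apply/measurable_EFinP; rewrite -IS; exact: measurable_h.
rewrite IS ge0_integral_setU//; last 3 first.
- exact: measurable_I.
- move=> u; rewrite -IS /I/= in_itv/= => /andP[u0 _]; rewrite lee_fin; exact: h_ge0.
- apply/disj_set2P; rewrite /I; apply/seteqP; split => u //=.
  by rewrite !in_itv/= => -[/andP[_ h1] /andP[h2 _]]; move: h1; rewrite ltNge h2.
rewrite ih SS EFinD; congr (_ + _)%E.
rewrite (eq_integral (cst (y n)%:E)); last first.
  by move=> u; rewrite inE/= in_itv/= => /hT ->.
rewrite integral_cst//.
transitivity ((y n)%:E * lebesgue_measure (`[T n, T n.+1[%classic : set R))%E => //.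
have -> := @lebesgue_measure_itv R `[T n, T n.+1[.
rewrite /= lte_fin.
case: ltP => hs; first by rewrite TS -EFinB addrAC subrr add0r.
by rewrite mule0 (_ : s n = 0) ?mulr0//; apply/eqP; rewrite eq_le s0 andbT; move: hs; rewrite TS; lra.
Qed.

Let J u := (\int[leb]_(r in `[0%R, u]) (h r)%:E)%E.

Let J_bounds n u : T n <= u < T n.+1 -> ((S n)%:E <= J u <= (S n.+1)%:E)%E.
Proof.
move=> /andP[h1 h2].
have sub1 : I n `<=` `[0, u]%classic.
  by move=> r; rewrite /I/= !in_itv/= => /andP[-> h3]; apply: ltW; exact: lt_le_trans h1.
have sub2 : (`[0, u]%classic : set R) `<=` I n.+1.
  by move=> r; rewrite /I/= !in_itv/= => /andP[-> h3]; exact: le_lt_trans h2.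
have mS : measurable_fun (I n.+1) (EFin \o h).
  by apply/measurable_EFinP; exact: measurable_h.
have mu : measurable (`[0, u]%classic : set R) by exact: measurable_itv.
apply/andP; split; rewrite -integral_I.
  apply: ge0_subset_integral => //.
  - exact: measurable_I.
  - by apply: measurable_funS sub2 mS; exact: measurable_I.
  - by move=> r; rewrite /= in_itv/= => /andP[r0 _]; rewrite lee_fin h_ge0.
apply: ge0_subset_integral => //; first exact: measurable_I.
by move=> r; rewrite /I/= in_itv/= => /andP[r0 _]; rewrite lee_fin h_ge0.
Qed.

Lemma path_integral_fin u : 0 <= u -> J u \is a fin_num.
Proof.
move=> /bracket[n /J_bounds/andP[h1 h2]].
rewrite ge0_fin_numE; first by rewrite (le_lt_trans h2)// ltry.
by rewrite (le_trans _ h1)// lee_fin.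
Qed.

Let p_cvg : S k.+1 / k.+1%:R @[k --> \oo] --> sigma.
Proof. by have := S_cvg; rewrite -(cvg_shiftS (fun n => S n / n%:R)). Qed.

Let q_cvg : T k.+1 / k.+1%:R @[k --> \oo] --> c.
Proof. by have := T_cvg; rewrite -(cvg_shiftS (fun n => T n / n%:R)). Qed.

Let harm1 : (k.+1%:R^-1 : R) @[k --> \oo] --> (0 : R).
Proof. exact: cvg_harmonic. Qed.

Let lower_cvg : S k.+1 / T k.+2 @[k --> \oo] --> sigma / c.
Proof.
have h2 : (k.+2%:R^-1 : R) @[k --> \oo] --> (0 : R).
  by have := harm1; rewrite -(cvg_shiftS (fun k => k.+1%:R^-1 : R)).
have q2 : T k.+2 / k.+2%:R @[k --> \oo] --> c.
  by have := q_cvg; rewrite -(cvg_shiftS (fun k => T k.+1 / k.+1%:R)).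
have r1 : (1 - k.+2%:R^-1 : R) @[k --> \oo] --> (1 - 0 : R) by apply: cvgB => //; exact: cvg_cst.
have := cvgM (cvgM p_cvg (cvgV (lt0r_neq0 c0) q2)) r1.
rewrite subr0 mulr1 => hc.
suff -> : (fun k => S k.+1 / T k.+2) = (fun k => (S k.+1 / k.+1%:R) *
  (T k.+2 / k.+2%:R)^-1 * (1 - k.+2%:R^-1)) by exact: hc.
apply: funext => k; rewrite invfM invrK.
have k1 : k.+1%:R != 0 :> R by rewrite pnatr_eq0.
have k2 : k.+2%:R != 0 :> R by rewrite pnatr_eq0.
rewrite (_ : 1 - k.+2%:R^-1 = k.+1%:R / k.+2%:R :> R); last first.
  by apply: (mulIf k2); rewrite mulfVK// mulrBl mulVf// mul1r -(@natr1 _ k.+1) addrK.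
have [->|Tn0] := eqVneq (T k.+2) 0; first by rewrite !invr0 !(mulr0, mul0r).
move: k1 k2 Tn0; move: (k.+1%:R : R) (k.+2%:R : R) => a b k1 k2 Tn0.
by field; rewrite ?k1 ?k2 ?Tn0.
Qed.

Let upper_cvg : S k.+2 / T k.+1 @[k --> \oo] --> sigma / c.
Proof.
have p2 : S k.+2 / k.+2%:R @[k --> \oo] --> sigma.
  by have := p_cvg; rewrite -(cvg_shiftS (fun k => S k.+1 / k.+1%:R)).
have r1 : (1 + k.+1%:R^-1 : R) @[k --> \oo] --> (1 + 0 : R) by apply: cvgD => //; exact: cvg_cst.
have := cvgM (cvgM p2 (cvgV (lt0r_neq0 c0) q_cvg)) r1.
rewrite addr0 mulr1 => hc.
suff -> : (fun k => S k.+2 / T k.+1) = (fun k => (S k.+2 / k.+2%:R) *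
  (T k.+1 / k.+1%:R)^-1 * (1 + k.+1%:R^-1)) by exact: hc.
apply: funext => k; rewrite invfM invrK.
have k1 : k.+1%:R != 0 :> R by rewrite pnatr_eq0.
have k2 : k.+2%:R != 0 :> R by rewrite pnatr_eq0.
rewrite (_ : 1 + k.+1%:R^-1 = k.+2%:R / k.+1%:R :> R); last first.
  by apply: (mulIf k1); rewrite mulfVK// mulrDl mulVf// mul1r natr1.
have [->|Tn0] := eqVneq (T k.+1) 0; first by rewrite !invr0 !(mulr0, mul0r).
move: k1 k2 Tn0; move: (k.+1%:R : R) (k.+2%:R : R) => a b k1 k2 Tn0.
by field; rewrite ?k1 ?k2 ?Tn0.
Qed.

(** For [u] between [T n] and [T n.+1] the integral of [h] up to [u] is between
    [S n] and [S n.+1], and both [S n / T n.+1] and [S n.+1 / T n] tend to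
    [sigma / c]. *)
Lemma path_average_cvg :
  ((u^-1)%:E * \int[leb]_(r in `[0%R, u]) (h r)%:E)%E @[u --> +oo] --> (sigma / c)%:E.
Proof.
apply/fine_cvgP; split.
  near=> u; rewrite fin_numM// path_integral_fin//.
apply/cvgrPdist_le => e e0.
have /cvgrPdist_le/(_ _ e0)[N1 _ hN1] := lower_cvg.
have /cvgrPdist_le/(_ _ e0)[N2 _ hN2] := upper_cvg.
(* N3 is there for the denominator T k.+1 of the upper bound to be positive. *)
pose N := maxn N1 N2.
have [N3 hN3] := times_unbounded 0.
near=> u => /=.
have u0 : 0 < u by near: u; apply: nbhs_pinfty_gt; rewrite num_real.
have uT : T (maxn N.+1 N3) <= u by near: u; apply: nbhs_pinfty_ge; rewrite num_real.
have [n hn] := bracket (ltW u0).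
have /andP[Tn un] := hn.
have nN : (maxn N.+1 N3 <= n)%N.
  rewrite leqNgt; apply/negP => h1; have := T_nd h1; rewrite leNgt => /negP; apply.
  by rewrite (le_lt_trans uT).
have Nn : (N < n)%N by apply: leq_trans nN; rewrite leq_maxl.
have TN3 : 0 < T n by apply: (lt_le_trans hN3); apply: T_nd; apply: leq_trans nN; rewrite leq_maxr.
have [k kn] : exists k, n = k.+1 by case: n Nn {hn Tn un nN TN3} => // k; exists k.
rewrite {}kn in hn Tn un Nn TN3 *.
have Nk1 : (N1 <= k)%N by move: Nn; rewrite ltnS; apply: leq_trans; rewrite leq_maxl.
have Nk2 : (N2 <= k)%N by move: Nn; rewrite ltnS; apply: leq_trans; rewrite leq_maxr.
have := hN1 _ Nk1; have := hN2 _ Nk2; rewrite /= !ler_distl => /andP[g1 _] /andP[_ g2].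
have /andP[j1 j2] := J_bounds hn.
have Jf := path_integral_fin (ltW u0).
rewrite -/(J u).
have j1' : S k.+1 <= fine (J u) by rewrite -lee_fin fineK.
have j2' : fine (J u) <= S k.+2 by rewrite -lee_fin fineK.
have l1 : S k.+1 / T k.+2 <= u^-1 * fine (J u).
  rewrite mulrC ler_pM ?invr_ge0//.
  by rewrite lef_pV2 ?posrE// ?ltW// (lt_trans u0).
have l2 : u^-1 * fine (J u) <= S k.+2 / T k.+1.
  rewrite mulrC ler_pM ?invr_ge0 ?(ltW u0)//; first exact: le_trans j1'.
  by rewrite lef_pV2 ?posrE.
rewrite fineM//=; apply/andP; split; lra.
Unshelve. all: by end_near. Qed.

End path_average.

Section signed_path_average.
Context {R : realType}.
Local Notation leb := (@lebesgue_measure R).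
Variables (s x : nat -> R) (h : R -> R).
Hypothesis s0 : forall k, 0 <= s k.
Let T n := \sum_(k < n) s k.
Hypothesis hT : forall n u, T n <= u < T n.+1 -> h u = x n.
Variables (a b c : R).
Hypothesis c0 : 0 < c.
Hypothesis T_cvg : T n / n%:R @[n --> \oo] --> c.
Hypothesis a_cvg : (\sum_(k < n) Num.max (x k) 0 * s k) / n%:R @[n --> \oo] --> a.
Hypothesis b_cvg : (\sum_(k < n) Num.max (- x k) 0 * s k) / n%:R @[n --> \oo] --> b.

Lemma signed_path_average_cvg :
  ((u^-1)%:E * \int[leb]_(r in `[0%R, u]) (h r)%:E)%E @[u --> +oo] --> (a / c - b / c)%:E.
Proof.
have y0 (y : nat -> R) k : 0 <= Num.max (y k) 0 by rewrite le_max lexx orbT.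
have hTp n u : T n <= u < T n.+1 -> Num.max (h u) 0 = Num.max (x n) 0 by move=> /hT ->.
have hTm n u : T n <= u < T n.+1 -> Num.max (- h u) 0 = Num.max (- x n) 0 by move=> /hT ->.
have cp := path_average_cvg s0 (y0 x) hTp c0 T_cvg a_cvg.
have cm := path_average_cvg s0 (y0 (fun k => - x k)) hTm c0 T_cvg b_cvg.
rewrite EFinB; apply: cvg_trans (cvgeB _ cp cm) => //.
apply: near_eq_cvg; near=> u.
have u0 : 0 <= u by near: u; apply: nbhs_pinfty_ge; rewrite num_real.
have fp := path_integral_fin s0 (y0 x) hTp c0 T_cvg u0.
have fm := path_integral_fin s0 (y0 (fun k => - x k)) hTm c0 T_cvg u0.
rewrite -muleBr//; last by apply: fin_num_adde_defl; rewrite fin_numN.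
congr (_ * _)%E; rewrite [RHS]integralE; congr (_ - _)%E; apply: eq_integral => r _.
  by rewrite funeposE EFin_max.
by rewrite funenegE EFin_max.
Unshelve. all: by end_near. Qed.

End signed_path_average.

(** * Ergodic averages from almost every starting point *)

Lemma measurable_cvg_set {d} {T : measurableType d} {R : realType}
    (F : nat -> T -> R) (c : R) : (forall n, measurable_fun setT (F n)) ->
  measurable [set w | F n w @[n --> \oo] --> c].
Proof.
move=> mF.
have -> : [set w | F n w @[n --> \oo] --> c] = \bigcap_k \bigcup_N
    \bigcap_(n in [set n | (N <= n)%N]) [set w | `|c - F n w| < k.+1%:R^-1].
  apply/seteqP; split => w /=.
    move=> /cvgrPdist_lt h k _; have k0 : 0 < k.+1%:R^-1 :> R by rewrite invr_gt0.
    by have [N _ hN] := h _ k0; exists N => // n /= Nn; exact: hN.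
  move=> h; apply/cvgrPdist_lt => e e0.
  have [k] := ltr_add_invr e0; rewrite add0r => hk.
  have [N _ hN] := h k Logic.I; exists N => // n /= Nn.
  by apply: lt_trans hk; exact: hN.
apply: bigcapT_measurable => k; apply: bigcupT_measurable => N.
apply: bigcap_measurableType => // n _; apply: measurable_lt_set => //.
by apply: measurableT_comp => //; exact: measurable_funB.
Qed.

Lemma measurable_inv {R : realType} :
  measurable_fun setT (GRing.inv : measurableTypeR R -> measurableTypeR R).
Proof.
rewrite -(setUv [set (0 : R)]); apply/measurable_funU => //; first exact: measurableC.
split; first exact: measurable_fun_set1.
apply: open_continuous_measurable_fun.
  by apply: closed_openC; exact: closed_eq.
by move=> x; rewrite inE/= => /eqP x0; exact: inv_continuous.
Qed.

Section birkhoff_from.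
Context {dU dV} {U : measurableType dU} {V : measurableType dV} {R : realType}.
Variables (Gam : R.-pker U ~> U) (rho : R.-pker U ~> V).
Variables (Q : R.-pker U ~> path U V) (K : set U).
Hypotheses (mK : measurable K).
Local Open Scope ereal_scope.
Hypothesis law : forall x, K x -> chain_law Gam rho x (Q x).
Variable m : probability U R.
Hypothesis m_inv : forall A, measurable A -> \int[m]_x Gam x A = m A.
Hypothesis mKC : m (~` K) = 0.
Variable phi : {measure set U -> \bar R}.
Hypothesis phi_nontrivial : 0 < phi setT.
Hypothesis irreducible : forall x, K x -> forall B, measurable B -> 0 < phi B ->
  exists n, 0 < Q x (coordX n @^-1` B).
Variable a : nat -> set U.
Hypothesis ma : forall i, measurable (a i).
Hypothesis a_gen : @measurable _ U = <<s range a >>.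
Hypothesis a0 : range a set0.
Hypothesis aC : setC_closed (range a).
Hypothesis aU : setU_closed (range a).

Let mu := stationary_law Q m.

Let avg (F : path U V -> R) (n : nat) (w : path U V) : R :=
  (birkhoff_sum (@shift _ _ U V) F n w / n%:R)%R.

Let avg_shift F (c : R) w :
  (avg F n (shift w) @[n --> \oo] --> c) <-> (avg F n w @[n --> \oo] --> c).
Proof.
pose r n := (n.+1%:R^-1 : R)%R.
have r0 : r n @[n --> \oo] --> (0 : R)%R by exact: cvg_harmonic.
have E1 n : avg F n.+1 w = (F w * r n + avg F n (shift w) * (1 - r n))%R.
  rewrite /avg birkhoff_sumS mulrDl; congr (_ + _)%R.
  case: n => [|n]; first by rewrite /r invr1 subrr mulr0 /birkhoff_sum big_ord0 mul0r.
  have k1 : (n.+1%:R != 0 :> R)%R by rewrite pnatr_eq0.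
  have k2 : (n.+2%:R != 0 :> R)%R by rewrite pnatr_eq0.
  rewrite (_ : 1 - r n.+1 = n.+1%:R / n.+2%:R)%R.
    by rewrite mulrA mulfVK.
  by apply: (mulIf k2); rewrite mulfVK// mulrBl mulVf// mul1r -(@natr1 _ n.+1) addrK.
have E2 n : (0 < n)%N -> avg F n (shift w) =
    ((avg F n.+1 w - F w * r n) * (1 + n%:R^-1))%R.
  case: n => // n _; rewrite E1 [(F w * _ + _)%R]addrC addrK -mulrA.
  have k1 : (n.+1%:R != 0 :> R)%R by rewrite pnatr_eq0.
  have k2 : (n.+2%:R != 0 :> R)%R by rewrite pnatr_eq0.
  rewrite [X in (_ * X)%R](_ : _ = 1%R) ?mulr1// /r.
  move: k2; rewrite -[n.+2%:R]natr1; move: (n.+1%:R : R)%R k1 => b k1 k2.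
  by field; rewrite k1 k2.
have fr : (F w * r n)%R @[n --> \oo] --> (F w * 0 : R)%R.
  by apply: cvgM => //; exact: cvg_cst.
split => h.
  rewrite -(cvg_shiftS (avg F ^~ w)).
  have h1 : (1 - r n : R)%R @[n --> \oo] --> (1 - 0 : R)%R.
    by apply: cvgB => //; exact: cvg_cst.
  have := cvgD fr (cvgM h h1); rewrite mulr0 add0r subr0 mulr1 => h2.
  suff -> : (fun n => avg F n.+1 w) =
    (fun n => F w * r n + avg F n (shift w) * (1 - r n))%R by exact: h2.
  by apply/funext => n; exact: E1.
rewrite -(cvg_shiftS (avg F ^~ (shift w))).
have h1 : (1 + r n : R)%R @[n --> \oo] --> (1 + 0 : R)%R.
  by apply: cvgD => //; exact: cvg_cst.
have fr' : (F w * r n.+1)%R @[n --> \oo] --> (F w * 0 : R)%R.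
  by rewrite (cvg_shiftS (fun n => F w * r n)%R).
have h3 : avg F n.+2 w @[n --> \oo] --> c.
  by rewrite (cvg_shiftS (fun n => avg F n.+1 w)) (cvg_shiftS (fun n => avg F n w)).
have := cvgM (cvgB h3 fr') h1; rewrite mulr0 subr0 addr0 mulr1 => h2.
suff -> : (fun n => avg F n.+1 (shift w)) =
  (fun n => (avg F n.+2 w - F w * r n.+1) * (1 + r n))%R by exact: h2.
by apply/funext => n; rewrite E2.
Qed.

(** The theorem of Birkhoff for each [F] is a statement about an invariant event,
    so the exceptional set of [uniform_invariant_event] serves all functions
    [F] at once. *)
Lemma birkhoff_from : {ae m, forall x, forall F, mu.-integrable setT (EFin \o F) ->
  Q x [set w | avg F n w @[n --> \oo] --> fine (\int[mu]_w (F w)%:E)] = 1}.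
Proof.
have := uniform_invariant_event mK law m_inv mKC phi_nontrivial irreducible ma a_gen a0 aC aU.
apply: filterS => x hx F iF.
have mF : measurable_fun setT F by apply/measurable_EFinP; exact: measurable_int iF.
have mA : measurable [set w | avg F n w @[n --> \oo] --> fine (\int[mu]_w (F w)%:E)].
  apply: measurable_cvg_set => n; apply: measurable_funM => //.
  by apply: measurable_birkhoff_sum => //; exact: measurable_shift.
apply: hx => //.
  by apply/seteqP; split => w h; [exact: (avg_shift F _ w).1|exact: (avg_shift F _ w).2].
have h := birkhoff (@measurable_shift _ _ U V) (stationary_shift mK law m_inv mKC)
  (shift_zero_one mK law m_inv mKC phi_nontrivial irreducible) iF.
have A0 : mu (~` [set w | avg F n w @[n --> \oo] --> fine (\int[mu]_w (F w)%:E)]) = 0.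
  by apply/negligibleP; [exact: measurableC|exact: h].
rewrite -[X in mu X]setCK probability_setC; last exact: measurableC.
by rewrite A0 sube0.
Qed.

End birkhoff_from.

Section first_step.
Context {dU dV} {U : measurableType dU} {V : measurableType dV} {R : realType}.
Variables (Gam : R.-pker U ~> U) (rho : R.-pker U ~> V).
Local Open Scope ereal_scope.
Variables (x : U) (q : probability (path U V) R).
Hypothesis law : chain_law Gam rho x q.

Let mX : measurable_fun setT (coordX 0 : path U V -> U).
Proof. exact: measurable_coordX. Qed.

Let mT : measurable_fun setT (coordT 0 : path U V -> V).
Proof. exact: measurable_coordT. Qed.

Let law0 C B : measurable C -> measurable B ->
  q (coordX 0 @^-1` C `&` coordT 0 @^-1` B) = (\1_C x)%:E * rho x B.
Proof.
move=> mC mB; have := @law 1%N (fun=> C) (fun=> B) (cst 1) (fun=> mC) (fun=> mB)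
  (measurable_cst _) (fun=> lee01).
rewrite /= integral_cst ?mul1e; last by apply: measurable_rects; exists (fun=> C), (fun=> B).
rewrite integral_cst// prob_kernel !mule1 => <-; congr (q _); apply/seteqP; split => w /=.
  by move=> [h1 h2] [|].
by move=> /(_ 0%N isT) [].
Qed.

(** The first state is deterministic and the first mark is independent of it; each
    factor is integrated in turn by [ci_integral]. *)
Lemma first_step_integral (G : U -> \bar R) (h : V -> \bar R) :
  measurable_fun setT G -> (forall y, 0 <= G y) ->
  measurable_fun setT h -> (forall s, 0 <= h s) ->
  \int[q]_w (G (coordX 0 w) * h (coordT 0 w)) = G x * \int[rho x]_s h s.
Proof.
move=> mG G0 mh h0.
have mXC C : measurable C -> measurable (coordX 0 @^-1` C : set (path U V)).
  by move=> mC; rewrite -[X in measurable X]setTI; exact: mX.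
have mTB B : measurable B -> measurable (coordT 0 @^-1` B : set (path U V)).
  by move=> mB; rewrite -[X in measurable X]setTI; exact: mT.
have qX C : measurable C -> q (coordX 0 @^-1` C) = (\1_C x)%:E.
  by move=> mC; have := law0 mC measurableT; rewrite preimage_setT setIT prob_kernel mule1.
have qT B : measurable B -> q (coordT 0 @^-1` B) = rho x B.
  by move=> mB; have := law0 measurableT mB; rewrite preimage_setT setTI indicT mul1e.
have mhT : measurable_fun setT (h \o (coordT 0 : path U V -> V)).
  exact: measurableT_comp mh mT.
have mGX : measurable_fun setT (G \o (coordX 0 : path U V -> U)).
  exact: measurableT_comp mG mX.
have intT : \int[q]_w h (coordT 0 w) = \int[rho x]_s h s.
  transitivity (\int[pushm q mT]_s h s).
    by rewrite ge0_integral_pushforward// preimage_setT.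
  by apply: eq_measure_integral => B mB _; exact: qT.
have intX : \int[q]_w G (coordX 0 w) = G x.
  have := @law 0%N (fun=> setT) (fun=> setT) G (fun=> measurableT) (fun=> measurableT) mG G0.
  by move=> /= <-; congr integral; apply/seteqP; split.
pose c := \int[rho x]_s h s.
have c0 : 0 <= c by exact: integral_ge0.
have intXT C : measurable C ->
    \int[q]_(w in coordX 0 @^-1` C) h (coordT 0 w) = (\1_C x)%:E * c.
  move=> mC.
  transitivity (\int[q]_w (h (coordT 0 w) * (\1_(coordX 0 @^-1` C) w)%:E)).
    rewrite integral_mkcond; apply: eq_integral => w _; rewrite patchE indicE.
    by case: ifPn; rewrite ?mule1 ?mule0.
  transitivity (\int[q]_w (h (coordT 0 w) * (cst (\1_C x)%:E w))).
    apply: ci_integral => //.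
    - by apply/measurable_EFinP/measurable_indic; exact: mXC.
    - by move=> w; rewrite /cst lee_fin.
    move=> B mB; rewrite integral_indic//; [|exact: mTB|exact: mXC].
    transitivity (q (coordX 0 @^-1` C `&` coordT 0 @^-1` B)) => //.
    by rewrite law0// integral_cst -?qT//; exact: mTB.
  rewrite ge0_integralZr//.
  by rewrite intT muleC.
transitivity (\int[q]_w (G (coordX 0 w) * cst c w)).
  apply: (@ci_integral _ _ _ _ _ q (coordX 0) (h \o coordT 0) (cst c)) => //.
    by move=> w; exact: h0.
  move=> C mC; rewrite intXT// integral_cst -?qX 1?muleC//; exact: mXC.
by rewrite ge0_integralZr// ?intX.
Qed.

End first_step.

(** * Averages of holding times *)

Section time_average.
Context {dU} {U : measurableType dU} {R : realType}.
Local Open Scope ereal_scope.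
Local Notation V := (\bar R).
Variables (Gam : R.-pker U ~> U) (rho : R.-pker U ~> V).
Variables (Q : R.-pker U ~> path U V) (K : set U).
Hypotheses (mK : measurable K).
Hypothesis law : forall x, K x -> chain_law Gam rho x (Q x).
Variable m : probability U R.
Hypothesis m_inv : forall A, measurable A -> \int[m]_x Gam x A = m A.
Hypothesis mKC : m (~` K) = 0.
Variable phi : {measure set U -> \bar R}.
Hypothesis phi_nontrivial : 0 < phi setT.
Hypothesis irreducible : forall x, K x -> forall B, measurable B -> 0 < phi B ->
  exists n, 0 < Q x (coordX n @^-1` B).
Variable a : nat -> set U.
Hypothesis ma : forall i, measurable (a i).
Hypothesis a_gen : @measurable _ U = <<s range a >>.
Hypothesis a0 : range a set0.
Hypothesis aC : setC_closed (range a).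
Hypothesis aU : setU_closed (range a).
Variable lam : U -> R.
Hypotheses (mlam : measurable_fun setT lam) (lam0 : forall x, (0 <= lam x)%R).
Hypothesis rhoE : {ae m, forall x, (0 < lam x)%R /\
  forall A, measurable A -> rho x A = hold (lam x)%:E A}.
Variables (pi : probability U R) (Lam : R).
Hypothesis Lam0 : (0 < Lam)%R.
Hypothesis m_pi : forall A, measurable A -> m A = \int[pi]_(x in A) (lam x / Lam)%:E.
Hypothesis lam_gt0 : {ae pi, forall x, (0 < lam x)%R}.

Let mu := stationary_law Q m.

Let pos : set (\bar R) := [set s | 0 < s /\ s < +oo].

Let mpos : measurable pos.
Proof.
rewrite (_ : pos = [set s | 0 < s] `&` [set s | s < +oo]); last by apply/seteqP; split.
apply: measurableI; rewrite -[X in measurable X]setTI.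
  by apply: (emeasurable_fun_o_infty (f := id)).
by apply: (emeasurable_fun_infty_o (f := id)).
Qed.

Let hold_pos r : (0 < r)%R -> hold r%:E (~` pos) = 0.
Proof.
move=> r0.
have m0 : measurable [set s : \bar R | 0 < s].
  by rewrite -[X in measurable X]setTI; apply: (emeasurable_fun_o_infty (f := id)).
have h1 : hold r%:E pos = 1.
  rewrite -(_ : hold r%:E [set s | 0 < s] = 1); last by rewrite hold_gt// mulr0 expR0.
  rewrite !hold_exp_law ?lee_fin ?(ltW r0)//= gt_eqF//.
  by congr exponential_prob; apply/seteqP; split => s /=; [case|split; rewrite ?ltry].
rewrite -[LHS]/(pker_at hold r%:E (~` pos)) probability_setC//.
by rewrite [X in 1 - X]h1 subee.
Qed.

Let stationary_first_step (G : U -> \bar R) (h : V -> \bar R) :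
  measurable_fun setT G -> (forall y, 0 <= G y) ->
  measurable_fun setT h -> (forall s, 0 <= h s) ->
  \int[mu]_w (G (coordX 0 w) * h (coordT 0 w)) =
  \int[m]_x (G x * \int[hold (lam x)%:E]_s h s).
Proof.
move=> mG G0 mh h0.
have [N [mN N0 hN]] : {ae m, forall x, K x /\ forall A, measurable A -> rho x A = hold (lam x)%:E A}.
  by have := ae_K mK mKC; apply: filterS2 rhoE => x [_ ?] ?.
rewrite integral_stationary; last 2 first.
- apply: emeasurable_funM.
    by apply: measurableT_comp => //; exact: measurable_coordX.
  by apply: measurableT_comp => //; exact: measurable_coordT.
- by move=> w; rewrite mule_ge0.
apply: (ge0_ae_eq_integral_nm measurableT mN N0).
- by move=> x; apply: integral_ge0 => w _; rewrite mule_ge0.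
- by move=> x; rewrite mule_ge0// integral_ge0.
move=> x Nx; have [Kx hx] : K x /\ forall A, measurable A -> rho x A = hold (lam x)%:E A.
  by apply: contrapT => hx; exact/Nx/hN.
rewrite (@first_step_integral _ _ _ _ _ Gam rho x (pker_at Q x))//; last exact: law.
by congr (_ * _); apply: eq_measure_integral => A mA _; exact: hx.
Qed.

Let mu_pos : mu (coordT 0 @^-1` (~` pos)) = 0.
Proof.
have mC : measurable (coordT 0 @^-1` (~` pos) : set (path U V)).
  by rewrite -[X in measurable X]setTI; apply: measurable_coordT => //; exact: measurableC.
have mI : measurable_fun setT (fun s : V => (\1_(~` pos) s)%:E : \bar R).
  by apply/measurable_EFinP/measurable_indic; exact: measurableC.
have := stationary_first_step (measurable_cst (1%E : \bar R)) (fun=> lee01) mI (fun=> lee0n _).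
rewrite (eq_integral (fun w => (\1_(coordT 0 @^-1` (~` pos)) w)%:E)); last first.
  by move=> w _; rewrite mul1e.
rewrite integral_indic// setIT => ->.
have [N [mN N0 hN]] : {ae m, forall x, (0 < lam x)%R} by apply: filterS rhoE => x [].
rewrite (ge0_ae_eq_integral_nm measurableT mN N0 (g := cst 0)) ?integral0//.
  by move=> x; rewrite mul1e integral_ge0.
move=> x Nx; rewrite mul1e integral_indic//; last exact: measurableC.
by rewrite setIT hold_pos//; apply: contrapT => hx; exact/Nx/hN.
Qed.

Let pos_ae : {ae m, forall x, Q x [set w | forall k, 0 < coordT k w /\ coordT k w < +oo] = 1}.
Proof.
have mC : measurable (coordT 0 @^-1` (~` pos) : set (path U V)).
  by rewrite -[X in measurable X]setTI; apply: measurable_coordT => //; exact: measurableC.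
have mk k : measurable (coordT k @^-1` (~` pos) : set (path U V)).
  by rewrite -[X in measurable X]setTI; apply: measurable_coordT => //; exact: measurableC.
have h : {ae m, forall x, forall k, Q x (coordT k @^-1` (~` pos)) = 0}.
  apply/ae_foralln => k; apply: ge0_integral_eq0_ae => //.
    by apply: measurable_kernel.
  rewrite -[LHS]/(mu (coordT k @^-1` (~` pos))).
  rewrite (_ : coordT k @^-1` _ = iter k shift @^-1` (coordT 0 @^-1` (~` pos))).
    by rewrite (stationary_iter_shift mK law m_inv mKC).
  by apply/seteqP; split => w; rewrite /preimage/= /coordT iter_shiftE addn0.
apply: filterS h => x hx.
pose bad := \bigcup_k (coordT k @^-1` (~` pos)) : set (path U V).
have mbad : measurable bad by exact: bigcupT_measurable.
have bad0 : Q x bad = 0 by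
  apply/negligibleP => //; apply: negligible_bigcup => k; apply/negligibleP => //; exact: hx.
transitivity (pker_at Q x (~` bad)); last by rewrite probability_setC// [X in 1 - X]bad0 sube0.
congr (Q x _); apply/seteqP; split => w /=.
  by move=> hw [k _]; apply; exact: hw.
by move=> hw k; apply: contrapT => hk; apply: hw; exists k.
Qed.

(** The mean holding time at [x] is the inverse of [lam x], which cancels the
   density of [m] with respect to [pi]. *)
Let integral_holding (f : U -> R) : measurable_fun setT f -> (forall x, (0 <= f x)%R) ->
  \int[mu]_w ((f (coordX 0 w))%:E * `|coordT 0 w|) = \int[pi]_x (f x)%:E * (Lam^-1)%:E.
Proof.
move=> mf f0.
have mlL : measurable_fun setT (fun x => (lam x / Lam)%:E).
  by apply/measurable_EFinP; exact: measurable_funM.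
have lL0 x : 0 <= (lam x / Lam)%:E by rewrite lee_fin divr_ge0// ltW.
have mF : measurable_fun setT (fun x => (f x / lam x)%:E).
  apply/measurable_EFinP; apply: measurable_funM => //.
  by apply: measurableT_comp => //; exact: measurable_inv.
have F0 x : 0 <= (f x / lam x)%:E by rewrite lee_fin divr_ge0.
have mf' : measurable_fun setT (EFin \o f) by exact/measurable_EFinP.
rewrite (stationary_first_step mf' (fun x => f0 x) (@abse_measurable R setT) (@abse_ge0 _)).
transitivity (\int[m]_x (f x / lam x)%:E).
  have [N [mN N0 hN]] : {ae m, forall x, (0 < lam x)%R} by apply: filterS rhoE => x [].
  apply: (ge0_ae_eq_integral_nm measurableT mN N0).
  - by move=> x; rewrite mule_ge0// ?lee_fin// integral_ge0.
  - exact: F0.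
  move=> x Nx; rewrite hold_mean; first by rewrite -EFinM.
  by apply: contrapT => hx; exact/Nx/hN.
transitivity (\int[dens pi mlL lL0]_x (f x / lam x)%:E).
  by apply: eq_measure_integral => A mA _; exact: m_pi.
rewrite dens_integral// -ge0_integralZr//; last 2 first.
- by move=> x _; rewrite lee_fin.
- by rewrite lee_fin invr_ge0 ltW.
apply: ge0_ae_eq_integral => //.
- exact: emeasurable_funM.
- exact: emeasurable_funM.
- by move=> x _; exact: mule_ge0.
- by move=> x _; rewrite mule_ge0// lee_fin// invr_ge0 ltW.
apply: filterS lam_gt0 => x lx _.
by rewrite -!EFinM; congr (_%:E); field; rewrite !gt_eqF.
Qed.

(** The average of [f] over the jumps, weighted by holding times, tends to the
    mean of [f] under [pi] up to the factor [Lam^-1], and this from starting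
    points that do not depend on [f]. *)
Lemma time_average : {ae m, forall x,
  {ae Q x, forall w, forall k, 0 < coordT k w /\ coordT k w < +oo} /\
  forall f : U -> R, measurable_fun setT f -> (forall x, (0 <= f x)%R) ->
    \int[pi]_x (f x)%:E < +oo ->
    {ae Q x, forall w, ((\sum_(k < n) f (coordX k w) * fine (coordT k w)) / n%:R)%R
      @[n --> \oo] --> (fine (\int[pi]_x (f x)%:E) / Lam)%R}}.
Proof.
have := birkhoff_from mK law m_inv mKC phi_nontrivial irreducible ma a_gen a0 aC aU.
apply: filterS2 pos_ae => x hpos hx.
have mpath : measurable [set w : path U V | forall k, 0 < coordT k w /\ coordT k w < +oo].
  rewrite (_ : [set _ | _] = \bigcap_k (coordT k @^-1` pos)); last first.
    by apply/seteqP; split => w /= hw k; [move=> _; exact: hw|exact: hw].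
  apply: bigcapT_measurable => k.
  by rewrite -[X in measurable X]setTI; exact: measurable_coordT.
have full (A : set (path U V)) : measurable A -> Q x A = 1 -> {ae Q x, forall w, A w}.
  move=> mA A1; apply/negligibleP; first exact: measurableC.
  transitivity (pker_at Q x (~` A)) => //.
  by rewrite probability_setC// [X in 1 - X]A1 subee.
have pos_x := full _ mpath hpos.
split=> // f mf f0 ifin.
pose F (w : path U V) := (f (coordX 0 w) * `|fine (coordT 0 w)|)%R.
have mF : measurable_fun setT F.
  apply: measurable_funM.
    by apply: measurableT_comp => //; exact: measurable_coordX.
  apply: measurableT_comp => //.
  by apply: measurableT_comp => //; exact: measurable_coordT.
have F0 w : (0 <= F w)%R by rewrite mulr_ge0.
have intF : \int[mu]_w (F w)%:E = \int[pi]_x (f x)%:E * (Lam^-1)%:E.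
  rewrite -integral_holding//; apply: ge0_ae_eq_integral => //.
  - exact/measurable_EFinP.
  - apply: emeasurable_funM.
      apply/measurable_EFinP; apply: measurableT_comp => //; exact: measurable_coordX.
    by apply: measurableT_comp => //; exact: measurable_coordT.
  - by move=> w _; rewrite lee_fin.
  - by move=> w _; rewrite mule_ge0// lee_fin.
  have : {ae mu, forall w, pos (coordT 0 w)}.
    have mT0 : measurable (coordT 0 @^-1` (~` pos) : set (path U V)).
      by rewrite -[X in measurable X]setTI; apply: measurable_coordT => //; exact: measurableC.
    by exists (coordT 0 @^-1` (~` pos)); split.
  apply: filterS => w [h0 h1] _; rewrite /F EFinM; congr (_ * _).
  by rewrite -abse_EFin fineK// fin_numE gt_eqF ?lt_eqF// (lt_trans _ h0).
have fin_f : \int[pi]_x (f x)%:E \is a fin_num.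
  by rewrite ge0_fin_numE// integral_ge0// => y _; rewrite lee_fin.
have iF : mu.-integrable setT (EFin \o F).
  apply/integrableP; split; first exact/measurable_EFinP.
  rewrite (eq_integral (EFin \o F)).
    by rewrite intF -(fineK fin_f) -EFinM ltry.
  by move=> w _; rewrite /= ger0_norm.
have := hx F iF; rewrite [X in fine X]intF fineM//= => hQ.
have mcv : measurable [set w | (birkhoff_sum (@shift _ _ U V) F n w / n%:R)%R @[n --> \oo]
    --> (fine (\int[pi]_x (f x)%:E) / Lam)%R].
  apply: measurable_cvg_set => n; apply: measurable_funM => //.
  by apply: measurable_birkhoff_sum => //; exact: measurable_shift.
have := full _ mcv hQ; apply: filterS2 pos_x => w hw; rewrite /=.
suff -> : (fun n => birkhoff_sum (@shift _ _ U V) F n w / n%:R)%R =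
  (fun n => (\sum_(k < n) f (coordX k w) * fine (coordT k w)) / n%:R)%R by [].
apply/funext => n; congr (_ / _)%R; apply: eq_bigr => k _.
rewrite /F /coordX /coordT iter_shiftE addn0 ger0_norm//.
by apply: fine_ge0; apply: ltW; case: (hw k).
Qed.

End time_average.

(** * Countable generation and topological support *)

Section countable_base.
Context {R : realType} {E : ptopologicalType}.

(** Balls of radius [k.+1%:R^-1] around the points of a countable dense set. *)
Lemma polish_base : polish R E -> exists b : nat -> set E,
  (forall i, open (b i)) /\
  forall (x : E) (A : set E), open A -> A x -> exists i, b i x /\ b i `<=` A.
Proof.
move=> [[D cD dD] [d [d0 dC dtri dnbhs _]]].
have dxx x : d x x = 0 by exact/d0.
pose B (x : E) (e : R) : set E := [set y | d x y < e].
have oB x e : open (B x e).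
  rewrite openE => y /= xy; apply/dnbhs; exists (e - d x y); first by rewrite subr_gt0.
  by move=> z /=; rewrite /B/= => yz; rewrite (le_lt_trans (dtri _ y _))// -ltrBrDl.
have /countable_injP[f finj] := cD.
pose e n : E := xget point [set x | D x /\ f x = n].
have ef x : D x -> e (f x) = x.
  move=> Dx; have [h1 h2] : [set y | D y /\ f y = f x] (e (f x)).
    by rewrite /e; apply: (@xgetPex _ point); exists x.
  by apply: finj => //; exact/mem_set.
exists (fun n => if (choice.unpickle n : option (nat * nat)) is Some (i, k) then B (e i) k.+1%:R^-1 else set0).
split.
  by move=> i; case: (choice.unpickle i : option (nat * nat)) => [[j k]|]; [exact: oB|exact: open0].
move=> x A oA Ax.
have /dnbhs[r r0 rA] : nbhs x A by exact: open_nbhs_nbhs.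
have r20 : 0 < r / 2 by rewrite divr_gt0.
have [k] := ltr_add_invr r20; rewrite add0r => hk.
have [y [xy Dy]] : B x k.+1%:R^-1 `&` D !=set0.
  by apply: dD; [exists x; rewrite /B/= dxx invr_gt0|exact: oB].
exists (choice.pickle (f y, k)); rewrite choice.pickleK ef//; split; first by rewrite /B/= dC.
move=> z yz; apply: rA; rewrite /= (le_lt_trans (dtri _ y _))//.
by rewrite [r]splitr ltrD// (lt_trans _ hk).
Qed.

Variable b : nat -> set E.
Hypothesis b_open : forall i, open (b i).
Hypothesis b_base : forall (x : E) (A : set E), open A -> A x ->
  exists i, b i x /\ b i `<=` A.

(** Finite Boolean combinations of the basic open sets, indexed by the trees that
    describe them because these form a countable type. *)
Fixpoint boolean_comb (s : GenTree.tree nat) : set (borel E) :=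
  match s with
  | GenTree.Leaf i => b i
  | GenTree.Node _ [::] => set0
  | GenTree.Node _ [:: s1] => ~` boolean_comb s1
  | GenTree.Node _ [:: s1, s2 & _] => boolean_comb s1 `|` boolean_comb s2
  end.

Let a n : set (borel E) := oapp boolean_comb set0 (choice.unpickle n).

Let range_a s : range a (boolean_comb s).
Proof. by exists (choice.pickle s) => //; rewrite /a choice.pickleK. Qed.

Let aE n : exists s, a n = boolean_comb s.
Proof. by rewrite /a; case: choice.unpickle => [s|]; [exists s|exists (GenTree.Node 0 [::])]. Qed.

Let open_measurable_borel (A : set E) : open A -> measurable (A : set (borel E)).
Proof. by move=> oA; exact: sub_sigma_algebra. Qed.

Let measurable_comb s : measurable (boolean_comb s).
Proof.
move: s; fix ih 1 => -[i|n ts] /=; first exact: open_measurable_borel.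
case: ts => [|s1 [|s2 ts]].
- exact: measurable0.
- by apply: measurableC; exact: ih.
- by apply: measurableU; exact: ih.
Qed.

Lemma countable_algebra : exists a : nat -> set (borel E),
  [/\ forall i, measurable (a i), @measurable _ (borel E) = <<s range a >>,
      range a set0, setC_closed (range a) & setU_closed (range a)].
Proof.
have ma i : measurable (a i) by have [s ->] := aE i; exact: measurable_comb.
exists a; split => //.
- apply/seteqP; split; last first.
    apply: smallest_sub; first exact: sigma_algebra_measurable.
    by move=> _ [i _ <-]; exact: ma.
  apply: (@smallest_sub _ (sigma_algebra setT) (@open E) <<s range a >>);
    first exact: (smallest_sigma_algebra setT (range a)).
  move=> A oA; rewrite (_ : A = \bigcup_i (if `[< b i `<=` A >] then b i else set0)).
    apply: sigma_algebra_bigcup => i.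
    case: ifPn => _; last exact: sigma_algebra0.
    apply: sub_sigma_algebra; exact: (range_a (GenTree.Leaf i)).
  apply/seteqP; split => x.
    move=> Ax; have [i [bix biA]] := b_base oA Ax; exists i => //.
    by rewrite asboolT.
  by move=> [i _]; case: asboolP => // + bx; apply.
- exact: (range_a (GenTree.Node 0 [::])).
- move=> _ [i _ <-]; have [s ->] := aE i; exact: (range_a (GenTree.Node 0 [:: s])).
- move=> _ _ [i _ <-] [j _ <-]; have [s ->] := aE i; have [s' ->] := aE j.
  exact: (range_a (GenTree.Node 0 [:: s; s'])).
Qed.

Variable pi : probability (borel E) R.

Let topsuppC : ~` topsupp pi = \bigcup_i (if pi (b i) == 0%E then b i else set0).
Proof.
apply/seteqP; split => x.
  move=> /existsNP[A /not_implyP[oA /not_implyP[Ax hA]]].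
  have [i [bix biA]] := b_base oA Ax; exists i => //.
  suff -> : pi (b i) = 0%E by rewrite eqxx.
  apply/eqP; rewrite eq_le measure_ge0 andbT.
  have A0 : (pi A <= 0)%E by rewrite leNgt; exact/negP.
  by apply: le_trans A0; apply: le_measure => //; rewrite inE; exact: open_measurable_borel.
move=> [i _]; case: eqP => // bi0 bix /(_ _ (b_open i) bix).
by rewrite bi0 ltxx.
Qed.

Lemma measurable_topsupp : measurable (topsupp pi).
Proof.
rewrite -[topsupp pi]setCK topsuppC; apply: measurableC; apply: bigcupT_measurable => i.
by case: ifP => _; [exact: open_measurable_borel|exact: measurable0].
Qed.

(** The complement of the support is a countable union of basic open null sets. *)
Lemma topsupp_full : pi (~` topsupp pi) = 0%E.
Proof.
apply/negligibleP; first by apply: measurableC; exact: measurable_topsupp.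
rewrite topsuppC; apply: negligible_bigcup => i.
case: eqP => [h|_]; last exact: negligible_set0.
by apply/negligibleP => //; exact: open_measurable_borel.
Qed.

End countable_base.

(** * The locally balanced kernels *)

Section constructors.
Context {d1 d2} {T1 : measurableType d1} {T2 : measurableType d2} {R : realType}.
Local Open Scope ereal_scope.

Section kernels.
Variable k : T1 -> {measure set T2 -> \bar R}.
Hypothesis mk : forall A, measurable A -> measurable_fun setT (k ^~ A).
Hypothesis k1 : forall x, k x setT = 1.

Definition pker_of of (forall A, measurable A -> measurable_fun setT (k ^~ A)) &
  (forall x, k x setT = 1) : T1 -> {measure set T2 -> \bar R} := k.

HB.instance Definition _ := isKernel.Build _ _ _ _ R (pker_of mk k1) mk.
HB.instance Definition _ := Kernel_isProbability.Build _ _ _ _ R (pker_of mk k1) k1.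

End kernels.

Section densities.
Variables (mu : {measure set T1 -> \bar R}) (u : T1 -> \bar R).
Hypotheses (mu_ : measurable_fun setT u) (u0 : forall x, 0 <= u x).
Hypothesis u1 : dens mu mu_ u0 setT = 1.

Definition dens_prob of (dens mu mu_ u0 setT = 1) : set T1 -> \bar R := dens mu mu_ u0.

HB.instance Definition _ := Measure.copy (dens_prob u1) (dens mu mu_ u0).
HB.instance Definition _ := Measure_isProbability.Build _ _ _ (dens_prob u1) u1.

End densities.
End constructors.

Section locally_balanced.
Context {R : realType} {E : ptopologicalType}.
Local Notation U := (borel E).
Variables (pi : probability U R) (gamma : R.-pker U ~> U).
Variables (t : U * U -> R) (g : R -> R).
Hypotheses (t_ratio : is_ratio pi gamma t) (g_bal : balancing g).
Hypothesis g_nd : forall r s : R, (0 <= r -> r <= s -> g r <= g s)%R.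
Local Open Scope ereal_scope.
Local Notation J := (joint pi gamma).

Let rate := jump_rate gamma t g.
Let w z := g (t z).

Let mt : measurable_fun setT t. Proof. by case: t_ratio. Qed.
Let t0 z : (0 <= t z)%R. Proof. by case: t_ratio. Qed.

Let mw : measurable_fun setT w.
Proof.
have [mg _ _ _ _] := g_bal.
apply: (measurable_comp (F := [set s : R | 0 <= s]%R)) mg mt.
  rewrite (_ : mkset _ = `[0%R, +oo[%classic); first exact: measurable_itv.
  by apply/seteqP; split => s /=; rewrite in_itv/= andbT.
by move=> _ [z _ <-]; exact: t0.
Qed.

Let w0 z : (0 <= w z)%R.
Proof.
have [_ _ g00 g0 _] := g_bal; rewrite /w.
by have := t0 z; rewrite le_eqVlt => /orP[/eqP <-|/g0/ltW//]; rewrite g00.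
Qed.

Let mwE : measurable_fun setT (EFin \o w). Proof. exact/measurable_EFinP. Qed.

Let mw1 x : measurable_fun setT (fun y => w (x, y)).
Proof. exact: measurableT_comp mw (measurable_pair1 x). Qed.

Lemma measurable_jump_rate : measurable_fun setT rate.
Proof.
by apply: (measurable_fun_integral_finite_kernel (EFin \o w)) => // z; rewrite lee_fin.
Qed.

Lemma jump_rate_ge0 x : 0 <= rate x.
Proof. by apply: integral_ge0 => y _; rewrite lee_fin w0. Qed.

Let mdensity x : measurable_fun setT (fun y => (w (x, y) / fine (rate x))%:E).
Proof. by apply/measurable_EFinP; apply: measurable_funM. Qed.

Let density0 x y : 0 <= (w (x, y) / fine (rate x))%:E.
Proof. by rewrite lee_fin divr_ge0// fine_ge0// jump_rate_ge0. Qed.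

Let jump_measure (x : U) : {measure set U -> \bar R} :=
  if (rate x == 0) || (rate x == +oo) then (\d_x : {measure set U -> \bar R})
  else (dens (gamma x) (mdensity x) (density0 x) : {measure set U -> \bar R}).

Let jump_measureE x A : jump_measure x A = embedded_kernel gamma t g x A.
Proof. by rewrite /jump_measure /embedded_kernel; case: ifP. Qed.

Let measurable_rate_eq r : measurable_fun setT (fun x => rate x == r).
Proof.
apply: (measurable_fun_bool true); rewrite setTI.
rewrite (_ : _ @^-1` _ = rate @^-1` [set r]); last first.
  by apply/seteqP; split => x /= => [/eqP|->]; rewrite ?eqxx.
rewrite -[X in measurable X]setTI.
by apply: measurable_jump_rate => //; exact: emeasurable_set1.
Qed.

Let measurable_jump_measure A : measurable A -> measurable_fun setT (jump_measure ^~ A).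
Proof.
move=> mA; pose h (z : U * U) := ((w z / fine (rate z.1)) * \1_A z.2)%:E.
rewrite (_ : jump_measure ^~ A = fun x => if (rate x == 0) || (rate x == +oo)
    then (\1_A x)%:E else \int[gamma x]_y h (x, y)); last first.
  apply/funext => x; rewrite /jump_measure; case: ifP => _ //.
  rewrite /= /dens integral_mkcond; apply: eq_integral => y _.
  by rewrite /h patchE indicE; case: ifPn => _; rewrite ?mulr1 ?mulr0.
apply: measurable_fun_ifT.
- by apply: measurable_or; exact: measurable_rate_eq.
- exact/measurable_EFinP/measurable_indic.
apply: (measurable_fun_integral_finite_kernel h).
  move=> z; rewrite lee_fin mulr_ge0// divr_ge0// fine_ge0//; exact: jump_rate_ge0.
apply/measurable_EFinP; apply: measurable_funM.
  apply: measurable_funM => //; apply: measurableT_comp; first exact: measurable_inv.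
  apply: measurableT_comp => //.
  by apply: measurableT_comp; [exact: measurable_jump_rate|exact: measurable_fst].
by apply: measurableT_comp; [exact: measurable_indic|exact: measurable_snd].
Qed.

Let jump_measureT x : jump_measure x setT = 1.
Proof.
rewrite /jump_measure; case: ifPn => [_|]; first exact: diracT.
rewrite negb_or => /andP[r0 roo]; rewrite /= /dens.
have rfin : rate x \is a fin_num by rewrite ge0_fin_numE ?jump_rate_ge0// lt_neqAle roo leey.
under eq_integral do rewrite mulrC EFinM.
rewrite ge0_integralZl//.
- rewrite -[X in _ * X]/(rate x) -[X in _ * X](fineK rfin) -EFinM mulVf//.
  by apply: contra r0 => /eqP h; rewrite -(fineK rfin) h.
- exact/measurable_EFinP.
- by move=> y _; rewrite lee_fin w0.
- by rewrite lee_fin invr_ge0 fine_ge0// jump_rate_ge0.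
Qed.

Lemma embedded_pker : exists Gam : R.-pker U ~> U, forall x A, Gam x A = embedded_kernel gamma t g x A.
Proof. by exists (pker_of measurable_jump_measure jump_measureT) => x A; exact: jump_measureE. Qed.

Lemma holding_pker : exists rho : R.-pker U ~> \bar R, forall x, rho x = hold (rate x).
Proof.
have mk A : measurable A -> measurable_fun setT (fun x => hold (rate x) A).
  move=> mA; have mh : measurable_fun setT (hold ^~ A : \bar R -> \bar R).
    exact: measurable_kernel.
  exact: measurableT_comp mh measurable_jump_rate.
have k1 x : hold (rate x) setT = 1 by exact: hold_setT.
by exists (pker_of mk k1).
Qed.

Let integral_joint f : measurable_fun setT f -> (forall z, 0 <= f z) ->
  \int[J]_z f z = \int[pi]_x \int[gamma x]_y f (x, y).
Proof.
move=> mf f0.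
have kE x A : measurable A -> pushm (gamma x) (measurable_pair1 x) A =
    \int[gamma x]_y (\1_A (x, y))%:E.
  move=> mA; rewrite (eq_integral (fun y => (\1_((fun y => (x, y)) @^-1` A) y)%:E))//.
  rewrite integral_indic// ?setIT// -[X in measurable X]setTI.
  exact: measurable_pair1.
have mk A : measurable A ->
    measurable_fun setT (fun x => pushm (gamma x) (measurable_pair1 x) A).
  move=> mA; rewrite (_ : (fun x => _) = fun x => \int[gamma x]_y (\1_A (x, y))%:E).
    apply: (measurable_fun_integral_finite_kernel (EFin \o \1_A)) => [z|].
      by rewrite lee_fin.
    exact/measurable_EFinP/measurable_indic.
  by apply/funext => x; exact: kE.
have k1 x : pushm (gamma x) (measurable_pair1 x) setT = 1 by exact: prob_kernel.
transitivity (\int[mixture pi (pker_of mk k1)]_z f z).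
  apply: eq_measure_integral => A mA _.
  by apply: eq_integral => x _; exact/esym/kE.
rewrite mixture_integral//; apply: eq_integral => x _.
by rewrite ge0_integral_pushforward ?preimage_setT//; exact: measurable_pair1.
Qed.

Let swap (z : U * U) : U * U := (z.2, z.1).

Let mswap : measurable_fun setT swap.
Proof. by apply/measurable_fun_pairP; split; [exact: measurable_snd|exact: measurable_fst]. Qed.

Let mtE : measurable_fun setT (EFin \o t). Proof. exact/measurable_EFinP. Qed.
Let tE0 z : 0 <= (EFin \o t) z. Proof. by rewrite lee_fin. Qed.

Let integral_swap f : measurable_fun setT f -> (forall z, 0 <= f z) ->
  \int[J]_z f (swap z) = \int[J]_z (f z * (t z)%:E).
Proof.
move=> mf f0; have [_ _ h _] := t_ratio.
have := @ge0_integral_pushforward _ _ _ _ R _ mswap J setT f measurableT mf (fun z _ => f0 z).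
rewrite preimage_setT => hJ; transitivity (\int[pushm J mswap]_z f z); first exact/esym/hJ.
transitivity (\int[dens J mtE tE0]_z f z).
  by apply: eq_measure_integral => A mA _; exact: h.
exact: (dens_integral J mtE tE0 mf f0).
Qed.

Let JT : J setT = 1.
Proof.
rewrite /joint (eq_integral (cst 1)); first by rewrite integral_cst// mul1e; exact: probability_setT.
move=> x _; rewrite (eq_integral (cst 1)); last by move=> y _; rewrite indicT.
by rewrite integral_cst// mul1e prob_kernel.
Qed.

(** The measure with density [g (t z)] is symmetric, since [s * g (1 / s) = g s]
    and exchanging the coordinates inverts [t]. *)
Let balanced_swap f : measurable_fun setT f -> (forall z, 0 <= f z) ->
  \int[J]_z (f (swap z) * (w z)%:E) = \int[J]_z (f z * (w z)%:E).
Proof.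
move=> mf f0; have [_ _ _ [S [mS S1 hS _]]] := t_ratio.
have [_ _ _ _ gE] := g_bal.
have swapK z : swap (swap z) = z by case: z.
have mws : measurable_fun setT (fun z => (w (swap z))%:E).
  by apply/measurable_EFinP; exact: measurableT_comp mw mswap.
have := @integral_swap (fun z => f z * (w (swap z))%:E).
under eq_integral do rewrite swapK.
move=> ->; [|exact: emeasurable_funM|by move=> z; rewrite mule_ge0// lee_fin].
have JS : J (~` S) = 0.
  have := measureU J mS (measurableC mS) (setICr _).
  rewrite setUv => h0.
  have : 1 = 1 + J (~` S) by rewrite -[X in X = _]JT -[X in X + _]S1; exact: h0.
  case: (J (~` S)) => [r| |]// h.
  have h1 : (1 = 1 + r)%R by apply: EFin_inj; rewrite EFinD -h.
  by congr (_%:E); lra.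
apply: (ge0_ae_eq_integral_nm measurableT (measurableC mS) JS).
- by move=> z; rewrite !mule_ge0// lee_fin.
- by move=> z; rewrite mule_ge0// lee_fin.
move=> z /contrapT Sz; rewrite -muleA -EFinM; congr (_ * _%:E).
have [tz ts] := hS z.1 z.2 (eq_ind _ S Sz _ (surjective_pairing z)).
rewrite -surjective_pairing in tz ts.
by rewrite /w /swap ts [RHS](gE _ tz) mulrC.
Qed.

Hypothesis rate_gt0 : {ae pi, forall x, 0 < rate x}.

Let integral_t : \int[J]_z (t z)%:E = 1.
Proof.
have [_ _ h _] := t_ratio.
by have := h setT measurableT; rewrite -[X in X = _]/(J setT) JT.
Qed.

(** Below 1 the balancing function is at most [g 1 = 1]; above 1 its symmetry
   gives [g s = s * g s^-1 <= s]. So the jump rate is integrable. *)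
Let w_le z : (w z <= 1 + t z)%R.
Proof.
have [_ g1 _ _ gE] := g_bal; have [tz1|tz1] := leP (t z) 1%R.
  by rewrite /w (le_trans (g_nd (t0 z) tz1))// g1 lerDl.
have tz0 : (0 < t z)%R by exact: lt_trans tz1.
rewrite /w gE// (@le_trans _ _ (t z * 1)%R)//; last by rewrite mulr1 lerDr.
rewrite ler_wpM2l// -g1 g_nd ?invr_ge0//.
by rewrite invf_le1// ltW.
Qed.

Let integral_rate : \int[pi]_x rate x = \int[J]_z (w z)%:E.
Proof. by rewrite integral_joint// => z; rewrite lee_fin. Qed.

Let integral_rate_fin : \int[pi]_x rate x \is a fin_num.
Proof.
rewrite ge0_fin_numE; last by apply: integral_ge0 => x _; exact: jump_rate_ge0.
rewrite integral_rate; apply: (@le_lt_trans _ _ (1 + 1)); last by rewrite -EFinD ltry.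
rewrite -[X in _ <= X + _](_ : \int[J]_z (cst 1 z) = 1); last first.
  by rewrite integral_cst// mul1e; exact: JT.
rewrite -[X in _ <= _ + X]integral_t -ge0_integralD//.
- apply: ge0_le_integral => //.
  + by move=> z _; rewrite lee_fin.
  + exact: emeasurable_funD.
  + by move=> z _; exact: w_le.
- by move=> z _; rewrite lee_fin.
Qed.

Let rate_fin : {ae pi, forall x, 0 < rate x /\ rate x < +oo}.
Proof.
have : pi.-integrable setT rate.
  apply/integrableP; split; first exact: measurable_jump_rate.
  rewrite (eq_integral rate); last by move=> x _; rewrite gee0_abs// jump_rate_ge0.
  by rewrite -ge0_fin_numE// integral_ge0// => x _; exact: jump_rate_ge0.
move=> /integrable_ae => /(_ measurableT); apply: filterS2 rate_gt0 => x h1 h2; split => //.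
by rewrite -ge0_fin_numE ?jump_rate_ge0//; exact: h2.
Qed.

Let lam x := fine (rate x).

Lemma measurable_lam : measurable_fun setT lam.
Proof. by apply: measurableT_comp => //; exact: measurable_jump_rate. Qed.

Lemma lam_ge0 x : (0 <= lam x)%R.
Proof. by rewrite fine_ge0// jump_rate_ge0. Qed.

Lemma lam_rate : {ae pi, forall x, (0 < lam x)%R /\ (lam x)%:E = rate x}.
Proof.
apply: filterS rate_fin => x [r0 roo].
have rfin : rate x \is a fin_num by rewrite ge0_fin_numE// ltW.
by rewrite /lam fineK//; split => //; rewrite fine_gt0// r0.
Qed.

Variable Gam : R.-pker U ~> U.
Hypothesis GamE : forall x A, Gam x A = embedded_kernel gamma t g x A.

Let flow A B : measurable A -> measurable B ->
  \int[pi]_(x in A) ((lam x)%:E * Gam x B) =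
  \int[J]_z ((\1_A z.1 * \1_B z.2)%:E * (w z)%:E).
Proof.
move=> mA mB.
have mAB : measurable_fun setT (fun z : U * U => ((\1_A z.1 * \1_B z.2 : R)%:E)).
  apply/measurable_EFinP; apply: measurable_funM.
    by apply: measurableT_comp; [exact: measurable_indic|exact: measurable_fst].
  by apply: measurableT_comp; [exact: measurable_indic|exact: measurable_snd].
rewrite integral_joint; last 2 first.
- exact: emeasurable_funM.
- by move=> z; rewrite -EFinM lee_fin !mulr_ge0.
rewrite integral_mkcond.
have [N [mN N0 hN]] := rate_fin.
apply: (ge0_ae_eq_integral_nm measurableT mN N0).
- move=> x; rewrite patchE; case: ifP => // _.
  by rewrite mule_ge0// lee_fin lam_ge0.
- by move=> x; apply: integral_ge0 => y _; rewrite -EFinM lee_fin !mulr_ge0.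
move=> x Nx; have [r0 roo] : 0 < rate x /\ rate x < +oo.
  by apply: contrapT => h; exact/Nx/hN.
have l0 : (0 < lam x)%R by rewrite fine_gt0// r0.
rewrite patchE /= indicE; case: ifPn => xA; last first.
  by rewrite integral0_eq// => y _; rewrite mul0r mul0e.
rewrite GamE /embedded_kernel -/rate gt_eqF//= lt_eqF//.
rewrite -ge0_integralZl//; last 3 first.
- by apply/measurable_EFinP; apply: measurable_funM => //; exact: measurable_funS (mw1 x).
- by move=> y _; rewrite lee_fin; apply: divr_ge0; [exact: w0|exact: lam_ge0].
- by rewrite lee_fin ltW.
rewrite integral_mkcond; apply: eq_integral => y _.
rewrite patchE indicE mul1r; case: ifPn => yB; last by rewrite mul0e.
by rewrite mul1e -EFinM mulrC mulfVK// gt_eqF.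
Qed.

(** The embedded chain satisfies detailed balance for [lam x * pi(dx)]. *)
Lemma flow_sym A B : measurable A -> measurable B ->
  \int[pi]_(x in A) ((lam x)%:E * Gam x B) = \int[pi]_(x in B) ((lam x)%:E * Gam x A).
Proof.
move=> mA mB; rewrite !flow//.
rewrite -(balanced_swap (f := fun z => (\1_A z.1 * \1_B z.2)%:E)).
- by apply: eq_integral => z _; rewrite mulrC.
- apply/measurable_EFinP; apply: measurable_funM.
    by apply: measurableT_comp; [exact: measurable_indic|exact: measurable_fst].
  by apply: measurableT_comp; [exact: measurable_indic|exact: measurable_snd].
- by move=> z; rewrite lee_fin mulr_ge0.
Qed.

(** Detailed balance against the whole space; the normalization by [Lam] is
    possible because the rate is integrable. *)
Lemma embedded_invariant_law : exists (Lam : R) (m : probability U R),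
  [/\ (0 < Lam)%R,
      forall A, measurable A -> m A = \int[pi]_(x in A) (lam x / Lam)%:E &
      forall A, measurable A -> \int[m]_x Gam x A = m A].
Proof.
have mlam := measurable_lam.
have mlamE : measurable_fun setT (EFin \o lam) by exact/measurable_EFinP.
pose Lam := fine (\int[pi]_x rate x).
have rateE : \int[pi]_x (lam x)%:E = \int[pi]_x rate x.
  apply: ge0_ae_eq_integral => //.
  - exact: measurable_jump_rate.
  - by move=> x _; rewrite lee_fin lam_ge0.
  - by move=> x _; exact: jump_rate_ge0.
  - by apply: filterS lam_rate => x [_ ->].
have Lam0 : (0 < Lam)%R.
  rewrite fine_gt0//; apply/andP; split; last by rewrite -ge0_fin_numE// integral_ge0// => x _; exact: jump_rate_ge0.
  rewrite lt_neqAle integral_ge0 ?andbT//; last by move=> x _; exact: jump_rate_ge0.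
  apply/negP => /eqP/esym int0.
  have h := ge0_integral_eq0_ae measurable_jump_rate jump_rate_ge0 int0.
  have : {ae pi, forall x, False} by apply: filterS2 rate_gt0 h => x + h; rewrite h ltxx.
  move=> [N [mN N0 /(_ _ _)hN]]; have : pi setT = 0.
    rewrite -N0; congr (pi _); apply/esym; rewrite -subTset => x _; apply: hN; exact.
  by rewrite probability_setT => /eqP; rewrite onee_eq0.
have mu_ : measurable_fun setT (fun x => (lam x / Lam)%:E).
  by apply/measurable_EFinP; exact: measurable_funM.
have u0 x : 0 <= (lam x / Lam)%:E by rewrite lee_fin divr_ge0 ?lam_ge0// ltW.
have densE A : measurable A -> dens pi mu_ u0 A = (Lam^-1)%:E * \int[pi]_(x in A) (lam x)%:E.
  move=> mA; rewrite /dens -ge0_integralZl//.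
  - by apply: eq_integral => x _; rewrite -EFinM mulrC.
  - exact: measurable_funS mlamE.
  - by move=> x _; rewrite lee_fin lam_ge0.
  - by rewrite lee_fin invr_ge0 ltW.
have u1 : dens pi mu_ u0 setT = 1.
  rewrite densE// rateE -[X in _ * X]fineK// -EFinM mulVf//.
  by rewrite gt_eqF.
exists Lam, (dens_prob u1); split => // A mA.
transitivity (\int[dens pi mu_ u0]_x Gam x A); first exact: eq_measure_integral.
have mG : measurable_fun setT (Gam ^~ A) by exact: measurable_kernel.
rewrite dens_integral//.
transitivity ((Lam^-1)%:E * \int[pi]_(x in setT) ((lam x)%:E * Gam x A)).
  rewrite -ge0_integralZl//.
  - by apply: eq_integral => x _; rewrite muleA -EFinM muleC [(_ / _)%R]mulrC.
  - exact: emeasurable_funM.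
  - by move=> x _; rewrite mule_ge0// lee_fin lam_ge0.
  - by rewrite lee_fin invr_ge0 ltW.
rewrite flow_sym// -[RHS]/(dens pi mu_ u0 A) densE//; congr (_ * _).
by apply: eq_integral => x _; rewrite prob_kernel mule1.
Qed.

End locally_balanced.

(** * The law of the trajectory *)

Section trajectory.
Context {R : realType} {E : ptopologicalType}.
Local Notation U := (borel E).
Local Notation V := (\bar R).
Variables (gamma : R.-pker U ~> U) (t : U * U -> R) (g : R -> R).
Local Notation rate := (jump_rate gamma t g).
Hypothesis rate_ge0 : forall x, (0 <= rate x)%E.
Variables (Gam : R.-pker U ~> U) (rho : R.-pker U ~> V).
Hypothesis GamE : forall x A, Gam x A = embedded_kernel gamma t g x A.
Hypothesis rhoE : forall x, rho x = hold (rate x).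
Context {d : measure_display} {Omega : measurableType d}.
Variables (X : nat -> {mfun Omega >-> U}) (tau : nat -> {mfun Omega >-> V}).
Local Open Scope ereal_scope.

Definition trajectory (w : Omega) : path U V := fun n => (X n w, tau n w).

Lemma measurable_trajectory : measurable_fun setT trajectory.
Proof. by apply: measurable_to_path => n; exact: measurable_funPT. Qed.

Section one_start.
Variables (x : U) (P : probability Omega R).
Hypothesis from_x : lbmjp_from gamma t g X tau x P.

(** The sigma-algebra generated by the X i with i in I, as a type with underlying
   set Omega. *)
Local Notation sigX I := (g_sigma_algebraType
  (\bigcup_(i in I) preimage_set_system [set: Omega] (X i) measurable)).

Let sigX_id I : measurable_fun setT (id : Omega -> sigX I).
Proof.
move=> _ C mC; rewrite setTI preimage_id; move: C mC.
apply: smallest_sub; first exact: sigma_algebra_measurable.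
by move=> _ [i _ [B mB <-]]; exact: measurable_funPT.
Qed.

Let sigX_X (I : set nat) i : I i -> measurable_fun setT (X i : sigX I -> U).
Proof. by move=> Ii _ B mB; apply: sub_sigma_algebra; exists i => //; exists B. Qed.

Let mX n : measurable_fun setT (X n : Omega -> U). Proof. exact: measurable_funPT. Qed.

Let integral_Gam_measurable f : measurable_fun setT f -> (forall y, 0 <= f y) ->
  measurable_fun setT (fun y : U => \int[Gam y]_z f z).
Proof.
by move=> mf f0; apply: measurable_fun_integral_kernel => // B mB; exact: measurable_kernel.
Qed.

(** The transition formula for indicators, extended to functions by equality of
   the two image measures. *)
Let markov_set n F f : sigmaX X [set i | (i <= n)%N] F -> measurable_fun setT f ->
  (forall y, 0 <= f y) ->
  \int[P]_(w in F) f (X n.+1 w) = \int[P]_(w in F) \int[Gam (X n w)]_y f y.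
Proof.
move=> sF; have mF : measurable F.
  by rewrite -[F]setTI; exact: (@sigX_id [set i | (i <= n)%N] measurableT F sF).
have [_ h _] := from_x; move=> mf f0.
have m1F : measurable_fun setT (fun w : Omega => (\1_F w)%:E : \bar R).
  exact/measurable_EFinP/measurable_indic.
have p1F w : 0 <= (\1_F w)%:E :> \bar R by rewrite lee_fin.
pose PF := dens P m1F p1F.
have restr (k : Omega -> \bar R) : measurable_fun setT k -> (forall w, 0 <= k w) ->
    \int[P]_(w in F) k w = \int[PF]_w k w.
  move=> mk k0; rewrite dens_integral// [LHS]integral_mkcond; apply: eq_integral => w _.
  by rewrite patchE indicE; case: ifPn => _; rewrite ?mule1 ?mule0.
have mGf : measurable_fun setT (fun y => \int[Gam y]_z f z).
  exact: integral_Gam_measurable.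
have Gf0 y : 0 <= \int[Gam y]_z f z by exact: integral_ge0.
rewrite (restr (f \o X n.+1)) //; last 2 first.
- exact: measurableT_comp mf (mX n.+1).
- by move=> w; exact: f0.
rewrite (restr ((fun y => \int[Gam y]_z f z) \o X n)) //; last 2 first.
- exact: measurableT_comp mGf (mX n).
- by move=> w; exact: Gf0.
transitivity (\int[pushm PF (mX n.+1)]_y f y).
  by rewrite ge0_integral_pushforward.
transitivity (\int[mixture (pushm PF (mX n)) Gam]_y f y); last first.
  rewrite mixture_integral// ge0_integral_pushforward//.
  by move=> y _; exact: Gf0.
apply: eq_measure_integral => A mA _.
have mXA : measurable (X n.+1 @^-1` A) by rewrite -[X in measurable X]setTI; exact: mX.
transitivity (P (F `&` X n.+1 @^-1` A)); first exact: integral_indic.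
have mGA : measurable_fun setT (Gam ^~ A) by exact: measurable_kernel.
rewrite h//; transitivity (\int[pushm PF (mX n)]_y Gam y A) => //.
rewrite ge0_integral_pushforward//.
transitivity (\int[P]_(w in F) Gam (X n w) A).
  by apply: eq_integral => w _; rewrite GamE.
by apply: (restr ((Gam ^~ A) \o X n)) => //; exact: measurableT_comp mGA (mX n).
Qed.

Let weight (A : nat -> set U) (B : nat -> set V) k (y : U) : \bar R :=
  (\1_(A k) y)%:E * rho y (B k).

Let weight_ge0 A B k y : 0 <= weight A B k y.
Proof. by rewrite mule_ge0// lee_fin. Qed.

Let measurable_weight A B k : measurable (A k) -> measurable (B k) ->
  measurable_fun setT (weight A B k).
Proof.
move=> mA mB; apply: emeasurable_funM; last exact: measurable_kernel.
exact/measurable_EFinP/measurable_indic.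
Qed.

Let mprod (I : set nat) n (h : nat -> U -> \bar R) : (forall k, (k < n)%N -> I k) ->
  (forall k, measurable_fun setT (h k)) ->
  measurable_fun setT (fun w : sigX I => \prod_(k < n) h k (X k w)).
Proof.
move=> hI mh; elim: n hI => [|n ih] hI.
  by rewrite (_ : (fun w => _) = cst 1)//; apply/funext => w; rewrite big_ord0.
rewrite (_ : (fun w => _) = fun w : sigX I => \prod_(k < n) h k (X k w) * h n (X n w)); last first.
  by apply/funext => w; rewrite big_ord_recr.
apply: emeasurable_funM; first by apply: ih => k kn; apply: hI; exact: ltnW.
by apply: measurableT_comp => //; apply: sigX_X; exact: hI.
Qed.

Let prod_ge0 n (h : nat -> U -> \bar R) w : (forall k y, 0 <= h k y) ->
  0 <= \prod_(k < n) h k (X k w).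
Proof. by move=> h0; apply: prode_ge0 => k _. Qed.

(** The Markov property of the embedded chain, iterated from the last step. *)
Let weighted_chain n A B f : (forall k, measurable (A k)) -> (forall k, measurable (B k)) ->
  measurable_fun setT f -> (forall y, 0 <= f y) ->
  \int[P]_w (\prod_(k < n) weight A B k (X k w) * f (X n w)) = fd Gam rho n A B f x.
Proof.
move=> mA mB; elim: n f => [|n ih] f mf f0.
  have [[N [mN N0 hN]] _ _] := from_x.
  rewrite (ge0_ae_eq_integral_nm measurableT mN N0 (g := cst (f x))).
  - by rewrite integral_cst// -[RHS]mule1; congr (_ * _); exact: probability_setT.
  - by move=> w; rewrite big_ord0 mul1e.
  - by move=> w; exact: f0.
  move=> w Nw; rewrite big_ord0 mul1e; congr f.
  by apply: contrapT => h; exact/Nw/hN.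
have E1 : fd Gam rho n.+1 A B f x =
    fd Gam rho n A B (fd Gam rho 1 (fun k => A (n + k)%N) (fun k => B (n + k)%N) f) x.
  rewrite -fd_cat addn1; congr (fd _ _ _ _ _ _); apply/funext => k; rewrite /catf;
    by case: ltnP => // kn; rewrite subnKC.
rewrite E1 -ih; last 2 first.
- by apply: measurable_fd.
- by move=> y; exact: fd_ge0.
pose I := [set i | (i <= n)%N].
transitivity (\int[P]_w (\prod_(k < n.+1) weight A B k (X k w) * \int[Gam (X n w)]_y f y)).
  apply: (@ci_integral _ _ _ _ _ P (id : Omega -> sigX I) (f \o X n.+1)
    (fun w => \int[Gam (X n w)]_y f y) _ _ _ _ _
    (fun w : sigX I => \prod_(k < n.+1) weight A B k (X k w))).
  - exact: sigX_id.
  - exact: measurableT_comp mf (mX _).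
  - by move=> w; exact: f0.
  - exact: measurableT_comp (integral_Gam_measurable mf f0) (mX n).
  - by move=> w; exact: integral_ge0.
  - by apply: mprod => // k; exact: measurable_weight.
  - by move=> w; exact: prod_ge0.
  - by move=> C mC; apply: markov_set.
apply: eq_integral => w _.
by rewrite big_ord_recr/= addn0 -muleA.
Qed.

(** Conditionally on the embedded chain, the holding times contribute the
    factors [rho (X k w) (B k)]. *)
Lemma trajectory_chain_law : chain_law Gam rho x (pushm P measurable_trajectory).
Proof.
move=> n A B f mA mB mf f0.
have [_ _ hT] := from_x.
have mR : measurable (rect n A B : set (path U V)).
  by apply: (@measurable_rects _ _ _ _ n); exists A, B.
have mfX : measurable_fun setT (fun w : path U V => f (coordX n w)).
  by apply: measurableT_comp => //; exact: measurable_coordX.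
rewrite ge0_integral_pushforward//; last 2 first.
- exact: measurable_trajectory.
- exact: measurable_funS mfX.
rewrite -weighted_chain//.
pose T := \bigcap_(k < n) (tau k @^-1` B k).
have mT : measurable T.
  apply: bigcap_measurableType => // k _.
  by rewrite -[X in measurable X]setTI; exact: measurable_funPT.
have expE w k : exp_law (rate (X k w)) (B k) = rho (X k w) (B k).
  by rewrite rhoE hold_exp_law.
pose h k y := (\1_(A k) y)%:E : \bar R.
have mh k : measurable_fun setT (h k) by exact/measurable_EFinP/measurable_indic.
have h0 k y : 0 <= h k y by rewrite lee_fin.
pose G w := \prod_(k < n) h k (X k w) * f (X n w).
transitivity (\int[P]_w (G w * (\1_T w)%:E)).
  rewrite integral_mkcond; apply: eq_integral => w _; rewrite patchE.
  have GE : G w = (\1_(\bigcap_(k < n) (X k @^-1` A k)) w)%:E * f (X n w).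
    rewrite /G; congr (_ * _); rewrite indicE.
    case: (boolP (w \in _)) => hw.
      rewrite big1// => k _; rewrite /h indicE mem_set//.
      by move: hw; rewrite inE => /(_ k (ltn_ord k)).
    have [k hk] : exists k : 'I_n, ~ A k (X k w).
      apply: contrapT => hk; move/negP: hw; apply; rewrite inE => k kn.
      by apply: contrapT => hA; apply: hk; exists (Ordinal kn).
    by rewrite (bigD1 k)//= /h indicE memNset// mul0e.
  rewrite GE indicE; case: ifPn => [|].
    rewrite inE /preimage/= => hw; rewrite !indicE !mem_set ?mul1e ?mule1//.
      by move=> k kn; exact: (hw k kn).2.
    by move=> k kn; exact: (hw k kn).1.
  move=> /negP hw; rewrite indicE.
  case: (boolP (w \in T)) => wT; last by rewrite mule0.
  case: (boolP (w \in _)) => wX; last by rewrite !mul0e.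
  exfalso; apply: hw; move: wT wX; rewrite !inE => wT wX k kn; split; [exact: wX|exact: wT].
transitivity (\int[P]_w (G w * \prod_(k < n) exp_law (rate (X k w)) (B k))); last first.
  apply: eq_integral => w _; rewrite /G -muleA [f _ * _]muleC muleA -big_split/=.
  by congr (_ * _); apply: eq_bigr => k _; rewrite expE.
pose rB k y := rho y (B k).
have prodE w : \prod_(k < n) exp_law (rate (X k w)) (B k) = \prod_(k < n) rB k (X k w).
  by apply: eq_bigr => k _; rewrite expE.
have mrB k : measurable_fun setT (rB k) by exact: measurable_kernel.
apply: (@ci_integral _ _ _ _ _ P (id : Omega -> sigX setT) (fun w => (\1_T w)%:E)
  (fun w => \prod_(k < n) exp_law (rate (X k w)) (B k)) _ _ _ _ _ (G : sigX setT -> \bar R)).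
- exact: sigX_id.
- exact/measurable_EFinP/measurable_indic.
- by move=> w; rewrite lee_fin.
- under eq_fun do rewrite prodE.
  by have := measurableT_comp (@mprod setT n rB (fun _ _ => Logic.I) mrB) (@sigX_id setT).
- by move=> w; rewrite prodE; apply: prod_ge0 => k y; exact: measure_ge0.
- apply: emeasurable_funM; first exact: mprod.
  by apply: measurableT_comp => //; exact: sigX_X.
- by move=> w; rewrite mule_ge0// prod_ge0.
- move=> C mC; have mC' : measurable (C : set Omega).
    by rewrite -[C]setTI; exact: (@sigX_id setT measurableT C mC).
  by rewrite integral_indic// setIC -hT.
Qed.

End one_start.
End trajectory.

(** * The jump process as a function of the trajectory *)

Section path_kernel.
Context {R : realType} {E : ptopologicalType}.
Local Notation U := (borel E).
Local Notation V := (\bar R).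
Variables (gamma : R.-pker U ~> U) (t : U * U -> R) (g : R -> R).
Hypothesis rate_ge0 : forall x, (0 <= jump_rate gamma t g x)%E.
Variables (Gam : R.-pker U ~> U) (rho : R.-pker U ~> V).
Hypothesis GamE : forall x A, Gam x A = embedded_kernel gamma t g x A.
Hypothesis rhoE : forall x, rho x = hold (jump_rate gamma t g x).
Context {d : measure_display} {Omega : measurableType d}.
Variables (X : nat -> {mfun Omega >-> U}) (tau : nat -> {mfun Omega >-> V}).
Variables (K : set U) (P : U -> probability Omega R).
Hypothesis mK : measurable K.
Hypothesis from_K : forall x, K x -> lbmjp_from gamma t g X tau x (P x).
Local Open Scope ereal_scope.

Let dummy : path U V := fun=> (point, 0).

Let path_law (x : U) : {measure set (path U V) -> \bar R} :=
  if x \in K then pushm (P x) (measurable_trajectory X tau)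
  else (\d_dummy : {measure set (path U V) -> \bar R}).

Let path_lawT x : path_law x setT = 1.
Proof.
rewrite /path_law; case: ifP => _; last exact: diracT.
by rewrite /= /pushforward preimage_setT; exact: probability_setT.
Qed.

Let measurable_in_K : measurable_fun setT (fun x : U => x \in K).
Proof.
apply: (measurable_fun_bool true); rewrite setTI.
by rewrite (_ : _ @^-1` _ = K)//; apply/seteqP; split => x /= => [/set_mem|/mem_set].
Qed.

Let measurable_path_law C : measurable C -> measurable_fun setT (path_law ^~ C).
Proof.
move: C; apply: (@dynkin_induction _ (path U V) (\bigcup_n rects n)) => //.
- exact: all_rectsI.
- rewrite (_ : (path_law ^~ setT) = cst 1); first exact: measurable_cst.
  by apply/funext => x; exact: path_lawT.
- move=> _ [n _ [A [B [mA mB ->]]]].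
  have mf : measurable_fun setT (cst 1 : U -> \bar R) by exact: measurable_cst.
  rewrite (_ : path_law ^~ (rect n A B) = fun x => if x \in K then
    fd Gam rho n A B (cst 1) x else \d_dummy (rect n A B)).
    by apply: measurable_fun_ifT => //; apply: measurable_fd.
  apply/funext => x; rewrite /path_law; case: ifPn => //; rewrite inE => Kx.
  apply: chain_law_rect => //; apply: trajectory_chain_law => //; exact: from_K.
- move=> C mC ih; rewrite (_ : (path_law ^~ (~` C)) = fun x => 1 - path_law x C).
    by apply: emeasurable_funB.
  apply/funext => x; have mCC : measurable (~` C) by exact: measurableC.
  have Cfin : path_law x C \is a fin_num.
    rewrite ge0_fin_numE//; apply: (@le_lt_trans _ _ (path_law x setT)).
      by apply: le_measure; rewrite ?inE.
    by rewrite path_lawT ltry.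
  rewrite -(path_lawT x) -(setUv C) measureU//; last exact: setICr.
  by rewrite addeAC subee// add0e.
- move=> F mF tF ih.
  rewrite (_ : (path_law ^~ _) = fun x => \sum_(0 <= i <oo) path_law x (F i)).
    by apply: ge0_emeasurable_sum.
  apply/funext => x; rewrite measure_bigcup//; apply: eq_eseriesl => i.
  exact: mem_set.
Qed.

(** Off [K] nothing is known of [P], and [x |-> P x] may be non-measurable there;
    the kernel takes a constant value off [K]. Measurability follows from the
    finite-dimensional laws by the pi-lambda theorem. *)
Lemma path_pker : exists Q : R.-pker U ~> path U V, forall x, K x ->
  forall C, Q x C = P x (trajectory X tau @^-1` C).
Proof.
exists (pker_of measurable_path_law path_lawT) => x Kx C.
by rewrite -[LHS]/(path_law x C) /path_law mem_set.
Qed.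

End path_kernel.

Section pathwise.
Context {R : realType} {E : ptopologicalType}.
Local Notation U := (borel E).
Local Notation V := (\bar R).
Context {d : measure_display} {Omega : measurableType d}.
Variables (X : nat -> {mfun Omega >-> U}) (tau : nat -> {mfun Omega >-> V}).
Local Open Scope ereal_scope.

Let supremum_max (A : set nat) m : A m -> (forall n, A n -> (n <= m)%N) ->
  supremum 0%N A = m.
Proof.
move=> Am ub.
have sm : supremums A m.
  by split=> [n /ub|n /(_ m Am)]; rewrite leEnat.
rewrite /supremum ifF; last by apply/eqP => A0; move: Am; rewrite A0.
have := xgetPex 0%N (ex_intro _ m sm) => h.
by apply: (@is_subset1_supremums _ _ A).
Qed.

(** For [0] this fails, as it is also the value on empty and on unbounded sets. *)
Let supremum_S (A : set nat) m : supremum 0%N A = m.+1 ->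
  A m.+1 /\ forall n, A n -> (n <= m.+1)%N.
Proof.
rewrite /supremum; case: ifPn => // A0.
case: xgetP => // _ -> [ub lb] E1; rewrite {}E1 in ub lb *.
have ub' n : A n -> (n <= m.+1)%N by move=> /ub; rewrite leEnat.
split => //; apply: contrapT => Am.
have : (m.+1 <= m)%O.
  apply: lb => n An; have := ub' n An; rewrite leEnat leq_eqVlt => /orP[/eqP nm|//].
  by case: Am; rewrite -nm.
by rewrite leEnat ltnn.
Qed.

Let jt n w := jump_time tau n w.

Let jtS n w : jt n.+1 w = jt n w + tau n w.
Proof. by rewrite /jt /jump_time big_ord_recr. Qed.

Let measurable_jt n : measurable_fun setT (jt n).
Proof.
elim: n => [|n ih].
  by rewrite (_ : jt 0 = cst 0)//; apply/funext => w; rewrite /jt /jump_time big_ord0.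
rewrite (_ : jt n.+1 = fun w => jt n w + tau n w); last exact/funext/(jtS n).
by apply: emeasurable_funD => //; exact: measurable_funPT.
Qed.

Let mle n (u : R) : measurable [set w | jt n w <= u%:E].
Proof. by rewrite -[X in measurable X]setTI; exact: emeasurable_fun_infty_c. Qed.

Let mgt n (u : R) : measurable [set w | u%:E < jt n w].
Proof. by rewrite -[X in measurable X]setTI; exact: emeasurable_fun_o_infty. Qed.

Let index (u : R) w := supremum 0%N [set n | jt n w <= u%:E].

Let measurable_index u m : measurable [set w | index u w = m].
Proof.
have mS k : measurable [set w | index u w = k.+1].
  rewrite (_ : [set _ | _] = [set w | jt k.+1 w <= u%:E] `&`
      \bigcap_(n in [set n | (k.+1 < n)%N]) [set w | u%:E < jt n w]).
    by apply: measurableI => //; apply: bigcap_measurableType.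
  apply/seteqP; split => w /=.
    move=> /supremum_S[/= h1 h2]; split => // n /= kn.
    by rewrite ltNge; apply/negP => /h2; rewrite leqNgt kn.
  move=> [h1 h2]; apply: supremum_max => // n /= hn; rewrite leqNgt; apply/negP => kn.
  by have := h2 n kn; rewrite /= ltNge hn.
case: m => [|m]//.
rewrite (_ : [set _ | _] = ~` \bigcup_k [set w | index u w = k.+1]).
  by apply: measurableC; exact: bigcupT_measurable.
apply/seteqP; split => w /=; first by move=> h [k _ /=]; rewrite h.
move=> h; case E1 : (index u w) => [|k]//.
by exfalso; apply: h; exists k.
Qed.

(** The index of the current state is a supremum of a set of integers, and each
    of its positive values is described by countably many comparisons of jump
    times with [u]. *)
Lemma measurable_lbmjp_in u B : measurable B -> measurable (lbmjp_in X tau u B).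
Proof.
move=> mB.
rewrite (_ : lbmjp_in X tau u B = (\bigcup_n [set w | u%:E < jt n w]) `&`
    \bigcup_m ([set w | index u w = m] `&` (X m @^-1` B))).
  apply: measurableI; first exact: bigcupT_measurable.
  apply: bigcupT_measurable => m; apply: measurableI; first exact: measurable_index.
  by rewrite -[X in measurable X]setTI; exact: measurable_funPT.
rewrite /lbmjp_in /lbmjp; apply/seteqP; split => w /=.
  move=> [y]; case: ifPn => // /ereal_sup_gtP[_ [n _ <-] hn] [<-] By.
  by split; [exists n|exists (index u w)].
move=> [[n _ hn] [m _ [im Bm]]]; exists (X m w) => //.
rewrite ifT; last by apply/ereal_sup_gtP; exists (jt n w) => //; exists n.
by congr (Some (X _ w)).
Qed.

Let jt_nd n n' w : (n <= n')%N -> (forall k, (k < n')%N -> 0 <= tau k w) ->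
  jt n w <= jt n' w.
Proof.
move=> /subnKC <-; elim: (n' - n)%N => [|k ih] h; first by rewrite addn0.
rewrite addnS jtS (le_trans (ih _))//.
  by move=> i ik; apply: h; rewrite addnS ltnW.
by rewrite leeDl// h// addnS.
Qed.

Lemma at_time_disjoint n n' u (A B : set U) w : at_time n u A (trajectory X tau w) ->
  at_time n' u B (trajectory X tau w) -> n = n'.
Proof.
move=> [t0 h1 h2 _] [t0' h1' h2' _]; apply/eqP; rewrite eqn_leq; apply/andP; split;
  rewrite leqNgt; apply/negP => nn'.
- have := @jt_nd _ _ w nn' (fun k kn => t0 k (ltnW kn)); rewrite leNgt => /negP; apply.
  exact: le_lt_trans h2'.
- have := @jt_nd _ _ w nn' (fun k kn => t0' k (ltnW kn)); rewrite leNgt => /negP; apply.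
  exact: le_lt_trans h2.
Qed.

Variable w : Omega.
Hypothesis tau0 : forall k, 0 <= tau k w.

Lemma lbmjp_between n (u : R) : jump_time tau n w <= u%:E ->
  u%:E < jump_time tau n.+1 w -> lbmjp X tau u w = Some (X n w).
Proof.
move=> h1 h2; rewrite /lbmjp ifT; last by apply/ereal_sup_gtP; exists (jump_time tau n.+1 w) => //; exists n.+1.
congr (Some (X _ w)); apply: supremum_max => // k /= hk; rewrite leqNgt; apply/negP => nk.
have := @jt_nd _ _ w nk (fun k _ => tau0 k); rewrite leNgt => /negP; apply.
exact: le_lt_trans h2.
Qed.

Lemma lbmjp_alive (u : R) : (0 <= u)%R -> (exists n, u%:E < jump_time tau n w) ->
  exists n, jump_time tau n w <= u%:E /\ u%:E < jump_time tau n.+1 w.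
Proof.
move=> u0 hn; have [n hn1 hmin] := ex_minnP hn.
case: n hn1 hmin => [|n] hn1 hmin.
  by move: hn1; rewrite /jump_time big_ord0 lte_fin ltNge u0.
exists n; split => //; rewrite leNgt; apply/negP => /hmin.
by rewrite ltnn.
Qed.

Lemma lbmjp_in_at_time u B : (0 <= u)%R ->
  lbmjp_in X tau u B w <-> exists n, at_time n u B (trajectory X tau w).
Proof.
move=> u0; split.
  rewrite /lbmjp_in/= => -[y].
  case: (boolP (u%:E < ereal_sup (range (jump_time tau ^~ w)))) => [|h]; last first.
    by rewrite /lbmjp (negbTE h).
  move=> /ereal_sup_gtP[_ [n _ <-] hn].
  have [k [h1 h2]] := lbmjp_alive u0 (ex_intro _ n hn).
  rewrite (lbmjp_between h1 h2) => -[<-] By; exists k; split => // i _; exact: tau0.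
move=> [n [_ h1 h2 Bn]]; exists (X n w) => //; exact: lbmjp_between.
Qed.

End pathwise.

(** * Long-time behaviour under the invariant law *)

Lemma ae_eq_measure {d} {T : measurableType d} {R : realType}
    (mu : {measure set T -> \bar R}) (A B : set T) : measurable A -> measurable B ->
  {ae mu, forall w, A w <-> B w} -> mu A = mu B.
Proof.
move=> mA mB AB; rewrite -(setIT A) -(setIT B) -!integral_indic//.
apply: ge0_ae_eq_integral => //.
- exact/measurable_EFinP/measurable_indic.
- exact/measurable_EFinP/measurable_indic.
apply: filterS AB => x AB _; rewrite !indicE; congr (nat_of_bool _)%:R%:E.
by apply/idP/idP => /set_mem /AB /mem_set.
Qed.

Section conclusion.
Context {R : realType} {E : ptopologicalType}.
Local Notation U := (borel E).
Local Notation V := (\bar R).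
Context {d : measure_display} {Omega : measurableType d}.
Variables (X : nat -> {mfun Omega >-> U}) (tau : nat -> {mfun Omega >-> V}).
Variables (pi : probability U R) (P : U -> probability Omega R).
Local Open Scope ereal_scope.
Variables (Gam : R.-pker U ~> U) (rho : R.-pker U ~> V).
Variables (Q : R.-pker U ~> path U V) (K : set U).
Hypotheses (mK : measurable K) (pi_KC : pi (~` K) = 0).
Hypothesis law : forall x, K x -> chain_law Gam rho x (Q x).
Hypothesis QP : forall x, K x -> forall C, Q x C = P x (trajectory X tau @^-1` C).
Variable lam : U -> R.
Hypotheses (mlam : measurable_fun setT lam) (lam0 : forall x, (0 <= lam x)%R).
Hypothesis rho_lam : {ae pi, forall x, (0 < lam x)%R /\
  forall A, measurable A -> rho x A = hold (lam x)%:E A}.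
Hypothesis lam_sym : forall A B, measurable A -> measurable B ->
  \int[pi]_(x in A) ((lam x)%:E * Gam x B) = \int[pi]_(x in B) ((lam x)%:E * Gam x A).
Variables (Lam : R) (m : probability U R).
Hypothesis Lam0 : (0 < Lam)%R.
Hypothesis m_pi : forall A, measurable A -> m A = \int[pi]_(x in A) (lam x / Lam)%:E.
Hypothesis m_inv : forall A, measurable A -> \int[m]_x Gam x A = m A.
Variable phi : {measure set U -> \bar R}.
Hypothesis phi_nontrivial : 0 < phi setT.
Hypothesis irreducible : forall x, K x -> forall B, measurable B -> 0 < phi B ->
  exists n, 0 < P x (X n @^-1` B).
Variable a : nat -> set U.
Hypothesis ma : forall i, measurable (a i).
Hypothesis a_gen : @measurable _ U = <<s range a >>.
Hypothesis a0 : range a set0.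
Hypothesis aC : setC_closed (range a).
Hypothesis aU : setU_closed (range a).

Let mlamL : measurable_fun setT (fun x => (lam x / Lam)%:E).
Proof. by apply/measurable_EFinP; exact: measurable_funM. Qed.

Let lamL0 x : 0 <= (lam x / Lam)%:E. Proof. by rewrite lee_fin divr_ge0// ltW. Qed.

Let pi_to_m (Pr : U -> Prop) : {ae pi, forall x, Pr x} -> {ae m, forall x, Pr x}.
Proof.
move=> [N [mN N0 hN]]; exists N; split => //.
by rewrite m_pi//; apply: null_set_integral => //; exact: measurable_funS mlamL.
Qed.

Let m_to_pi (Pr : U -> Prop) : {ae m, forall x, Pr x} -> {ae pi, forall x, Pr x}.
Proof.
move=> [N [mN N0 hN]].
pose f x := (lam x / Lam)%:E * (\1_N x)%:E : \bar R.
have mf : measurable_fun setT f.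
  by apply: emeasurable_funM => //; exact/measurable_EFinP/measurable_indic.
have f0 x : 0 <= f x by rewrite mule_ge0// lee_fin.
have intf : \int[pi]_x f x = 0.
  rewrite -N0 m_pi// [RHS]integral_mkcond; apply: eq_integral => x _.
  by rewrite patchE /f indicE; case: ifPn; rewrite ?mule1 ?mule0.
apply: filterS2 (ge0_integral_eq0_ae mf f0 intf) rho_lam => x fx [lx _].
apply: contrapT => /hN Nx; move: fx; rewrite /f indicE mem_set// mule1.
by move=> -[] /eqP; rewrite mulf_eq0 invr_eq0 !gt_eqF.
Qed.

Let m_KC : m (~` K) = 0.
Proof.
have mKC : measurable (~` K) by exact: measurableC.
by rewrite m_pi//; apply: null_set_integral => //; exact: measurable_funS mlamL.
Qed.

Let irreducible_Q x : K x -> forall B, measurable B -> 0 < phi B ->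
  exists n, 0 < Q x (coordX n @^-1` B).
Proof. by move=> Kx B mB /(irreducible Kx mB)[n hn]; exists n; rewrite QP. Qed.

Let ae_trajectory x (Pr : path U V -> Prop) : K x -> {ae Q x, forall w, Pr w} ->
  {ae P x, forall w, Pr (trajectory X tau w)}.
Proof.
move=> Kx [N [mN N0 hN]]; exists (trajectory X tau @^-1` N); split.
- by rewrite -[X in measurable X]setTI; exact: measurable_trajectory.
- by move: N0; rewrite QP.
- by move=> w /= hw; exact: hN.
Qed.

(** The starting points for which every conclusion holds. *)
Let regular x := [/\ K x,
  {ae P x, forall w k, 0 < tau k w /\ tau k w < +oo} &
  forall f : U -> R, measurable_fun setT f -> (forall y, (0 <= f y)%R) ->
    \int[pi]_y (f y)%:E < +oo ->
    {ae P x, forall w, ((\sum_(k < n) f (X k w) * fine (tau k w)) / n%:R)%R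
      @[n --> \oo] --> (fine (\int[pi]_y (f y)%:E) / Lam)%R}].

Let ae_regular : {ae pi, forall x, regular x}.
Proof.
apply: m_to_pi.
have lam_gt0 : {ae pi, forall x, (0 < lam x)%R} by apply: filterS rho_lam => x [].
have := time_average mK law m_inv m_KC phi_nontrivial irreducible_Q ma a_gen a0 aC aU
  mlam lam0 (pi_to_m rho_lam) Lam0 m_pi lam_gt0.
apply: filterS2 (ae_K mK m_KC) => x Kx [h1 h2]; split => //.
  exact: (ae_trajectory Kx h1).
by move=> f mf f0 fi; have := ae_trajectory Kx (h2 f mf f0 fi).
Qed.

Let holding_average x : regular x -> {ae P x, forall w,
  (forall k, 0 < tau k w /\ tau k w < +oo) /\
  ((\sum_(k < n) fine (tau k w)) / n%:R)%R @[n --> \oo] --> (Lam^-1)%R}.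
Proof.
move=> [Kx hpos hf].
have h1 : \int[pi]_y (cst 1%R y : R)%:E = 1.
  by rewrite (integral_cst pi measurableT 1) mul1e; exact: probability_setT.
have := hf (cst 1%R) (measurable_cst _) (fun=> ler01); rewrite [X in X < _]h1 => /(_ (ltry _)).
rewrite [X in fine X]h1 mul1r; apply: filterS2 hpos => w hw hcv; split => //.
suff -> : (fun n => (\sum_(k < n) fine (tau k w)) / n%:R)%R =
  (fun n => (\sum_(k < n) cst 1%R (X k w) * fine (tau k w)) / n%:R)%R by exact: hcv.
by apply/funext => n; congr (_ / _)%R; apply: eq_bigr => k _; rewrite mul1r.
Qed.

Let jump_timeE w n : (forall k, 0 < tau k w /\ tau k w < +oo) ->
  jump_time tau n w = (\sum_(k < n) fine (tau k w))%:E.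
Proof.
move=> hw; rewrite /jump_time -sumEFin; apply: eq_bigr => k _.
have [h1 h2] := hw k; rewrite fineK// ge0_fin_numE// ltW//.
Qed.

Let fine_tau_ge0 w : (forall k, 0 < tau k w /\ tau k w < +oo) ->
  forall k, (0 <= fine (tau k w))%R.
Proof. by move=> hw k; apply: fine_ge0; rewrite ltW//; case: (hw k). Qed.

Let iLam0 : (0 < Lam^-1)%R. Proof. by rewrite invr_gt0. Qed.

(** The averages of the holding times tend to [Lam^-1 > 0]. *)
Lemma nonexplosive_ae : {ae pi, forall x, nonexplosive tau (P x)}.
Proof.
apply: filterS ae_regular => x /holding_average; apply: filterS => w [hw hT].
apply/eqyP => A A0.
have [n /ltW hn] := times_unbounded (fine_tau_ge0 hw) iLam0 hT A.
apply: (@le_trans _ _ (jump_time tau n w)); first by rewrite jump_timeE// lee_fin.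
rewrite /jump_time -(big_mkord xpredT (fun k => tau k w)).
by apply: nneseries_lim_ge => k _ _; rewrite ltW//; case: (hw k).
Qed.

(** The average of [f] along the process is the ratio of the averages, over the
    jumps, of [f (X k) * tau k] and of [tau k]. *)
Lemma ergodic_ae : {ae pi, forall x, lbmjp_ergodic_from X tau pi P x}.
Proof.
apply: filterS ae_regular => x reg f fint; have [Kx _ hf] := reg.
have mf : measurable_fun setT f by apply/measurable_EFinP; exact: measurable_int fint.
pose fp y := Num.max (f y) 0%R; pose fm y := Num.max (- f y)%R 0%R.
have fp0 y : (0 <= fp y)%R by rewrite le_max lexx orbT.
have fm0 y : (0 <= fm y)%R by rewrite le_max lexx orbT.
have mfp : measurable_fun setT fp by exact: measurable_maxr.
have mfm : measurable_fun setT fm by apply: measurable_maxr => //; exact: measurableT_comp.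
have Ep : \int[pi]_y (fp y)%:E = \int[pi]_y ((EFin \o f)^\+ y).
  by apply: eq_integral => y _; rewrite funeposE /fp EFin_max.
have Em : \int[pi]_y (fm y)%:E = \int[pi]_y ((EFin \o f)^\- y).
  by apply: eq_integral => y _; rewrite funenegE /fm EFin_max.
have ip : \int[pi]_y (fp y)%:E < +oo by rewrite Ep; exact: integral_funepos_lt_pinfty.
have im : \int[pi]_y (fm y)%:E < +oo by rewrite Em; exact: integral_funeneg_lt_pinfty.
have finp : \int[pi]_y (fp y)%:E \is a fin_num.
  by rewrite ge0_fin_numE// integral_ge0// => y _; rewrite lee_fin.
have finm : \int[pi]_y (fm y)%:E \is a fin_num.
  by rewrite ge0_fin_numE// integral_ge0// => y _; rewrite lee_fin.
have lim_f : \int[pi]_y (f y)%:E = (fine (\int[pi]_y (fp y)%:E) / Lam / Lam^-1 -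
    fine (\int[pi]_y (fm y)%:E) / Lam / Lam^-1)%:E.
  rewrite invrK !divfK ?gt_eqF//.
  by rewrite EFinB !fineK// Ep Em -integralE.
have := hf fp mfp fp0 ip; have := hf fm mfm fm0 im; have := holding_average reg.
apply: filterS3 => w [hw hT] hm hp; rewrite lim_f.
apply: (signed_path_average_cvg (fine_tau_ge0 hw) _ iLam0 hT hp hm) => n u /andP[h1 h2].
rewrite (@lbmjp_between _ _ _ _ X tau w _ n)//.
- by move=> k; rewrite ltW//; case: (hw k).
- by rewrite jump_timeE// lee_fin.
- by rewrite jump_timeE// lte_fin.
Qed.

(** Disjoint union over the number of jumps up to time [u]. *)
Let occupation (u : R) B : (0 <= u)%R -> measurable B ->
  {ae pi, forall x, P x (lbmjp_in X tau u B) = \sum_(n <oo) renew Gam lam n B (u, x)}.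
Proof.
move=> u0 mB.
have h : {ae pi, forall x n, Q x (at_time n u B) = renew Gam lam n B (u, x)}.
  apply: m_to_pi; apply/ae_foralln => n.
  have := at_time_renew mK law m_inv m_KC mlam lam0 (pi_to_m rho_lam) n mB.
  by apply: filterS => x; exact.
apply: filterS2 ae_regular h => x [Kx hpos _] hx.
pose F n := trajectory X tau @^-1` (at_time n u B).
have mF n : measurable (F n).
  rewrite -[X in measurable X]setTI; apply: measurable_trajectory => //.
  exact: measurable_at_time.
rewrite (@ae_eq_measure _ _ _ (P x) _ (\bigcup_n F n)).
- rewrite measure_bigcup//.
    transitivity (\sum_(n <oo) P x (F n)).
      by apply: eq_eseriesl => n; exact: mem_set.
    by apply: eq_eseriesr => n _; rewrite -hx QP.
  apply/trivIsetP => i j _ _ ij; rewrite -subset0 => w [/= h1 h2].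
  by move/eqP: ij; apply; exact: at_time_disjoint h1 h2.
- exact: measurable_lbmjp_in.
- exact: bigcupT_measurable.
- apply: filterS hpos => w hw.
  have tau0 k : 0 <= tau k w by rewrite ltW//; case: (hw k).
  rewrite (lbmjp_in_at_time X tau0 B u0).
  by split => [[n hn]|[n _ hn]]; exists n.
Qed.

Let renew_meas n B u : measurable B -> measurable_fun setT (fun x => renew Gam lam n B (u, x)).
Proof.
move=> mB; have [mr _] := mge0_renew Gam mlam lam0 n mB.
exact: measurableT_comp mr (measurable_pair1 u).
Qed.

Let renew_ge0 n B u x : measurable B -> 0 <= renew Gam lam n B (u, x).
Proof. by move=> mB; have [_] := mge0_renew Gam mlam lam0 n mB. Qed.

Let integral_occupation u A B : (0 <= u)%R -> measurable A -> measurable B ->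
  \int[pi]_(x in A) P x (lbmjp_in X tau u B) =
  \sum_(n <oo) \int[pi]_(x in A) renew Gam lam n B (u, x).
Proof.
move=> u0 mA mB; have [N [mN N0 hN]] := occupation u0 mB.
rewrite (ge0_ae_eq_integral_nm mA mN N0
  (g := fun x => \sum_(n <oo) renew Gam lam n B (u, x))).
- rewrite integral_nneseries//.
  + by move=> n; apply: measurable_funS (renew_meas n u mB).
  + by move=> n x _; exact: renew_ge0.
- by move=> x; exact: measure_ge0.
- by move=> x; apply: nneseries_ge0 => n _ _; exact: renew_ge0.
by move=> x Nx; apply: contrapT => hx; exact/Nx/hN.
Qed.

Lemma reversible : lbmjp_reversible X tau pi P.
Proof.
move=> u u0 A B mA mB; rewrite !integral_occupation//.
by apply: eq_eseriesr => n _; exact: renew_sym.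
Qed.

(** Reversibility against the whole space, since the process is almost surely
    alive at time [u]. *)
Lemma invariant : lbmjp_invariant X tau pi P.
Proof.
move=> u u0 B mB; rewrite (reversible u0 measurableT mB).
have alive : {ae pi, forall x, P x (lbmjp_in X tau u setT) = 1}.
  apply: filterS ae_regular => x reg.
  rewrite (@ae_eq_measure _ _ _ (P x) _ setT).
  - exact: probability_setT.
  - exact: measurable_lbmjp_in.
  - exact: measurableT.
  apply: filterS (holding_average reg) => w [hw hT]; split => // _.
  have tau0 k : 0 <= tau k w by rewrite ltW//; case: (hw k).
  have [n hn] := times_unbounded (fine_tau_ge0 hw) iLam0 hT u.
  have hn' : u%:E < jump_time tau n w by rewrite jump_timeE// lte_fin.
  have [k [h1 h2]] := lbmjp_alive u0 (ex_intro _ n hn').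
  by exists (X k w) => //; exact: lbmjp_between.
have [N [mN N0 hN]] := alive.
rewrite (ge0_ae_eq_integral_nm mB mN N0 (g := cst 1)).
- by rewrite integral_cst// mul1e.
- by move=> x; exact: measure_ge0.
- by [].
by move=> x Nx; apply: contrapT => hx; exact/Nx/hN.
Qed.

End conclusion.

(** * Conclusion *)

Unset Implicit Arguments.

Theorem theorem2p1 (R : realType) (E : ptopologicalType) (E_polish : polish R E)
    (pi : probability (borel E) R) (gamma : R.-pker (borel E) ~> (borel E))
    (t : borel E * borel E -> R) (t_ratio : is_ratio pi gamma t)
    (g : R -> R) (g_balancing : balancing g)
    (d : measure_display) (Omega : measurableType d)
    (P : borel E -> probability Omega R)
    (X : nat -> {mfun Omega >-> borel E})
    (tau : nat -> {mfun Omega >-> \bar R})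
    (Y_lbmjp : forall x, topsupp pi x -> lbmjp_from gamma t g X tau x (P x))
    (rate_gt0 : forall x, topsupp pi x -> (0 < jump_rate gamma t g x)%E)
    (g_nondecreasing : forall r s : R, 0 <= r -> r <= s -> g r <= g s)
    (g_continuous : {within [set s : R | 0 <= s], continuous g})
    (phi : {measure set (borel E) -> \bar R})
    (phi_nontrivial : (0 < phi setT)%E)
    (X_irreducible : forall x, topsupp pi x ->
       forall B : set (borel E), measurable B -> (0 < phi B)%E ->
       exists n, (0 < P x (X n @^-1` B))%E) :
  {ae pi, forall x, nonexplosive tau (P x)} /\
  (lbmjp_reversible X tau pi P /\ lbmjp_invariant X tau pi P) /\
  {ae pi, forall x, lbmjp_ergodic_from X tau pi P x}.
Proof.
have [b [b_open b_base]] := polish_base E_polish.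
have [a [ma a_gen a0 aC aU]] := countable_algebra b_open b_base.
have mK := measurable_topsupp b_open b_base pi.
have KC := topsupp_full b_open b_base pi.
have [Gam GamE] := embedded_pker t_ratio g_balancing.
have [rho rhoE] := holding_pker t_ratio g_balancing.
have rate0 := jump_rate_ge0 t_ratio g_balancing.
have [Q QP] := path_pker rate0 GamE rhoE mK Y_lbmjp.
have law x : topsupp pi x -> chain_law Gam rho x (Q x).
  move=> Kx n A B f mA mB mf f0.
  rewrite -(trajectory_chain_law rate0 GamE rhoE (Y_lbmjp x Kx) n mA mB mf f0).
  by apply: eq_measure_integral => C mC _; exact: QP.
have rate_ae : {ae pi, forall x, (0 < jump_rate gamma t g x)%E}.
  by apply: filterS (ae_K mK KC) => x; exact: rate_gt0.
have mlam := measurable_lam t_ratio g_balancing.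
have lam0 := lam_ge0 t_ratio g_balancing.
have lamE := lam_rate t_ratio g_balancing g_nondecreasing rate_ae.
have lam_sym := flow_sym t_ratio g_balancing g_nondecreasing rate_ae GamE.
have [Lam [m [Lam0 m_pi m_inv]]] :=
  embedded_invariant_law t_ratio g_balancing g_nondecreasing rate_ae GamE.
have rho_lam : {ae pi, forall x, 0 < fine (jump_rate gamma t g x) /\
    forall A, measurable A -> rho x A = hold (fine (jump_rate gamma t g x))%:E A}.
  by apply: filterS lamE => x [l0 lE]; split => // A _; rewrite rhoE lE.
split; [|split; [split|]].
- exact: (nonexplosive_ae mK KC law QP mlam lam0 rho_lam Lam0 m_pi m_inv phi_nontrivial
    X_irreducible ma a_gen a0 aC aU).
- exact: (reversible mK KC law QP mlam lam0 rho_lam lam_sym Lam0 m_pi m_inv phi_nontrivial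
    X_irreducible ma a_gen a0 aC aU).
- exact: (invariant mK KC law QP mlam lam0 rho_lam lam_sym Lam0 m_pi m_inv phi_nontrivial
    X_irreducible ma a_gen a0 aC aU).
- exact: (ergodic_ae mK KC law QP mlam lam0 rho_lam Lam0 m_pi m_inv phi_nontrivial
    X_irreducible ma a_gen a0 aC aU).
Qed.
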